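(* For $A=0$, the non-zero spectrum of the Mathieu–Hankel operator $\mathbf H(0)$ consists only of infinitely many eigenvalues, each of infinite multiplicity.
   Context: Fix $T>0$, $\omega=2\pi/T$. For $A\in\mathbb R$, the Mathieu–Hankel operator $\mathbf H(A)$ is the Hankel operator on $L^2(\mathbb R_+)$, $(\mathbf H(A)f)(t)=\int_0^\infty h_A(t+s)f(s)ds$, with $h_A(t)=p_A(\log t)/t$ and $p_A(\xi)=A+\operatorname{Re}\big(\Gamma(1-i\omega)e^{i\omega\xi}\big)$. Equivalently, its Floquet–Bloch fiber operators $H(k;A)$ on $\ell^2(\mathbb Z)$ have matrices $[H(k;A)]_{n,m}=\overline{\gamma_n(k)}\,\mathfrak s_{n-m}\,\gamma_m(k)$ with $\gamma_n(k)=\Gamma(\frac12+i(\omega n+k))$, $\mathfrak s_0=A$, $\mathfrak s_{\pm1}=\frac12$, $\mathfrak s_j=0$ otherwise. *)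

(* Defs.v *)
From HB Require Import structures.
From mathcomp Require Import all_boot all_order all_algebra.
From mathcomp Require Import all_classical all_reals all_analysis.
From mathcomp Require Import complex.
Set Implicit Arguments. Unset Strict Implicit. Unset Printing Implicit Defensive.
Import Order.TTheory GRing.Theory Num.Theory.
Local Open Scope classical_set_scope.
Local Open Scope ring_scope.

Section MathieuHankel.
Variable R : realType.

Local Notation C := (complex R).
Local Notation leb := (@lebesgue_measure R).

Definition Rpos : set R := `]0, +oo[%classic.

(* Euler's Gamma function for Re z > 0:
   Gamma(z) = \int_0^oo t^(z-1) e^(-t) dt, with
   t^(z-1) = t^(Re z - 1) (cos(Im z ln t) + i sin(Im z ln t)). *)
Definition GammaC (z : C) : C :=
  complex.Complex
    (Rintegral leb Rpos (fun t => t `^ (complex.Re z - 1) * expR (- t)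
                                   * cos (complex.Im z * ln t)))
    (Rintegral leb Rpos (fun t => t `^ (complex.Re z - 1) * expR (- t)
                                   * sin (complex.Im z * ln t))).

Definition expi (x : R) : C := complex.Complex (cos x) (sin x).

Definition omega (T : R) : R := 2 * pi / T.

Definition pA (T A : R) (xi : R) : R :=
  A + complex.Re (GammaC (complex.Complex 1 (- omega T)) * expi (omega T * xi)).

Definition hA (T A : R) (t : R) : R := pA T A (ln t) / t.

(* complex-valued functions on R_+ (values outside R_+ are irrelevant) *)
Definition inL2 (f : R -> C) : Prop :=
  measurable_fun Rpos (fun t => complex.Re (f t)) /\
  measurable_fun Rpos (fun t => complex.Im (f t)) /\
  leb.-integrable Rpos
     (fun t => ((complex.Re (f t)) ^+ 2 + (complex.Im (f t)) ^+ 2)%:E).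

Definition aeq (f g : R -> C) : Prop :=
  leb.-negligible [set t | Rpos t /\ f t <> g t].

(* the Mathieu-Hankel operator H(A):
   (H f)(t) = \int_0^oo h_A(t+s) f(s) ds  (real kernel, so split into Re/Im) *)
Definition MH (T A : R) (f : R -> C) : R -> C := fun t =>
  complex.Complex
    (Rintegral leb Rpos (fun s => hA T A (t + s) * complex.Re (f s)))
    (Rintegral leb Rpos (fun s => hA T A (t + s) * complex.Im (f s))).

(* lambda is in the resolvent set iff H - lambda is a bijection of L^2(R_+)
   (modulo a.e. equality); the spectrum is its complement. *)
Definition in_spectrum (T A : R) (lam : C) : Prop :=
  ~ ( (forall f, inL2 f -> aeq (fun t => MH T A f t - lam * f t) (fun=> 0) ->
                 aeq f (fun=> 0)) /\
      (forall g, inL2 g -> exists2 f, inL2 f &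
                 aeq (fun t => MH T A f t - lam * f t) g) ).

Definition eigenvalue_infinite_mult (T A : R) (lam : C) : Prop :=
  forall n : nat, exists F : 'I_n -> R -> C,
    (forall i, inL2 (F i) /\ aeq (MH T A (F i)) (fun t => lam * F i t)) /\
    (forall c : 'I_n -> C,
        aeq (fun t => \sum_(i < n) c i * F i t) (fun=> 0) -> forall i, c i = 0).

End MathieuHankel.

(* Main.v *)
Require Import Defs.
From HB Require Import structures.
From mathcomp Require Import all_boot all_order all_algebra.
From mathcomp Require Import all_classical all_reals all_analysis.
From mathcomp Require Import measurable_realfun lebesgue_integral_under.
From mathcomp Require Import complex ring lra.
Set Implicit Arguments. Unset Strict Implicit. Unset Printing Implicit Defensive.
Import Order.TTheory GRing.Theory Num.Theory.
Import numFieldNormedType.Exports.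
Local Open Scope classical_set_scope.
Local Open Scope ring_scope.

(* In logarithmic variables the Laplace transform of the half line becomes an operator
   [laplace] of L^2(R) whose square is the convolution [S] with 1 / (2 cosh (x / 2)), and
   H(0) = laplace c laplace, where c is the multiplication by cos (w x). So the nonzero
   spectrum of H(0) is that of K = S c. Let d be the multiplication by sin (w x), Q = e^(pi w)
   and R_w = Q K d - d K. The shift relations of the symbol 1 / cosh (pi xi) of S give
     K R_w = Q R_w K   and   R_(-w) R_w = const (K^2 - (Q / pi^2) K^4).
   Hence K - l is invertible as soon as K - Q l is, unless Q l^2 = pi^2; as K - Q^N l is
   invertible for N large, the nonzero spectrum consists of numbers +- pi Q^(-1/2 - n).
   Conversely the Gaussians centred at the points of (T / 2) Z are eigenfunctions of K for
   the eigenvalues +- pi Q^(-1/2), and R_(-w)^n moves them to the level n. *)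

(** * Integration on the real line *)

(** By [K R_w = Q R_w K], [R_w] climbs from an eigenvalue [l] to [Q l] unless it kills the
    eigenfunction, and [R_(-w)] descends. The norm of [K] is at most [pi], so every climb stops. The
    product [R_(-w) R_w] shows where: its value [l^2 - (Q / pi^2) l^4] vanishes, for [l] nonzero,
    only at [l^2 = pi^2 / Q], the top level. Knowing the eigenfunctions does not exclude other kinds
    of spectrum, so the ladder has to act on resolvents. A solution of the equation for [Q l] is
    pushed down by [R_(-w)] and corrected by a polynomial in [K]. This is pure algebra, and the
    Neumann series supplies the starting point at large parameters. The function space is chosen to
    keep everything pointwise. [K] acts on bounded square-integrable functions, where each integral
    converges at every point. The Laplace transform sends all of [L^2] into this space, so
    almost-everywhere equations on the half line become genuine equations for [K]. The passage
    between [H(0)] and [K] is the classical comparison of [A B] with [B A] away from 0, with [B] the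
    Laplace transform and [A] its composite with [c]. *)

Section IntegralsOnTheLine.
Variable R : realType.
Implicit Types (f g u v : R -> R).
Notation leb := (@lebesgue_measure R).
Notation Lint f := (leb.-integrable setT (EFin \o f)).

Lemma integrable_dominated f g : measurable_fun setT f -> Lint g ->
  (forall x, `|f x| <= g x) -> Lint f.
Proof.
move=> mf ig fg; apply: (le_integrable _ _ _ ig) => //.
  exact/measurable_EFinP.
by move=> x _ /=; rewrite lee_fin (le_trans (fg x))// ler_norm.
Qed.

Lemma measurable_integrable f : Lint f -> measurable_fun setT f.
Proof. by move=> /(measurable_int _) /measurable_EFinP. Qed.

Lemma integrableD_fun f g : Lint f -> Lint g -> Lint (fun x => f x + g x).
Proof. by move=> fi gi; have := integrableD measurableT fi gi. Qed.

Lemma integrableB_fun f g : Lint f -> Lint g -> Lint (fun x => f x - g x).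
Proof. by move=> fi gi; have := integrableB measurableT fi gi. Qed.

Lemma integrableZ_fun k f : Lint f -> Lint (fun x => k * f x).
Proof. by move=> fi; have := integrableZl measurableT k fi. Qed.

Lemma integrable_bounded_mul f g B : Lint f -> measurable_fun setT g ->
  (forall x, `|g x| <= B) -> Lint (fun x => f x * g x).
Proof.
move=> fi mg gB.
have fn : Lint (fun x => B * `|f x|).
  by apply: integrableZ_fun; apply: integrable_norm.
apply: integrable_dominated fn _.
  by apply: measurable_funM => //; exact: measurable_integrable.
by move=> x; rewrite normrM mulrC ler_wpM2r.
Qed.

Lemma integrable_bounded_mull f g B : Lint f -> measurable_fun setT g ->
  (forall x, `|g x| <= B) -> Lint (fun x => g x * f x).
Proof.
move=> fi mg gB; rewrite (_ : (fun _ => _) = (fun x => f x * g x)).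
  exact: integrable_bounded_mul gB.
by apply/funext => x; rewrite mulrC.
Qed.

Lemma le_norm_int f g : measurable_fun setT f -> Lint g ->
  (forall x, `|f x| <= g x) -> `|\int[leb]_x f x| <= \int[leb]_x g x.
Proof.
move=> mf ig fg; have fi := integrable_dominated mf ig fg.
apply: le_trans (le_normr_Rintegral measurableT fi) _.
by apply: le_Rintegral => //; exact: integrable_norm.
Qed.

Lemma measurable_affinity (k b : R) :
  measurable_fun [set: measurableTypeR R]
    (fun x : measurableTypeR R => k * x + b : measurableTypeR R).
Proof. by apply: measurable_funD => //; apply: measurable_funM. Qed.

Definition affine_image (k b : R) : {measure set (measurableTypeR R) -> \bar R} :=
  measure_function_pushforward__canonical__measure_function_Measure
    leb (measurable_affinity k b).

(** Lebesgue measure is determined by its values on half-open intervals. A negative [k] reverses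
    them, hence two cases whose preimages are closed at opposite ends. *)
Lemma lebesgue_affine (k b : R) (k0 : k != 0) (A : set R) : measurable A ->
  leb A = mscale (NngNum (normr_ge0 k)) (affine_image k b) A.
Proof.
move=> mA; apply: lebesgue_measure_unique => // X [[x y] _ <-] /=.
rewrite /mscale/= /pushforward/=.
have [kn|kp] : k < 0 \/ 0 < k by apply/orP; rewrite -neq_lt.
- rewrite (_ : _ @^-1` _ = `[(y - b) / k, (x - b) / k[%classic); last first.
    apply/seteqP; split => z /=; rewrite !in_itv/= ltr_ndivlMr// ler_ndivrMr//;
    by rewrite lerBrDr ltrBlDr (mulrC z) andbC.
  rewrite !lebesgue_measure_itv/= !lte_fin ltr_nM2r ?invr_lt0// ltrD2r.
  case: ifPn => [xy|_]; last by rewrite mule0.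
  rewrite -!EFinD -EFinM; congr EFin; rewrite ltr0_norm//.
  by field; rewrite lt_eqF.
- rewrite (_ : _ @^-1` _ = `](x - b) / k, (y - b) / k]%classic); last first.
    apply/seteqP; split => z /=; rewrite !in_itv/= ltr_pdivrMr// ler_pdivlMr//;
    by rewrite ltrBlDr lerBrDr (mulrC z).
  rewrite !lebesgue_measure_itv/= !lte_fin ltr_pM2r ?invr_gt0// ltrD2r.
  case: ifPn => [xy|_]; last by rewrite mule0.
  rewrite -!EFinD -EFinM; congr EFin; rewrite gtr0_norm//.
  by field; rewrite gt_eqF.
Qed.

Lemma ge0_integral_affine (k b : R) f : k != 0 -> measurable_fun setT f ->
  (forall x, 0 <= f x) ->
  (\int[leb]_x (f x)%:E = (`|k|)%:E * \int[leb]_x (f (k * x + b)%R)%:E)%E.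
Proof.
move=> k0 mf f0.
transitivity (\int[mscale (NngNum (normr_ge0 k)) (affine_image k b)]_x (f x)%:E)%E.
  by apply: eq_measure_integral => A mA _; exact: lebesgue_affine.
rewrite ge0_integral_mscale//=; last 2 first.
- exact/measurable_EFinP.
- by move=> x _; rewrite lee_fin.
congr (_ * _)%E.
rewrite (ge0_integral_pushforward (measurable_affinity k b))//.
- exact/measurable_EFinP.
- by move=> x _; rewrite lee_fin.
Qed.

Lemma measurable_affine (k b : R) f : measurable_fun setT f ->
  measurable_fun setT (fun x => f (k * x + b)).
Proof.
move=> mf; apply: (measurableT_comp mf).
by apply: measurable_funD => //; apply: measurable_funM.
Qed.

Lemma integrable_affine (k b : R) f : k != 0 -> Lint f ->
  Lint (fun x => f (k * x + b)).
Proof.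
move=> k0 fi; apply/integrableP; split.
  apply/measurable_EFinP; apply: (measurable_affine k b).
  exact: measurable_integrable.
have /integrableP[/measurable_EFinP mf /=] := fi.
have -> := @ge0_integral_affine k b (fun x => `|f x|) k0; last 2 first.
- exact: measurableT_comp.
- by move=> x; exact: normr_ge0.
set I := (\int[_]_x _)%E.
have : (0 <= I)%E by apply: integral_ge0 => x _; rewrite lee_fin.
by case: I => [r| |] //=; rewrite ?ltry// mulry gtr0_sg ?normr_gt0// mul1e.
Qed.

Lemma Rintegral_affine (k b : R) f : k != 0 -> Lint f ->
  \int[leb]_x f (k * x + b) = `|k|^-1 * \int[leb]_x f x.
Proof.
move=> k0 fi.
have mf := measurable_integrable fi.
(* Writing [h] as [(h + |h|) - |h|] reduces the claim to nonnegative functions. *)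
have split (h : R -> R) : Lint h ->
    \int[leb]_x h x = \int[leb]_x (h x + `|h x|) - \int[leb]_x `|h x|.
  move=> hi; rewrite RintegralD ?addrK//; exact: integrable_norm.
have ge0 (h : R -> R) : measurable_fun setT h -> (forall x, 0 <= h x) ->
    \int[leb]_x h (k * x + b) = `|k|^-1 * \int[leb]_x h x.
  move=> mh h0; rewrite /Rintegral (ge0_integral_affine b k0 mh h0).
  set I := (\int[_]_x _)%E.
  have : (0 <= I)%E by apply: integral_ge0 => x _; rewrite lee_fin.
  case: I => [r| |] //=; first by rewrite mulKf// normr_eq0.
  (* If the integral is infinite, both sides are 0 because [fine] sends [+oo] to 0. *)
  by rewrite mulry gtr0_sg ?normr_gt0// mul1e mulr0.
have fi' := integrable_affine b k0 fi.
rewrite split// [in RHS]split//.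
rewrite (ge0 (fun x => f x + `|f x|)); last 2 first.
- by apply: measurable_funD => //; exact: measurableT_comp.
- by move=> x; have := ler_norm (- f x); rewrite normrN; lra.
by rewrite (ge0 (fun x => `|f x|))// ?mulrBr//; exact: measurableT_comp.
Qed.

Lemma cvg_Rintegral_symitv f : Lint f ->
  (fun n : nat => \int[leb]_(x in `[- n%:R, n%:R]) f x) @ \oo --> \int[leb]_x f x.
Proof.
move=> fi.
pose f_ (n : nat) := EFin \o (f \_ (`[- n%:R, n%:R] : set R)).
have mf := measurable_integrable fi.
have mI (n : nat) : measurable (`[- n%:R, n%:R] : set R) by exact: measurable_itv.
have [] := @dominated_convergence _ _ _ leb setT measurableT f_ (EFin \o f)
  (fun x => `|(f x)%:E|%E).
- move=> n; apply/measurable_EFinP; apply/measurable_restrict => //.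
  by rewrite setTI; exact: measurable_funS mf.
- exact/measurable_EFinP.
- apply: aeW => x _ /=.
  apply: cvg_EFin; first by apply: nearW.
  apply: cvg_near_cst.
  near=> n; rewrite /f_ /= patchE ifT//.
  rewrite inE/= in_itv/= -ler_norml.
  by near: n; exact: nbhs_infty_ger.
- exact: integrable_abse.
- apply: aeW => x n _ /=; rewrite lee_fin patchE.
  by case: ifPn => // _; rewrite normr0.
move=> _ _ /= cf.
have fine_f (n : nat) : \int[leb]_(x in `[- n%:R, n%:R]) f x =
    fine (\int[leb]_x f_ n x)%E.
  by rewrite Rintegral_mkcond.
under eq_fun do rewrite fine_f.
apply: fine_cvg; rewrite fineK; last exact: integrable_fin_num.
exact: cf.
Unshelve. all: end_near. Qed.

Lemma Rintegral_FTC F f (lp lm : R) : (forall x : R, is_derive x 1 F (f x)) ->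
  continuous f -> Lint f ->
  F x @[x --> +oo] --> lp -> F x @[x --> -oo] --> lm ->
  \int[leb]_x f x = lp - lm.
Proof.
move=> dF cf fi Fp Fm.
have cF (x : R) : {for x, continuous F}.
  apply: differentiable_continuous; apply/derivable1_diffP.
  by have [] := dF x.
have E (n : nat) : (0 < n)%N ->
    \int[leb]_(x in `[- n%:R, n%:R]) f x = F n%:R - F (- n%:R).
  move=> n0; rewrite /Rintegral (@continuous_FTC2 _ f F) ?EFinB//.
  - by rewrite gtrN// ltr0n.
  - exact: continuous_subspaceT.
  - split.
    + by move=> x _; have [] := dF x.
    + by apply: cvg_at_right_filter; exact: cF.
    + by apply: cvg_at_left_filter; exact: cF.
  - by move=> x _; rewrite derive1E; apply: derive_val.
have c1 := cvg_Rintegral_symitv fi.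
have c2 : (fun n : nat => \int[leb]_(x in `[- n%:R, n%:R]) f x) @ \oo --> lp - lm.
  apply: (@cvg_trans _ ((fun n : nat => F n%:R - F (- n%:R)) @ \oo)).
    apply: near_eq_cvg; near=> n; rewrite E//.
    by near: n; exact: nbhs_infty_gt.
  apply: cvgB.
    exact: (cvg_comp _ _ (@cvgr_idn R) Fp).
  apply: (cvg_comp _ _ _ Fm).
  by have := @cvgr_idn R; rewrite -cvgNrNy.
exact: (cvg_unique _ c1 c2).
Unshelve. all: end_near. Qed.

End IntegralsOnTheLine.

(** * Derivative and continuity rules in the pointwise form matched by the tactics [derive] and
    [cont] *)

Section Derivatives.
Variable R : realType.
Implicit Types (f g : R -> R) (x : R).

Lemma deriv_cst (c x : R) : is_derive x 1 (fun _ : R => c) 0.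
Proof. exact: is_derive_cst. Qed.
Lemma deriv_id x : is_derive x 1 (fun y : R => y) 1.
Proof. exact: is_derive_id. Qed.
Lemma derivD f g x df dg : is_derive x 1 f df -> is_derive x 1 g dg ->
  is_derive x 1 (fun y => f y + g y) (df + dg).
Proof. by move=> ? ?; exact: is_deriveD. Qed.
Lemma derivN f x df : is_derive x 1 f df -> is_derive x 1 (fun y => - f y) (- df).
Proof. by move=> ?; exact: is_deriveN. Qed.
Lemma derivM f g x df dg : is_derive x 1 f df -> is_derive x 1 g dg ->
  is_derive x 1 (fun y => f y * g y) (f x * dg + g x * df).
Proof. by move=> ? ?; exact: is_deriveM. Qed.
Lemma derivV f x df : f x != 0 -> is_derive x 1 f df ->
  is_derive x 1 (fun y => (f y)^-1) (- (f x)^-2 * df).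
Proof. by move=> ? ?; exact: is_deriveV. Qed.
Lemma derivX2 f x df : is_derive x 1 f df ->
  is_derive x 1 (fun y => f y ^+ 2) (2 * f x * df).
Proof.
move=> df'; rewrite (_ : (fun _ => _) = (fun y => f y * f y)); last first.
  by apply/funext => y; rewrite expr2.
by apply: is_derive_eq (derivM df' df') _; ring.
Qed.
Lemma deriv_exp f x df : is_derive x 1 f df ->
  is_derive x 1 (fun y => expR (f y)) (expR (f x) * df).
Proof. by move=> ?; exact: is_derive1_comp. Qed.
Lemma deriv_cos f x df : is_derive x 1 f df ->
  is_derive x 1 (fun y => cos (f y)) (- sin (f x) * df).
Proof. by move=> ?; exact: is_derive1_comp. Qed.
Lemma deriv_sin f x df : is_derive x 1 f df ->
  is_derive x 1 (fun y => sin (f y)) (cos (f x) * df).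
Proof. by move=> ?; exact: is_derive1_comp. Qed.
Lemma deriv_atan f x df : is_derive x 1 f df ->
  is_derive x 1 (fun y => atan (f y)) ((1 + f x ^+ 2)^-1 * df).
Proof. by move=> ?; exact: is_derive1_comp. Qed.

Lemma deriv_continuous f (df : R -> R) : (forall x, is_derive x 1 f (df x)) ->
  continuous f.
Proof.
move=> dF x; apply: differentiable_continuous; apply/derivable1_diffP.
by have [] := dF x.
Qed.

Lemma cont_cst (c : R) : continuous (fun _ : R => c).
Proof. by move=> x; exact: cvg_cst. Qed.
Lemma cont_id : continuous (fun y : R => y).
Proof. by move=> x. Qed.
Lemma contD f g : continuous f -> continuous g -> continuous (fun y => f y + g y).
Proof. by move=> cf cg x; apply: cvgD; [exact: cf|exact: cg]. Qed.
Lemma contN f : continuous f -> continuous (fun y => - f y).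
Proof. by move=> cf x; apply: cvgN; exact: cf. Qed.
Lemma contM f g : continuous f -> continuous g -> continuous (fun y => f y * g y).
Proof. by move=> cf cg x; apply: cvgM; [exact: cf|exact: cg]. Qed.
Lemma contV f : (forall x, f x != 0) -> continuous f -> continuous (fun y => (f y)^-1).
Proof. by move=> f0 cf x; apply: cvgV => //; exact: cf. Qed.
Lemma contX f n : continuous f -> continuous (fun y => f y ^+ n).
Proof.
move=> cf; elim: n => [|n IH]; first by under eq_fun do rewrite expr0; exact: cont_cst.
by under eq_fun do rewrite exprS; exact: contM.
Qed.
Lemma cont_comp h f : continuous h -> continuous f -> continuous (fun y : R => h (f y) : R).
Proof. by move=> ch cf x; apply: (continuous_comp (cf x)); exact: ch. Qed.
Lemma cont_exp f : continuous f -> continuous (fun y => expR (f y)).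
Proof. by apply: cont_comp; exact: continuous_expR. Qed.
Lemma cont_cos f : continuous f -> continuous (fun y => cos (f y)).
Proof. by apply: cont_comp; exact: continuous_cos. Qed.
Lemma cont_sin f : continuous f -> continuous (fun y => sin (f y)).
Proof. by apply: cont_comp; exact: continuous_sin. Qed.

End Derivatives.

Ltac derive_step := match goal with
  | |- is_derive _ _ (fun _ => ?c) _ => first [exact: (deriv_cst c _) | exact: deriv_cst]
  | |- is_derive _ _ (fun x => x) _ => notypeclasses refine (deriv_id _)
  | |- is_derive _ _ (fun x => @?f x + @?g x) _ => notypeclasses refine (derivD (f := f) (g := g) _ _)
  | |- is_derive _ _ (fun x => - @?f x) _ => notypeclasses refine (derivN (f := f) _)
  | |- is_derive _ _ (fun x => @?f x ^+ 2) _ => notypeclasses refine (derivX2 (f := f) _)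
  | |- is_derive _ _ (fun x => @?f x * @?g x) _ => notypeclasses refine (derivM (f := f) (g := g) _ _)
  | |- is_derive _ _ (fun x => (@?f x)^-1) _ => notypeclasses refine (derivV (f := f) _ _)
  | |- is_derive _ _ (fun x => expR (@?f x)) _ => notypeclasses refine (deriv_exp (f := f) _)
  | |- is_derive _ _ (fun x => cos (@?f x)) _ => notypeclasses refine (deriv_cos (f := f) _)
  | |- is_derive _ _ (fun x => sin (@?f x)) _ => notypeclasses refine (deriv_sin (f := f) _)
  | |- is_derive _ _ (fun x => atan (@?f x)) _ => notypeclasses refine (deriv_atan (f := f) _)
  end.
(** [is_derive_eq] leaves the derivative as an existential that the steps fill in. What remains is
    one identity for [ring] or [field], besides the nonvanishing conditions of inverses. *)
Ltac derive := notypeclasses refine (is_derive_eq _ _); [repeat derive_step|cbv beta].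
Ltac cont_step := match goal with
  | |- continuous (fun _ => ?c) => first [exact: (cont_cst c) | exact: cont_cst]
  | |- continuous (fun x => x) => exact (@cont_id _)
  | |- continuous (fun x => @?f x + @?g x) => notypeclasses refine (contD (f := f) (g := g) _ _)
  | |- continuous (fun x => - @?f x) => notypeclasses refine (contN (f := f) _)
  | |- continuous (fun x => @?f x ^+ ?n) => notypeclasses refine (@contX _ f n _)
  | |- continuous (fun x => @?f x * @?g x) => notypeclasses refine (contM (f := f) (g := g) _ _)
  | |- continuous (fun x => (@?f x)^-1) => notypeclasses refine (contV (f := f) _ _)
  | |- continuous (fun x => expR (@?f x)) => notypeclasses refine (cont_exp (f := f) _)
  | |- continuous (fun x => cos (@?f x)) => notypeclasses refine (cont_cos (f := f) _)
  | |- continuous (fun x => sin (@?f x)) => notypeclasses refine (cont_sin (f := f) _)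
  end.
Ltac cont := repeat cont_step.

(** * Contour shifts for real integrals *)

Section ContourShift.
Variable R : realType.
Notation leb := (@lebesgue_measure R).
Notation Lint f := (leb.-integrable setT (EFin \o f)).

(** Cauchy's theorem on a strip in real terms: [E] and [- F] are the real and imaginary parts of a
    holomorphic function of [x + i a], and [dE] is the common value of the two derivatives in a
    Cauchy-Riemann equation. The derivative in [a] of the integral of [E a] is thus the integral of
    an [x]-derivative, which is 0 because [F a] vanishes at both ends. The majorant [G] justifies
    differentiating under the integral. *)
Lemma Rintegral_contour_shift (E F dE : R -> R -> R) (r : R) (G : R -> R) :
  (forall a x : R, `|a| < r -> is_derive a (1 : R) (E ^~ x) (dE a x)) ->
  (forall a x : R, `|a| < r -> is_derive x (1 : R) (F a) (dE a x)) ->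
  (forall a, `|a| < r -> continuous (dE a)) ->
  (forall a, `|a| < r -> Lint (E a)) ->
  Lint G -> (forall a x, `|a| < r -> `|dE a x| <= G x) ->
  (forall a, `|a| < r -> F a x @[x --> +oo] --> (0 : R)) ->
  (forall a, `|a| < r -> F a x @[x --> -oo] --> (0 : R)) ->
  forall a b, `|a| < r -> `|b| < r -> \int[leb]_x E a x = \int[leb]_x E b x.
Proof.
move=> dEa dFx cdE iE iG dEG Fp Fm.
have arI (a : R) : (`]- r, r[%classic a : Prop) <-> `|a| < r.
  by rewrite /= in_itv/= -ltr_norml.
suff W a b : a < b -> `|a| < r -> `|b| < r -> \int[leb]_x E a x = \int[leb]_x E b x.
  move=> a b ar br; have [ab|ba|->//] := ltgtP a b; first exact: W.
  by rewrite (W b a).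
move=> ab ar br.
pose f (c : R) := \int[leb]_x E c x.
have df (c : R) : `|c| < r -> is_derive c 1 f 0.
  move=> cr; have cI := (arI c).2 cr.
  have H1 x : `]- r, r[%classic x -> Lint (E x) by move=> /arI; exact: iE.
  have H2 x (y : measurableTypeR R) : `]- r, r[%classic x -> setT y -> derivable (E ^~ y) x 1.
    by move=> /arI xr _; have [] := dEa _ y xr.
  have H3 x (y : measurableTypeR R) : `]- r, r[%classic x -> setT y ->
      `|partial1of2 E x y| <= G y.
    move=> /arI xr _; rewrite partial1of2E.
    by have := dEa _ y xr => /@derive_val ->; exact: dEG.
  have G0' (y : measurableTypeR R) : 0 <= G y by exact: le_trans (normr_ge0 _) (dEG _ y cr).
  apply: DeriveDef.
    exact: (derivable_under_integral measurableT cI H1 H2 G0' iG H3).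
  rewrite -derive1E (differentiation_under_integral measurableT cI H1 H2 G0' iG H3).
  rewrite (_ : (fun _ => _) = (fun x => dE c x)); last first.
    apply/funext => y; rewrite partial1of2E.
    by have := dEa _ y cr => /@derive_val ->.
  rewrite (Rintegral_FTC (fun x => dFx c x cr) (cdE c cr) _ (Fp c cr) (Fm c cr)) ?subrr//.
  apply: (integrable_dominated _ iG (dEG c ^~ cr)).
  by apply: continuous_measurable_fun; exact: cdE.
have inI c : c \in `[a, b] -> `|c| < r.
  rewrite in_itv/= => /andP[ac cb].
  move: ar br; rewrite !ltr_norml => /andP[ra _] /andP[_ br].
  by rewrite (lt_le_trans ra ac) (le_lt_trans cb br).
have [||c _] := @MVT _ f (fun=> 0) a b ab.
- by move=> x xab; apply: df; apply: inI; exact: subset_itv_oo_cc.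
- apply: derivable_within_continuous => x xab.
  by have [] := df x (inI _ xab).
by rewrite mul0r => /subr0_eq.
Qed.

End ContourShift.

(** * The Fourier transforms of the hyperbolic secant and of the Gaussian *)

Section SechTransform.
Variable R : realType.
Implicit Types (x y a xi : R).
Notation leb := (@lebesgue_measure R).
Notation Lint f := (leb.-integrable setT (EFin \o f)).

(** The integrals over [[-n, n]] are differences of values of [F], so at most [2 B], and they
    increase to the full integral by monotone convergence. *)
Lemma integrable_primitive (F f : R -> R) (B : R) :
  (forall x : R, is_derive x 1 F (f x)) -> continuous f ->
  (forall x, 0 <= f x) -> (forall x, `|F x| <= B) -> Lint f.
Proof.
move=> dF cf f0 FB.
have mf : measurable_fun setT f by exact: continuous_measurable_fun.
have cF := deriv_continuous dF.
have E (n : nat) : (\int[leb]_(x in `[(- n%:R : R)%R, n%:R%R]) (f x)%:E <= (2 * B)%:E)%E.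
  case: n => [|n].
    rewrite oppr0 set_itv1 integral_set1 lee_fin mulr_ge0//.
    exact: le_trans (FB 0).
  rewrite (@continuous_FTC2 _ f F) -?EFinB ?lee_fin//.
  - have := FB n.+1%:R; have := FB (- n.+1%:R); rewrite !ler_norml; lra.
  - by rewrite gtrN// ltr0n.
  - exact: continuous_subspaceT.
  - split.
    + by move=> x _; have [] := dF x.
    + by apply: cvg_at_right_filter; exact: cF.
    + by apply: cvg_at_left_filter; exact: cF.
  - by move=> x _; rewrite derive1E; apply: derive_val.
apply/integrableP; split; first exact/measurable_EFinP.
under eq_integral do rewrite /= ger0_norm//.
have UT : \bigcup_n `[- n%:R, n%:R]%classic = setT :> set R.
  apply/seteqP; split => // x _.
  exists (Num.truncn `|x|).+1 => //=; rewrite in_itv/= -ler_norml.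
  by apply/ltW; rewrite truncnS_gt.
rewrite -[setT]UT.
have mono : {homo (fun n : nat => `[(- n%:R : R), n%:R]%classic) : n m / (n <= m)%N >-> (n <= m)%O}.
  move=> m n mn; apply/subsetPset => x /=; rewrite !in_itv/= -!ler_norml => /le_trans; apply.
  by rewrite ler_nat.
have c := @ge0_nondecreasing_set_cvg_integral _ (measurableTypeR R) R
  (fun n : nat => `[(- n%:R : R), n%:R]%classic) (EFin \o f) leb mono
  (fun n => measurable_itv _)
  (fun n => (measurable_EFinP _ _).2 (measurable_funS measurableT (@subsetT _ _) mf))
  (fun n x _ => f0 x).
rewrite -(cvg_lim _ c)//.
apply: (@le_lt_trans _ _ (2 * B)%:E); last exact: ltry.
apply: lime_le.
  apply: ereal_nondecreasing_is_cvgn => m n mn.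
  apply: ge0_subset_integral => //=.
  - by apply/measurable_EFinP; exact: measurable_funS mf.
  - by move=> x _; rewrite lee_fin.
  - move=> x /=; rewrite !in_itv/= -!ler_norml => /le_trans; apply.
    by rewrite ler_nat.
by apply: nearW => n; exact: E.
Qed.

(** At [x = ln p - ln q] this is [sqrt (p q) / (p + q)], the Carleman kernel in logarithmic
    variables. It also serves as the universal integrable majorant of the development. *)
Definition sech2 x := (expR (x / 2) + expR (- (x / 2)))^-1.

Lemma sech2_den_gt0 x : 0 < expR (x / 2) + expR (- (x / 2)).
Proof. by rewrite addr_gt0// expR_gt0. Qed.

Lemma sech2_den_neq0 x : expR (x / 2) + expR (- (x / 2)) != 0.
Proof. by rewrite gt_eqF// sech2_den_gt0. Qed.

Lemma sech2_gt0 x : 0 < sech2 x.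
Proof. by rewrite invr_gt0 sech2_den_gt0. Qed.

Lemma sech2N x : sech2 (- x) = sech2 x.
Proof. by rewrite /sech2 mulNr opprK addrC. Qed.

Lemma sech2_le1 x : sech2 x <= 1.
Proof.
rewrite invf_le1 ?sech2_den_gt0//.
have := expR_ge1Dx (x / 2); have := expR_ge1Dx (- (x / 2)); lra.
Qed.

Lemma deriv_sech2_primitive x :
  is_derive x 1 (fun y => 2 * atan (expR (y / 2))) (sech2 x).
Proof.
derive; rewrite /sech2 expRN.
have e0 := expR_gt0 (x / 2).
field; apply/andP; split; apply: lt0r_neq0; rewrite ?addr_gt0 ?exprn_gt0 ?mulr_gt0//.
Qed.

Lemma continuous_sech2 : continuous sech2.
Proof. by rewrite /sech2; cont; exact: sech2_den_neq0. Qed.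

Lemma measurable_sech2 : measurable_fun setT sech2.
Proof. by apply: continuous_measurable_fun; exact: continuous_sech2. Qed.

Lemma integrable_sech2 : Lint sech2.
Proof.
apply: (integrable_primitive (B := pi) deriv_sech2_primitive continuous_sech2).
  by move=> x; exact/ltW/sech2_gt0.
move=> x; rewrite normrM ger0_norm// -ler_pdivlMl//.
have := atan_gtNpi2 (expR (x / 2)); have := atan_ltpi2 (expR (x / 2)).
by move=> ? ?; rewrite ltW// ltr_norml; apply/andP; split; lra.
Qed.

Lemma cvg_expR_half_py : expR (x / 2) @[x --> +oo] --> (+oo : set_system R).
Proof.
apply/cvgryPge => A; near=> x.
apply: le_trans (expR_ge1Dx _).
suff : 2 * A <= x by lra.
by near: x; apply: nbhs_pinfty_ge; rewrite num_real.
Unshelve. all: end_near. Qed.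

Lemma cvg_expR_half_ny : expR (x / 2) @[x --> -oo] --> (0 : R).
Proof.
have H : expR (- x) @[x --> +oo] --> (0 : R) by exact: cvgr_expR.
have L : (fun x : R => - (x / 2)) @ -oo --> +oo.
  apply/cvgryPge => A; near=> x.
  suff : x <= - (2 * A) by lra.
  by near: x; apply: nbhs_ninfty_le; rewrite num_real.
apply: cvg_trans (cvg_comp _ _ L H).
by apply: near_eq_cvg; apply: nearW => x; rewrite /= opprK.
Unshelve. all: end_near. Qed.

Lemma cvg_opp_py : - x @[x --> +oo] --> (-oo : set_system R).
Proof.
apply/cvgrNyPle => A; near=> x; rewrite lerNl.
by near: x; apply: nbhs_pinfty_ge; rewrite num_real.
Unshelve. all: end_near. Qed.

Lemma cvg_opp_ny : - x @[x --> -oo] --> (+oo : set_system R).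
Proof.
apply/cvgryPge => A; near=> x; rewrite lerNr.
by near: x; apply: nbhs_ninfty_le; rewrite num_real.
Unshelve. all: end_near. Qed.

Lemma Rintegral_sech2 : \int[leb]_x sech2 x = pi.
Proof.
rewrite (Rintegral_FTC (lp := 2 * (pi / 2)) (lm := 2 * atan 0)
  deriv_sech2_primitive continuous_sech2 integrable_sech2).
- by rewrite atan0 mulr0 subr0; field.
- apply: cvgM; first exact: cvg_cst.
  exact: (cvg_comp _ _ cvg_expR_half_py (@cvgy_atan R)).
- apply: cvgM; first exact: cvg_cst.
  exact: (cvg_comp _ _ cvg_expR_half_ny (@continuous_atan R 0)).
Qed.

Lemma sech2_cvgy : sech2 x @[x --> +oo] --> (0 : R).
Proof.
apply: (@squeeze_cvgr _ _ _ _ (fun=> 0) (fun x => expR (- x / 2))).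
- apply: nearW => x; rewrite ltW ?sech2_gt0//= /sech2 mulNr [leRHS]expRN.
  by rewrite lef_pV2 ?posrE ?expR_gt0 ?sech2_den_gt0// lerDl expR_ge0.
- exact: cvg_cst.
- exact: (cvg_comp _ _ cvg_opp_py cvg_expR_half_ny).
Qed.

Lemma sech2_cvgNy : sech2 x @[x --> -oo] --> (0 : R).
Proof.
apply: cvg_trans (cvg_comp _ _ cvg_opp_ny sech2_cvgy).
by apply: near_eq_cvg; apply: nearW => x; rewrite /= sech2N.
Qed.

End SechTransform.

(** * The cosine transform of the hyperbolic secant *)

Section SechTransform2.
Variable R : realType.
Implicit Types (x y a xi : R).
Notation leb := (@lebesgue_measure R).
Notation Lint f := (leb.-integrable setT (EFin \o f)).

(** At [z = x + i a], [A + i B] is [2 cosh (z / 2)] and [N] is its squared modulus. The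
    [x]-derivatives of [A] and [B] are [al] and [be], so by Cauchy-Riemann their [a]-derivatives are
    [- be] and [al]. *)
Let A a x := (expR (x / 2) + expR (- (x / 2))) * cos (a / 2).
Let B a x := (expR (x / 2) - expR (- (x / 2))) * sin (a / 2).
Let al a x := (expR (x / 2) - expR (- (x / 2))) / 2 * cos (a / 2).
Let be a x := (expR (x / 2) + expR (- (x / 2))) / 2 * sin (a / 2).
Let N a x := A a x ^+ 2 + B a x ^+ 2.
Let C xi x := cos (xi * x).
Let S xi x := sin (xi * x).

(* [E] and [- F] are the real and imaginary parts of
   [exp (i xi z) / (2 cosh (z / 2))] at [z = x + i a]. *)
Let E xi a x := expR (- (xi * a)) * ((C xi x * A a x + S xi x * B a x) / N a x).
Let F xi a x := expR (- (xi * a)) * ((C xi x * B a x - S xi x * A a x) / N a x).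
Let dE xi a x := expR (- (xi * a)) *
  (- xi * ((C xi x * A a x + S xi x * B a x) / N a x)
   + (S xi x * al a x - C xi x * be a x) / N a x
   - 2 * (C xi x * A a x + S xi x * B a x) * (B a x * al a x - A a x * be a x)
     / N a x ^+ 2).

Let cos_half_gt0 a : `|a| < pi -> 0 < cos (a / 2).
Proof. by rewrite ltr_norml => /andP[? ?]; apply: cos_gt0_pihalf; lra. Qed.

(** The zeros of [cosh (z / 2)] nearest to the real axis are [i pi] and [- i pi], which fixes the
    width of the strip. *)
Let N_gt0 a x : `|a| < pi -> 0 < N a x.
Proof.
move=> /cos_half_gt0 a0; rewrite ltr_wpDr ?sqr_ge0// exprn_gt0// mulr_gt0//.
exact: sech2_den_gt0.
Qed.

Let dA a x : is_derive a 1 (A ^~ x) (- be a x).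
Proof. by rewrite /A; derive; rewrite /be; field. Qed.
Let dB a x : is_derive a 1 (B ^~ x) (al a x).
Proof. by rewrite /B; derive; rewrite /al; field. Qed.
Let dAx a x : is_derive x 1 (A a) (al a x).
Proof. by rewrite /A; derive; rewrite /al; field. Qed.
Let dBx a x : is_derive x 1 (B a) (be a x).
Proof. by rewrite /B; derive; rewrite /be; field. Qed.

Let E_deriv xi a x : `|a| < pi -> is_derive a 1 (E xi ^~ x) (dE xi a x).
Proof.
move=> api; have N0 := N_gt0 x api.
rewrite /E /N; notypeclasses refine (is_derive_eq _ _).
  repeat first [exact: dA | exact: dB | derive_step].
  by rewrite gt_eqF.
rewrite /dE -[A a x ^+ 2 + _]/(N a x); field; exact: lt0r_neq0.
Qed.

Let F_deriv xi a x : `|a| < pi -> is_derive x 1 (F xi a) (dE xi a x).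
Proof.
move=> api; have N0 := N_gt0 x api.
rewrite /F /N /C /S; notypeclasses refine (is_derive_eq _ _).
  repeat first [exact: dAx | exact: dBx | derive_step].
  by rewrite gt_eqF.
move: N0; rewrite /dE /N /C /S.
move: (A a x) (B a x) (al a x) (be a x) (cos _) (sin _) => u v p q c s N0.
field; exact: lt0r_neq0.
Qed.

Let c x := expR (x / 2) + expR (- (x / 2)).
Let d x := expR (x / 2) - expR (- (x / 2)).

Let c_gt0 x : 0 < c x. Proof. exact: sech2_den_gt0. Qed.

Let d_le_c x : `|d x| <= c x.
Proof.
rewrite /d /c ler_norml; have := expR_gt0 (x / 2); have := expR_gt0 (- (x / 2)).
by move=> ? ?; apply/andP; split; lra.
Qed.

Let A_le a x : `|A a x| <= c x.
Proof.
by rewrite /A -/(c x) normrM gtr0_norm// ler_piMr ?cos_max// ltW.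
Qed.

Let B_le a x : `|B a x| <= c x.
Proof.
rewrite /B -/(d x) normrM -[leRHS]mulr1.
by rewrite ler_pM// ?sin_max// d_le_c.
Qed.

Let al_le a x : `|al a x| <= c x.
Proof.
rewrite /al -/(d x) !normrM -[leRHS]mulr1.
apply: ler_pM => //; last exact: cos_max.
by rewrite (le_trans _ (d_le_c x))// ler_piMr// ger0_norm ?invr_ge0// invf_le1 ?ltr0n// ler1n.
Qed.

Let be_le a x : `|be a x| <= c x.
Proof.
rewrite /be -/(c x) !normrM -[leRHS]mulr1.
apply: ler_pM => //; last exact: sin_max.
by rewrite gtr0_norm// ler_piMr ?(ltW (c_gt0 x))// ger0_norm ?invr_ge0// invf_le1 ?ltr0n// ler1n.
Qed.

Let N_ge r a x : r < pi -> `|a| < r -> c x ^+ 2 * cos (r / 2) ^+ 2 <= N a x.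
Proof.
move=> rpi ar; have r0 : 0 < r by exact: le_lt_trans ar.
rewrite -[leLHS]addr0 lerD ?sqr_ge0// /A -/(c x) exprMn ler_wpM2l ?sqr_ge0//.
rewrite ler_sqr ?nnegrE; last 2 first.
- by apply/ltW/cos_half_gt0; rewrite gtr0_norm.
- by apply/ltW/cos_half_gt0; exact: lt_trans rpi.
rewrite -(cos_norm (a / 2)) normrM (@ger0_norm _ 2^-1) ?invr_ge0//.
have a0 := normr_ge0 a.
rewrite leNgt ltr_cos ?in_itv/= -?leNgt; [lra| |]; apply/andP; split; lra.
Qed.

(** The denominator is at least [c^2 cos (r / 2)^2] on the whole strip. A numerator of size [c]
    therefore leaves [1 / c], which is [sech2]: one integrable majorant for all heights [a]. *)
Let frac_le r a x n u : r < pi -> `|a| < r -> `|u| <= n * c x ->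
  `|u / N a x| <= n / cos (r / 2) ^+ 2 * sech2 x.
Proof.
move=> rpi ar un; have r0 : 0 < r by exact: le_lt_trans ar.
have N0 := N_gt0 x (lt_trans ar rpi).
have k0 : 0 < cos (r / 2) by apply: cos_half_gt0; rewrite gtr0_norm.
rewrite normrM normfV (gtr0_norm N0) ler_pdivrMr//.
apply: (le_trans un).
rewrite (_ : n * c x = n / cos (r / 2) ^+ 2 * sech2 x * (c x ^+ 2 * cos (r / 2) ^+ 2)).
  apply: ler_wpM2l; last exact: N_ge.
  rewrite mulr_ge0 ?(ltW (sech2_gt0 x))// divr_ge0 ?sqr_ge0//.
  by move: (le_trans (normr_ge0 u) un); rewrite pmulr_lge0.
by rewrite /sech2 -/(c x); field; rewrite !gt_eqF.
Qed.

Let comb_le (k u v p q : R) : `|u| <= 1 -> `|v| <= 1 -> `|p| <= k -> `|q| <= k ->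
  `|u * p + v * q| <= 2 * k.
Proof.
move=> u1 v1 pk qk; rewrite (le_trans (ler_normD _ _))// mulr2n mulrDl mul1r !normrM.
by rewrite lerD// -[leRHS]mul1r ler_pM.
Qed.

Let CA_le xi a x : `|C xi x * A a x + S xi x * B a x| <= 2 * c x.
Proof. by apply: comb_le; rewrite ?cos_max ?sin_max ?A_le ?B_le. Qed.

Let CB_le xi a x : `|C xi x * B a x - S xi x * A a x| <= 2 * c x.
Proof. by rewrite -mulNr; apply: comb_le; rewrite ?normrN ?cos_max ?sin_max ?A_le ?B_le. Qed.

Let Cal_le xi a x : `|S xi x * al a x - C xi x * be a x| <= 2 * c x.
Proof. by rewrite -mulNr; apply: comb_le; rewrite ?normrN ?cos_max ?sin_max ?al_le ?be_le. Qed.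

Let exp_le xi a r : `|a| < r -> expR (- (xi * a)) <= expR (`|xi| * r).
Proof.
move=> ar; rewrite ler_expR (le_trans (ler_norm _))// normrN normrM.
by rewrite ler_wpM2l// ltW.
Qed.

Let E_le xi r a x : r < pi -> `|a| < r ->
  `|E xi a x| <= expR (`|xi| * r) * (2 / cos (r / 2) ^+ 2) * sech2 x.
Proof.
move=> rpi ar; rewrite /E normrM -mulrA ler_pM//; last exact: (frac_le rpi ar (CA_le _ _ _)).
by rewrite ger0_norm ?expR_ge0// exp_le.
Qed.

Let F_le xi r a x : r < pi -> `|a| < r ->
  `|F xi a x| <= expR (`|xi| * r) * (2 / cos (r / 2) ^+ 2) * sech2 x.
Proof.
move=> rpi ar; rewrite /F normrM -mulrA ler_pM//; last exact: (frac_le rpi ar (CB_le _ _ _)).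
by rewrite ger0_norm ?expR_ge0// exp_le.
Qed.

Let dE_le xi r a x : r < pi -> `|a| < r -> `|dE xi a x| <=
  expR (`|xi| * r) * ((`|xi| + 1 + 4 / cos (r / 2) ^+ 2) *
    (2 / cos (r / 2) ^+ 2)) * sech2 x.
Proof.
move=> rpi ar; rewrite /dE normrM -[leRHS]mulrA ler_pM//.
  by rewrite ger0_norm ?expR_ge0// exp_le.
have k0 : 0 < cos (r / 2).
  by apply: cos_half_gt0; rewrite gtr0_norm// (le_lt_trans _ ar).
have h1 := frac_le rpi ar (CA_le xi a x); have h2 := frac_le rpi ar (Cal_le xi a x).
have cc : `|B a x * al a x - A a x * be a x| <= 2 * c x ^+ 2.
  rewrite (le_trans (ler_normB _ _))// mulr2n mulrDl mul1r (normrM (B a x)) (normrM (A a x)) expr2.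
  by rewrite lerD// ler_pM// ?A_le ?B_le ?al_le ?be_le.
have h3 : `|2 * (B a x * al a x - A a x * be a x) / N a x| <= 4 / cos (r / 2) ^+ 2.
  have := @frac_le r a x (4 * c x) (2 * (B a x * al a x - A a x * be a x)) rpi ar.
  move=> /(_ _)/le_trans -> //.
    by rewrite normrM (@ger0_norm _ 2)// -mulrA -expr2; lra.
  rewrite le_eqVlt; apply/orP; left; apply/eqP; rewrite /sech2 -/(c x).
  by field; rewrite !gt_eqF.
(* The last term of [dE] is split into a bounded fraction times one that decays like [sech2]. *)
have -> : 2 * (C xi x * A a x + S xi x * B a x) * (B a x * al a x - A a x * be a x)
    / N a x ^+ 2 = (2 * (B a x * al a x - A a x * be a x) / N a x) *
  ((C xi x * A a x + S xi x * B a x) / N a x).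
  by field; rewrite gt_eqF// N_gt0// (lt_trans ar).
move: h1 h2 h3; set u := _ / N a x; set v := _ / N a x; set w := _ / N a x => h1 h2 h3.
rewrite (le_trans (ler_normB _ _))//.
have -> : forall p q t z : R, (p + 1 + q) * t * z = p * (t * z) + t * z + q * (t * z).
  by move=> *; ring.
rewrite lerD//; last by rewrite normrM ler_pM.
by rewrite (le_trans (ler_normD _ _))// lerD// normrM normrN ler_wpM2l.
Qed.

Let cC xi : continuous (C xi). Proof. by rewrite /C; cont. Qed.
Let cS xi : continuous (S xi). Proof. by rewrite /S; cont. Qed.
Let cA a : continuous (A a). Proof. exact: deriv_continuous (dAx a). Qed.
Let cB a : continuous (B a). Proof. exact: deriv_continuous (dBx a). Qed.
Let cal a : continuous (al a). Proof. by rewrite /al; cont. Qed.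
Let cbe a : continuous (be a). Proof. by rewrite /be; cont. Qed.
Let cN a : continuous (N a).
Proof. by rewrite /N; repeat first [cont_step | exact: cA | exact: cB]. Qed.
Let N_neq0 a x : `|a| < pi -> N a x != 0.
Proof. by move=> ap; exact: lt0r_neq0 (N_gt0 x ap). Qed.

Let cont_E xi a : `|a| < pi -> continuous (E xi a).
Proof.
move=> ap; rewrite /E.
repeat first [cont_step | exact: cA | exact: cB | exact: cC | exact: cS | exact: cN].
by move=> x; exact: N_neq0.
Qed.

Let cont_dE xi a : `|a| < pi -> continuous (dE xi a).
Proof.
move=> ap; rewrite /dE.
repeat first [cont_step | match goal with
  | |- continuous (fun x => A _ x) => exact: cA
  | |- continuous (fun x => B _ x) => exact: cB
  | |- continuous (fun x => C _ x) => exact: cC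
  | |- continuous (fun x => S _ x) => exact: cS
  | |- continuous (fun x => al _ x) => exact: cal
  | |- continuous (fun x => be _ x) => exact: cbe
  | |- continuous (fun x => N _ x) => exact: cN end].
- by move=> x; exact: N_neq0.
- by move=> x; exact: N_neq0.
- by move=> x; rewrite expf_neq0//; exact: N_neq0.
Qed.

Let int_E xi a : `|a| < pi -> Lint (E xi a).
Proof.
move=> ap; have [ar rp] : `|a| < (`|a| + pi) / 2 /\ (`|a| + pi) / 2 < pi.
  by split; lra.
apply: (integrable_dominated _ _ (fun x => E_le xi x rp ar)).
  by apply: continuous_measurable_fun; exact: cont_E.
by apply: integrableZ_fun; exact: integrable_sech2.
Qed.

Let int_E0 xi a : `|a| < pi -> \int[leb]_x E xi a x = \int[leb]_x (C xi x * sech2 x).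
Proof.
move=> ap.
(* Any [r] strictly between [|a|] and [pi] would do: the majorants are uniform only on strips
   narrower than [pi]. *)
pose r := (`|a| + pi) / 2; have a0 := normr_ge0 a; have pi0 := @pi_gt0 R.
have ar : `|a| < r by rewrite /r; lra.
have rp : r < pi by rewrite /r; lra.
have r0 : `|0 : R| < r by rewrite normr0 (le_lt_trans _ ar).
transitivity (\int[leb]_x E xi 0 x); last first.
  apply: eq_Rintegral => x _; rewrite /E /N /A /B /sech2 !mul0r mulr0 oppr0 expR0 sin0 cos0.
  by rewrite -/(c x); field; rewrite gt_eqF.
pose G x := expR (`|xi| * r) * ((`|xi| + 1 + 4 / cos (r / 2) ^+ 2) *
    (2 / cos (r / 2) ^+ 2)) * sech2 x.
have FK (K : R) (b : R) (Fl : set_system R) : Filter Fl -> sech2 x @[x --> Fl] --> (0 : R) ->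
    `|b| < r -> F xi b x @[x --> Fl] --> (0 : R).
  move=> FF sl br; apply: norm_cvg0.
  apply: (@squeeze_cvgr _ _ _ _ (fun=> 0)
    (fun x => expR (`|xi| * r) * (2 / cos (r / 2) ^+ 2) * sech2 x)).
  - by apply: nearW => x; rewrite normr_ge0/= F_le.
  - exact: cvg_cst.
  - by rewrite -[X in _ --> X](mulr0 (expR (`|xi| * r) * (2 / cos (r / 2) ^+ 2))); apply: cvgM => //; exact: cvg_cst.
have lt (c' : R) : `|c'| < r -> `|c'| < pi by move=> h; exact: lt_trans rp.
refine (@Rintegral_contour_shift R (E xi) (F xi) (dE xi) r G
  (fun b x h => @E_deriv xi b x (lt b h)) (fun b x h => @F_deriv xi b x (lt b h))
  (fun b h => @cont_dE xi b (lt b h)) (fun b h => @int_E xi b (lt b h)) _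
  (fun b x h => @dE_le xi r b x rp h)
  (fun b h => FK 1 b _ _ (@sech2_cvgy R) h) (fun b h => FK 1 b _ _ (@sech2_cvgNy R) h) a 0 ar r0).
by apply: integrableZ_fun; exact: integrable_sech2.
Qed.

Let mono0 (f df : R -> R) : (forall x : R, is_derive x 1 f (df x)) ->
  (forall x, 0 <= x -> 0 <= df x) -> forall x, 0 <= x -> f 0 <= f x.
Proof.
move=> dF df0 x x0.
have [|t t0x E'] := @MVT_segment _ f df 0 x x0 (fun y _ => dF y).
  by apply: continuous_subspaceT; exact: deriv_continuous dF.
rewrite -subr_ge0 E' subr0 mulr_ge0// df0//.
by move: t0x; rewrite in_itv/= => /andP[].
Qed.

Let sin_le x : 0 <= x -> sin x <= x.
Proof.
move=> x0; rewrite -subr_ge0.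
have D (y : R) : is_derive y 1 (fun y => y - sin y) (1 - cos y) by derive; ring.
have P y : 0 <= y -> 0 <= 1 - cos y by move=> _; rewrite subr_ge0 cos_le1.
by have := mono0 D P x0; rewrite sin0 subr0.
Qed.

Let cos_ge x : 1 - cos x <= x ^+ 2 / 2.
Proof.
wlog x0 : x / 0 <= x.
  move=> H; have [|x0] := leP 0 x; first exact: H.
  by rewrite -cosN -sqrrN; apply: H; rewrite oppr_ge0 ltW.
have D (y : R) : is_derive y 1 (fun y => y ^+ 2 / 2 + cos y) (y - sin y).
  by derive; field.
have P y : 0 <= y -> 0 <= y - sin y by move=> y0; rewrite subr_ge0 sin_le.
by have := mono0 D P x0; rewrite cos0 expr0n/= mul0r add0r; lra.
Qed.

(** [d] is [2 sinh (x / 2)], whose derivative [cosh (x / 2)] is at least 1. *)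
Let d_ge x : x ^+ 2 <= d x ^+ 2.
Proof.
wlog x0 : x / 0 <= x.
  move=> H; have [|x0] := leP 0 x; first exact: H.
  rewrite -(sqrrN x) (_ : d x ^+ 2 = d (- x) ^+ 2); first by apply: H; rewrite oppr_ge0 ltW.
  by rewrite /d mulNr opprK; ring.
have H : 0 <= d x - x.
  have D (y : R) : is_derive y 1 (fun y => d y - y) (c y / 2 - 1).
    by rewrite /d; derive; rewrite /c; field.
  have P y : 0 <= y -> 0 <= c y / 2 - 1.
    move=> _; rewrite /c.
    have := expR_ge1Dx (y / 2); have := expR_ge1Dx (- (y / 2)); lra.
  have d00 : d 0 = 0 by rewrite /d mul0r oppr0 subrr.
  by have := mono0 D P x0; rewrite d00 subrr.
by rewrite ler_sqr ?nnegrE//; lra.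
Qed.

(* Averaging the contours [Im z = a] and [Im z = - a] leaves a positive kernel of mass [pi]
   which concentrates at [0] as [a] tends to [pi]. *)
Let sh xi := \int[leb]_x (C xi x * sech2 x).
Let p a x := A a x / N a x.

Let int_Cp xi a : `|a| < pi -> Lint (fun x => C xi x * p a x).
Proof.
move=> ap; pose r := (`|a| + pi) / 2; have ar : `|a| < r by rewrite /r; lra.
have rp : r < pi by rewrite /r; lra.
apply: (@integrable_dominated _ _ (fun x => 1 / cos (r / 2) ^+ 2 * sech2 x)).
- apply: continuous_measurable_fun; rewrite /p.
  repeat first [cont_step | exact: cA | exact: cC | exact: cN].
  by move=> x; exact: N_neq0.
- by apply: integrableZ_fun; exact: integrable_sech2.
- move=> x; rewrite normrM -[leRHS]mul1r ler_pM ?cos_max//.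
  by apply: frac_le => //; rewrite mul1r A_le.
Qed.

(** Both contours give [sh xi]. With the weights [expR (xi * a)] and [expR (- (xi * a))] their sine
    terms, odd in [a], cancel and the cosine term remains twice. *)
Let sh_p xi a : `|a| < pi ->
  (expR (xi * a) + expR (- (xi * a))) * sh xi = 2 * \int[leb]_x (C xi x * p a x).
Proof.
move=> ap; have aNp : `|- a| < pi by rewrite normrN.
rewrite -[RHS]RintegralZl//; last exact: int_Cp.
rewrite mulrDl /sh -[in X in X + _](int_E0 xi ap) -[in X in _ + X](int_E0 xi aNp).
rewrite -RintegralZl//; last exact: int_E.
rewrite -RintegralZl//; last exact: int_E.
rewrite -RintegralD//; last 2 first.
- by apply: integrableZ_fun; exact: int_E.
- by apply: integrableZ_fun; exact: int_E.
apply: eq_Rintegral => x _.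
have NN : N (- a) x = N a x by rewrite /N /A /B mulNr cosN sinN; ring.
have AN : A (- a) x = A a x by rewrite /A mulNr cosN.
have BN : B (- a) x = - B a x by rewrite /B mulNr sinN mulrN.
rewrite /E /p NN AN BN mulrN opprK expRN.
have e0 := expR_gt0 (xi * a); have N0 := N_neq0 x ap.
move: (A a x) (B a x) (N a x) (C xi x) (S xi x) N0 => u v n k l n0.
by field; rewrite n0 gt_eqF.
Qed.

Let C0 x : C 0 x = 1. Proof. by rewrite /C mul0r cos0. Qed.

Let sh0 : sh 0 = pi.
Proof.
rewrite -[RHS](@Rintegral_sech2 R); apply: eq_Rintegral => x _.
by rewrite C0 mul1r.
Qed.

Let p_mass a : `|a| < pi -> \int[leb]_x (C 0 x * p a x) = pi.
Proof.
move=> ap; have := sh_p 0 ap; rewrite mul0r oppr0 expR0 sh0; lra.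
Qed.

(** Here [c^2 = d^2 + 4] and [N = d^2 + 4 cos (a / 2)^2]. The vanishing of [1 - cos (xi x)] at 0
    makes up for the smallness of [N] there: [(1 - cos (xi x)) d^2 <= 2 d^2], and [4 (1 - cos (xi
    x)) <= 2 (xi x)^2 <= 2 xi^2 d^2]. Both are absorbed by [N], and the factor [cos (a / 2)], which
    tends to 0 as [a] tends to [pi], is left over. *)
Let p_le xi a x : `|a| < pi ->
  `|C xi x * p a x - C 0 x * p a x| <= cos (a / 2) * (2 + 2 * xi ^+ 2) * sech2 x.
Proof.
move=> ap; have a0 := cos_half_gt0 ap; have N0 := N_gt0 x ap.
have p0 : 0 <= p a x.
  by rewrite /p divr_ge0 ?(ltW N0)// mulr_ge0 ?ltW// -/(c x).
rewrite -mulrBl normrM (ger0_norm p0) C0 distrC ger0_norm ?subr_ge0 ?cos_le1//.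
rewrite /p mulrA ler_pdivrMr// /sech2 -/(c x).
rewrite -(ler_pM2r (c_gt0 x)).
rewrite (_ : _ * (c x)^-1 * _ * _ = cos (a / 2) * ((2 + 2 * xi ^+ 2) * N a x)); last first.
  by field; rewrite gt_eqF.
rewrite /A -/(c x) (_ : _ * _ * _ = cos (a / 2) * ((1 - C xi x) * c x ^+ 2)); last by ring.
apply: ler_wpM2l; first exact: ltW.
have NE : N a x = d x ^+ 2 + 4 * cos (a / 2) ^+ 2.
  have ee : expR (x / 2) * expR (- (x / 2)) = 1 by rewrite -expRD subrr expR0.
  rewrite /N /A /B -/(c x) -/(d x) !exprMn (sin2cos2 (a / 2)).
  have -> : c x ^+ 2 = d x ^+ 2 + 4 * (expR (x / 2) * expR (- (x / 2))).
    by rewrite /c /d; ring.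
  by rewrite ee; ring.
have cE : c x ^+ 2 = d x ^+ 2 + 4.
  have ee : expR (x / 2) * expR (- (x / 2)) = 1 by rewrite -expRD subrr expR0.
  have -> : c x ^+ 2 = d x ^+ 2 + 4 * (expR (x / 2) * expR (- (x / 2))).
    by rewrite /c /d; ring.
  by rewrite ee mulr1.
have x2 := d_ge x; have cge := cos_ge (xi * x).
have C1 : -1 <= C xi x by exact: cos_geN1.
have d0 := sqr_ge0 (d x); have k0 := sqr_ge0 (cos (a / 2)); have q0 := sqr_ge0 xi.
have h1 : (1 - C xi x) * d x ^+ 2 <= 2 * d x ^+ 2 by apply: ler_wpM2r => //; lra.
have h2 : (1 - C xi x) * 4 <= 2 * xi ^+ 2 * d x ^+ 2.
  have : xi ^+ 2 * x ^+ 2 <= xi ^+ 2 * d x ^+ 2 by exact: ler_wpM2l.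
  by move: cge; rewrite exprMn -/(C xi x); lra.
have h3 : 0 <= (2 + 2 * xi ^+ 2) * (4 * cos (a / 2) ^+ 2).
  by apply: mulr_ge0; [lra|exact: mulr_ge0].
rewrite NE cE; lra.
Qed.

Let sh_bound xi a : `|a| < pi ->
  `|(expR (xi * a) + expR (- (xi * a))) * sh xi - 2 * pi| <=
  2 * (cos (a / 2) * (2 + 2 * xi ^+ 2) * pi).
Proof.
move=> ap; rewrite sh_p// -[in leLHS](p_mass ap) -mulrBr normrM (@ger0_norm _ 2)//.
apply: ler_wpM2l => //.
rewrite -RintegralB//; [|exact: int_Cp|exact: int_Cp].
rewrite -[in leRHS](@Rintegral_sech2 R) -RintegralZl//; last exact: integrable_sech2.
apply: le_norm_int.
- apply: measurable_funB; apply: measurable_integrable; exact: int_Cp.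
- by apply: integrableZ_fun; exact: integrable_sech2.
- by move=> x; exact: p_le.
Qed.

(** The line [Im z = pi] runs through a pole, so [sh_bound] stops short of it. Both of its sides are
    continuous in [a], and at [a = pi] the factor [cos (pi / 2) = 0] turns the bound into an
    equality. *)
Theorem sech2_cos_transform xi :
  (expR (pi * xi) + expR (- (pi * xi))) * \int[leb]_x (cos (xi * x) * sech2 x) = 2 * pi.
Proof.
pose phi a := 2 * (cos (a / 2) * (2 + 2 * xi ^+ 2) * pi) -
  `|(expR (xi * a) + expR (- (xi * a))) * sh xi - 2 * pi|.
have phic : continuous phi.
  rewrite /phi => a; apply: cvgB.
    by move: a; change (continuous (fun a => 2 * (cos (a / 2) * (2 + 2 * xi ^+ 2) * pi))); cont.
  apply: cvg_norm.
  by move: a; change (continuous (fun a => (expR (xi * a) + expR (- (xi * a))) * sh xi - 2 * pi)); cont.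
have : 0 <= phi pi.
  have : phi a @[a --> pi^'-] --> phi pi by apply: cvg_at_left_filter; exact: phic.
  move=> H; rewrite -(cvg_lim _ H)//; apply: limr_ge; first by apply/cvg_ex; exists (phi pi).
  near=> a; rewrite subr_ge0 sh_bound// ltr_norml; apply/andP; split.
    have : 0 < a by near: a; apply: nbhs_left_gt; exact: pi_gt0.
    by have := @pi_gt0 R; lra.
  by near: a; exact: nbhs_left_lt.
rewrite /phi cos_pihalf !mul0r mulr0 sub0r oppr_ge0 normr_le0 subr_eq0 => /eqP.
by rewrite mulrC -/(sh xi) (mulrC xi pi) => <-; rewrite mulrC.
Unshelve. all: end_near. Qed.

End SechTransform2.

(** * The cosine transform of the Gaussian *)

Section GaussianTransform.
Variable R : realType.
Implicit Types (x y a xi : R).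
Notation leb := (@lebesgue_measure R).
Notation Lint f := (leb.-integrable setT (EFin \o f)).

Lemma expR_half_le_sech2 x : expR (- (`|x| / 2)) <= 2 * sech2 x.
Proof.
have -> : sech2 x = sech2 `|x| by case: (ger0P x) => _ //; rewrite sech2N.
rewrite /sech2 ler_pdivlMr ?sech2_den_gt0// mulrDr -expRD addNr expR0 -expRD.
suff : expR (- (`|x| / 2) - `|x| / 2) <= 1 by lra.
by rewrite -[leRHS]expR0 ler_expR; have := normr_ge0 x; lra.
Qed.

(** With [1 + |x| <= e^|x|] and the decay [e^(- |x| / 2)] of [sech2], what has to be bounded is
    [3 t / 2 - al t^2] for [t = |x|]. Completing the square gives the maximum [9 / (16 al)]. *)
Lemma gaussian_le_sech2 (al : R) x : 0 < al ->
  expR (- (al * x ^+ 2)) * (1 + `|x|) <= 2 * expR (9 / (16 * al)) * sech2 x.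
Proof.
move=> al0.
apply: (@le_trans _ _ (expR (9 / (16 * al)) * expR (- (`|x| / 2)))); last first.
  rewrite (mulrC 2) -mulrA ler_wpM2l ?expR_ge0//; exact: expR_half_le_sech2.
apply: (@le_trans _ _ (expR (- (al * x ^+ 2)) * expR `|x|)).
  by rewrite ler_wpM2l ?expR_ge0// expR_ge1Dx.
rewrite -!expRD ler_expR -(real_normK (num_real x)).
set t := `|x|.
have -> : 9 / (16 * al) - t / 2 = - (al * t ^+ 2) + t + al * (t - 3 / (4 * al)) ^+ 2.
  by field; rewrite gt_eqF.
by rewrite lerDl mulr_ge0 ?sqr_ge0// ltW.
Qed.

Lemma continuous_gaussian (al : R) : continuous (fun x : R => expR (- (al * x ^+ 2))).
Proof. by cont. Qed.

Lemma integrable_gaussian (al : R) : 0 < al -> Lint (fun x => expR (- (al * x ^+ 2))).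
Proof.
move=> al0; apply: (@integrable_dominated _ _ (fun x => 2 * expR (9 / (16 * al)) * sech2 x)).
- by apply: continuous_measurable_fun; exact: continuous_gaussian.
- by apply: integrableZ_fun; exact: integrable_sech2.
- move=> x; rewrite ger0_norm ?expR_ge0//; apply: le_trans (gaussian_le_sech2 x al0).
  by rewrite ler_peMr ?expR_ge0// lerDl.
Qed.

(** Positivity allows [mathieu_ground0] to cancel this integral as a normalising factor. *)
Lemma Rintegral_gaussian_gt0 (al : R) : 0 < al -> 0 < \int[leb]_x expR (- (al * x ^+ 2)).
Proof.
move=> al0; have s0 : 0 < Num.sqrt al by rewrite sqrtr_gt0.
rewrite (_ : \int[leb]_x _ = \int[leb]_x gauss_fun (Num.sqrt al * x + 0)); last first.
  apply: eq_Rintegral => x _; rewrite /gauss_fun addr0 exprMn sqr_sqrtr//.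
  exact: ltW.
rewrite Rintegral_affine ?gt_eqF//; last exact: integrableT_gauss.
rewrite mulr_gt0 ?invr_gt0 ?normr_gt0 ?gt_eqF// /Rintegral integralT_gauss/= sqrtr_gt0.
exact: pi_gt0.
Qed.

(** [E] and [- F] are the real and imaginary parts of [exp (- al z^2)] at [z = xi + i a]. At the
    height [a0 = x / (2 al)] the phase is [cos (xi x)] and the modulus gains [exp (x^2 / (4 al))].
    Shifting the contour back to the real axis compares the two integrals. *)
Theorem gaussian_cos_transform (al : R) x : 0 < al ->
  \int[leb]_xi (expR (- (al * xi ^+ 2)) * cos (xi * x)) =
  expR (- (x ^+ 2 / (4 * al))) * \int[leb]_xi expR (- (al * xi ^+ 2)).
Proof.
move=> al0.
pose E (a xi : R) := expR (- (al * xi ^+ 2) + al * a ^+ 2) * cos (2 * al * a * xi).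
pose F (a xi : R) := expR (- (al * xi ^+ 2) + al * a ^+ 2) * sin (2 * al * a * xi).
pose dE (a xi : R) := expR (- (al * xi ^+ 2) + al * a ^+ 2) *
  (2 * al * a * cos (2 * al * a * xi) - 2 * al * xi * sin (2 * al * a * xi)).
pose a0 := x / (2 * al); pose r := `|a0| + 1.
pose K : R := expR (al * r ^+ 2) * (2 * al * (r + 1)).
have r0 : 0 < r by rewrite /r; have := normr_ge0 a0; lra.
pose G (xi : R) := K * (2 * expR (9 / (16 * al)) * sech2 xi).
have exple a xi : `|a| < r ->
    expR (- (al * xi ^+ 2) + al * a ^+ 2) <= expR (al * r ^+ 2) * expR (- (al * xi ^+ 2)).
  move=> ar; rewrite -expRD ler_expR addrC lerD2r ler_wpM2l ?(ltW al0)//.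
  by rewrite -(real_normK (num_real a)) ler_sqr ?nnegrE// ltW.
have iG : Lint G by apply: integrableZ_fun; apply: integrableZ_fun; exact: integrable_sech2.
have bd a xi : `|a| < r -> forall u, `|u| <= 2 * al * (r + 1) * (1 + `|xi|) ->
    `|expR (- (al * xi ^+ 2) + al * a ^+ 2) * u| <= G xi.
  move=> ar u ule; rewrite normrM ger0_norm ?expR_ge0//.
  apply: (@le_trans _ _ (K * (expR (- (al * xi ^+ 2)) * (1 + `|xi|)))); last first.
    rewrite ler_wpM2l ?gaussian_le_sech2// mulr_ge0 ?expR_ge0// !mulr_ge0 ?(ltW al0)//.
    by rewrite addr_ge0// ltW.
  apply: (le_trans (ler_pM (expR_ge0 _) (normr_ge0 _) (exple a xi ar) ule)).
  by rewrite /K le_eqVlt; apply/orP; left; apply/eqP; ring.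
have one_le xi : 1 <= 2 * al * (r + 1) * (1 + `|xi|) * (2 * al * (r + 1))^-1.
  rewrite mulrAC mulfV ?mul1r ?lerDl// gt_eqF// mulr_gt0 ?mulr_gt0//; lra.
have bd1 a xi : `|a| < r -> forall u, `|u| <= 1 ->
    `|expR (- (al * xi ^+ 2) + al * a ^+ 2) * u| <= (2 * al * (r + 1))^-1 * G xi.
  move=> ar u ule.
  have k0 : 0 < 2 * al * (r + 1) by rewrite mulr_gt0 ?mulr_gt0//; lra.
  rewrite ler_pdivlMl// -[X in X * _]gtr0_norm// -normrM mulrCA; apply: bd => //.
  rewrite normrM gtr0_norm// ler_wpM2l// ?(ltW k0)//.
  by rewrite (le_trans ule)// lerDl.
have iE a : `|a| < r -> Lint (E a).
  move=> ar; apply: (@integrable_dominated _ _ (fun xi => (2 * al * (r + 1))^-1 * G xi)).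
  - by apply: continuous_measurable_fun; rewrite /E; cont.
  - exact: integrableZ_fun.
  - by move=> xi; apply: bd1 => //; exact: cos_max.
have Fl (a : R) (L : set_system R) : Filter L -> sech2 y @[y --> L] --> (0 : R) ->
    `|a| < r -> F a y @[y --> L] --> (0 : R).
  move=> FF sl ar; apply: norm_cvg0.
  apply: (@squeeze_cvgr _ _ _ _ (fun=> 0) (fun y => (2 * al * (r + 1))^-1 * G y)).
  - by apply: nearW => y; rewrite normr_ge0/= bd1// sin_max.
  - exact: cvg_cst.
  - rewrite /G.
    rewrite -[X in _ --> X](_ : (2 * al * (r + 1))^-1 * (K * (2 * expR (9 / (16 * al)) * 0)) = 0); last by rewrite !mulr0.
    by apply: cvgM; [exact: cvg_cst|apply: cvgM; [exact: cvg_cst|apply: cvgM; [exact: cvg_cst|]]].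
have H : \int[leb]_xi E a0 xi = \int[leb]_xi E 0 xi.
  apply: (@Rintegral_contour_shift R E F dE r G) => //.
  - by move=> a y _; rewrite /E; derive; rewrite /dE; ring.
  - by move=> a y _; rewrite /F; derive; rewrite /dE; ring.
  - by move=> a _; rewrite /dE; cont.
  - move=> a y ar; apply: bd => //.
    rewrite (le_trans (ler_normB _ _))// !normrM (@ger0_norm _ 2)// (gtr0_norm al0).
    have h1 : 2 * al * `|a| * `|cos (2 * al * a * y)| <= 2 * al * r.
      rewrite -[leRHS]mulr1 ler_pM ?cos_max// ?mulr_ge0 ?(ltW al0)//.
      by rewrite ler_wpM2l ?mulr_ge0 ?(ltW al0) ?(ltW ar).
    have h2 : 2 * al * `|y| * `|sin (2 * al * a * y)| <= 2 * al * `|y|.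
      by rewrite -[leRHS]mulr1 ler_pM ?sin_max// ?mulr_ge0 ?(ltW al0).
    apply: (le_trans (lerD h1 h2)).
    have := mulr_ge0 (ltW al0) (normr_ge0 y); have := mulr_ge0 (mulr_ge0 (ltW al0) (ltW r0)) (normr_ge0 y).
    lra.
  - by move=> a; apply: Fl; exact: sech2_cvgy.
  - by move=> a; apply: Fl; exact: sech2_cvgNy.
  - by rewrite /r ltrDl.
  - by rewrite normr0.
have E0 : \int[leb]_xi E 0 xi = \int[leb]_xi expR (- (al * xi ^+ 2)).
  by apply: eq_Rintegral => xi _; rewrite /E !mulr0 mul0r cos0 expr0n/= mulr0 addr0 mulr1.
rewrite -E0 -H -RintegralZl//; last by apply: iE; rewrite /r ltrDl.
apply: eq_Rintegral => xi _; rewrite /E mulrA -expRD.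
have -> : 2 * al * a0 * xi = xi * x by rewrite /a0; field; rewrite gt_eqF.
by congr (expR _ * _); rewrite /a0; field; rewrite gt_eqF.
Qed.

End GaussianTransform.

(** * Fubini's theorem for iterated real integrals *)

Section RealFubini.
Variable R : realType.
Implicit Types (x y : R) (u v g : R -> R).
Notation leb := (@lebesgue_measure R).
Notation Lint f := (leb.-integrable setT (EFin \o f)).
Notation T := (measurableTypeR R).
Notation meas2 f := (measurable_fun [set: T * T] (fun p : T * T => f p.1 p.2 : R)).

Lemma integral_EFin f : Lint f -> (\int[leb]_x (f x)%:E = (\int[leb]_x f x)%:E)%E.
Proof. by move=> fi; rewrite /Rintegral fineK//; exact: integrable_fin_num. Qed.

Lemma measurable_Rintegral (k : R -> R -> R) : meas2 k -> (forall x, Lint (k x)) ->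
  measurable_fun setT (fun x => \int[leb]_y k x y).
Proof.
move=> mk ki.
have ge0 (h : R -> R -> R) : meas2 h -> (forall x y, 0 <= h x y) ->
    measurable_fun setT (fun x => \int[leb]_y h x y).
  move=> mh h0.
  have := @measurable_fun_fubini_tonelli_F _ _ T T R leb (fun p => (h p.1 p.2)%:E).
  move=> mF; apply: (measurableT_comp (@fine_measurable R _ measurableT) (mF _ _)).
  - exact/measurable_EFinP.
  - by move=> p; rewrite lee_fin.
have -> : (fun x => \int[leb]_y k x y) =
    (fun x => \int[leb]_y (k x y + `|k x y|) - \int[leb]_y `|k x y|).
  apply/funext => x; rewrite RintegralD ?addrK//; exact: integrable_norm.
apply: measurable_funB; apply: ge0 => //.
- by apply: measurable_funD => //; exact: measurableT_comp.
- by move=> x y; have := ler_norm (- k x y); rewrite normrN; lra.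
- exact: measurableT_comp.
Qed.

(** Sections are taken integrable at every point rather than almost everywhere, so that the real
    iterated integrals agree everywhere with the extended ones. Joint integrability comes from the
    iterated norm by Tonelli, and is repeated for the swapped function to obtain the second
    marginal. *)
Lemma Rfubini (f : R -> R -> R) : meas2 f ->
  (forall x, Lint (f x)) -> (forall y, Lint (f ^~ y)) ->
  Lint (fun x => \int[leb]_y `|f x y|) ->
  [/\ \int[leb]_x \int[leb]_y f x y = \int[leb]_y \int[leb]_x f x y,
      Lint (fun x => \int[leb]_y f x y) & Lint (fun y => \int[leb]_x f x y)].
Proof.
move=> mf fx fy ffi.
have mfE : measurable_fun [set: T * T] (fun p : T * T => (f p.1 p.2)%:E).
  exact/measurable_EFinP.
have fi : (leb \x leb)%E.-integrable [set: T * T] (fun p : T * T => (f p.1 p.2)%:E).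
  apply/(integrable12ltyP leb leb mfE) => /=.
  move/integrableP : ffi => [_]; apply: le_lt_trans.
  rewrite le_eqVlt; apply/orP; left; apply/eqP; apply: eq_integral => x _ /=.
  rewrite ger0_norm ?Rintegral_ge0//.
  by rewrite -integral_EFin//; exact: integrable_norm.
have gi : (leb \x leb)%E.-integrable [set: T * T] (fun p : T * T => (f p.2 p.1)%:E).
  have mg : measurable_fun [set: T * T] (fun p : T * T => (f p.2 p.1)%:E).
    exact: (measurableT_comp mfE (measurable_swap (T1 := T) (T2 := T))).
  apply/(integrable12ltyP leb leb mg) => /=.
  have := (integrable12ltyP leb leb mfE).1 fi.
  have mn : measurable_fun [set: T * T] (fun p : T * T => `|(f p.1 p.2)%:E|%E).
    exact: measurableT_comp.
  have := @fubini_tonelli _ _ T T R leb leb _ mn (fun _ => abse_ge0 _).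
  by move=> /= ->.
have i1 := integrable_fubini_F fi.
have i2 : leb.-integrable setT (fubini_G leb (fun p : T * T => (f p.1 p.2)%:E)).
  exact: (integrable_fubini_F gi).
have E1 : fubini_F leb (fun p : T * T => (f p.1 p.2)%:E) = EFin \o (fun x => \int[leb]_y f x y).
  by apply/funext => x /=; rewrite /fubini_F/= integral_EFin.
have E2 : fubini_G leb (fun p : T * T => (f p.1 p.2)%:E) = EFin \o (fun y => \int[leb]_x f x y).
  by apply/funext => y /=; rewrite /fubini_G/= integral_EFin.
rewrite E1 in i1; rewrite E2 in i2; split => //.
have := Fubini fi.
rewrite -[X in (X = _)%E]/(\int[leb]_x fubini_F leb (fun p : T * T => (f p.1 p.2)%:E) x)%E.
rewrite -[X in (_ = X)%E]/(\int[leb]_y fubini_G leb (fun p : T * T => (f p.1 p.2)%:E) y)%E.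
by rewrite E1 E2 /Rintegral/= => ->.
Qed.

Lemma meas2_fst u : measurable_fun setT u -> meas2 (fun x _ => u x).
Proof. by move=> mu; apply: measurableT_comp. Qed.
Lemma meas2_snd u : measurable_fun setT u -> meas2 (fun _ y => u y).
Proof. by move=> mu; apply: measurableT_comp. Qed.
Lemma meas2M (f g : R -> R -> R) : meas2 f -> meas2 g -> meas2 (fun x y => f x y * g x y).
Proof. by move=> mf mg; exact: measurable_funM. Qed.
Lemma meas2_sub u : measurable_fun setT u -> meas2 (fun x y => u (x - y)).
Proof.
move=> mu; apply: (measurableT_comp mu); apply: measurable_funB => //.
Qed.

End RealFubini.

(** * Convolution with the hyperbolic secant *)

Section SechConvolution.
Variable R : realType.
Implicit Types (x y : R) (u v g : R -> R).
Notation leb := (@lebesgue_measure R).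
Notation Lint f := (leb.-integrable setT (EFin \o f)).

(** On such functions convolution with an integrable kernel is defined at every point, so the
    operator identities below are equalities of functions and not only almost everywhere. *)
Definition bounded_mfun u := measurable_fun setT u /\ exists B, forall x, `|u x| <= B.

Lemma bounded_mfunD u v : bounded_mfun u -> bounded_mfun v ->
  bounded_mfun (fun x => u x + v x).
Proof.
move=> [mu [B uB]] [mv [D vD]]; split; first exact: measurable_funD.
by exists (B + D) => x; rewrite (le_trans (ler_normD _ _))// lerD.
Qed.

Lemma bounded_mfunM u v : bounded_mfun u -> bounded_mfun v ->
  bounded_mfun (fun x => u x * v x).
Proof.
move=> [mu [B uB]] [mv [D vD]]; split; first exact: measurable_funM.
by exists (B * D) => x; rewrite normrM ler_pM.
Qed.

Lemma bounded_mfun_cst (k : R) : bounded_mfun (fun=> k).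
Proof. by split; [exact: measurable_cst|exists `|k| => x]. Qed.

Lemma bounded_mfunZ k u : bounded_mfun u -> bounded_mfun (fun x => k * u x).
Proof. by apply: bounded_mfunM; exact: bounded_mfun_cst. Qed.

Lemma bounded_mfunB u v : bounded_mfun u -> bounded_mfun v ->
  bounded_mfun (fun x => u x - v x).
Proof.
move=> bu bv; have := bounded_mfunD bu (bounded_mfunZ (-1) bv).
by congr bounded_mfun; apply/funext => x; rewrite mulN1r.
Qed.

Lemma bounded_mfun_cos (w : R) : bounded_mfun (fun x => cos (w * x)).
Proof.
split; first by apply: continuous_measurable_fun; cont.
by exists 1 => x; exact: cos_max.
Qed.

Lemma bounded_mfun_sin (w : R) : bounded_mfun (fun x => sin (w * x)).
Proof.
split; first by apply: continuous_measurable_fun; cont.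
by exists 1 => x; exact: sin_max.
Qed.

Lemma integrable_bounded_mfun g u : Lint g -> bounded_mfun u -> Lint (fun x => g x * u x).
Proof. by move=> gi [mu [B uB]]; exact: integrable_bounded_mul uB. Qed.

Lemma sech2_sub x y : sech2 (x - y) = sech2 (1 * y + - x).
Proof. by rewrite mul1r -sech2N opprB. Qed.

Lemma integrable_sech2_subl x : Lint (fun y => sech2 (x - y)).
Proof.
under eq_fun do rewrite sech2_sub.
exact: (@integrable_affine R 1 (- x) (@sech2 R) (oner_neq0 R) (@integrable_sech2 R)).
Qed.

Lemma Rintegral_sech2_subl x : \int[leb]_y sech2 (x - y) = pi.
Proof.
under eq_Rintegral do rewrite sech2_sub.
by rewrite (@Rintegral_affine R 1 (- x) (@sech2 R) (oner_neq0 R) (@integrable_sech2 R))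
  Rintegral_sech2 normr1 invr1 mul1r.
Qed.

Lemma bounded_sech2_subl x : bounded_mfun (fun y => sech2 (x - y)).
Proof.
split; first exact: measurable_integrable (integrable_sech2_subl x).
by exists 1 => y; rewrite gtr0_norm ?sech2_gt0// sech2_le1.
Qed.

Definition sech_conv u x := \int[leb]_y (sech2 (x - y) * u y).
Local Notation S := sech_conv.

Lemma sech_conv_int_bounded u x : bounded_mfun u -> Lint (fun y => sech2 (x - y) * u y).
Proof. by move=> bu; apply: integrable_bounded_mfun => //; exact: integrable_sech2_subl. Qed.

Lemma sech_conv_int u x : Lint u -> Lint (fun y => sech2 (x - y) * u y).
Proof.
move=> iu; have := integrable_bounded_mfun iu (bounded_sech2_subl x).
by congr (_.-integrable _ _); apply/funext => y /=; rewrite mulrC.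
Qed.

Let meas_kernel u : measurable_fun setT u ->
  measurable_fun [set: measurableTypeR R * measurableTypeR R]
    (fun p : measurableTypeR R * measurableTypeR R => sech2 (p.1 - p.2) * u p.2 : R).
Proof.
move=> mu; apply: (@meas2M R (fun x y => sech2 (x - y)) (fun _ y => u y)).
  by apply: meas2_sub; exact: measurable_sech2.
exact: meas2_snd.
Qed.

Lemma sech_conv_le u B : measurable_fun setT u -> (forall x, `|u x| <= B) ->
  forall x, `|S u x| <= pi * B.
Proof.
move=> mu uB x; rewrite -(Rintegral_sech2_subl x) mulrC -RintegralZl//; last first.
  exact: integrable_sech2_subl.
apply: le_norm_int.
- apply: measurable_integrable; apply: sech_conv_int_bounded.
  by split => //; exists B.
- by apply: integrableZ_fun; exact: integrable_sech2_subl.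
- by move=> y; rewrite normrM gtr0_norm ?sech2_gt0// mulrC ler_wpM2r// ltW// sech2_gt0.
Qed.

Lemma bounded_sech_conv u : bounded_mfun u -> bounded_mfun (S u).
Proof.
move=> bu; have [mu [B uB]] := bu; split.
  apply: (measurable_Rintegral (k := fun x y => sech2 (x - y) * u y)).
    exact: meas_kernel.
  by move=> x; exact: sech_conv_int_bounded.
by exists (pi * B); exact: sech_conv_le.
Qed.

Lemma sech_convD u v : bounded_mfun u -> bounded_mfun v ->
  S (fun y => u y + v y) = (fun x => S u x + S v x).
Proof.
move=> bu bv; apply/funext => x; rewrite /S -RintegralD//.
- by apply: eq_Rintegral => y _; rewrite mulrDr.
- exact: sech_conv_int_bounded.
- exact: sech_conv_int_bounded.
Qed.

Lemma sech_convZ k u : bounded_mfun u ->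
  S (fun y => k * u y) = (fun x => k * S u x).
Proof.
move=> bu; apply/funext => x; rewrite /S -RintegralZl//.
- by apply: eq_Rintegral => y _; rewrite mulrCA.
- exact: sech_conv_int_bounded.
Qed.

Lemma sech_convB u v : bounded_mfun u -> bounded_mfun v ->
  S (fun y => u y - v y) = (fun x => S u x - S v x).
Proof.
move=> bu bv; apply/funext => x; rewrite /S -RintegralB//.
- by apply: eq_Rintegral => y _; rewrite mulrBr.
- exact: sech_conv_int_bounded.
- exact: sech_conv_int_bounded.
Qed.

(** Fubini and the evenness of [sech2]: [S] is its own transpose for the pairing of integrable with
    bounded functions. Integrability of [S g] is the pairing with the constant 1. *)
Lemma sech_conv_adjoint g u : Lint g -> bounded_mfun u ->
  \int[leb]_x (g x * S u x) = \int[leb]_y (S g y * u y) /\ Lint (S g).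
Proof.
have H v : Lint g -> bounded_mfun v ->
    \int[leb]_x (g x * S v x) = \int[leb]_y (S g y * v y) /\ Lint (fun y => S g y * v y).
  move=> gi bv; have [mv [B vB]] := bv.
  pose f x y := g x * (sech2 (x - y) * v y).
  have fx x : Lint (f x) by apply: integrableZ_fun; exact: sech_conv_int_bounded.
  have fy y : Lint (f ^~ y).
    have := integrableZ_fun (v y) (sech_conv_int y gi).
    congr (_.-integrable _ _); apply/funext => x /=.
    by rewrite /f -(sech2N (x - y)) opprB; congr EFin; ring.
  have mg := measurable_integrable gi.
  have mf : measurable_fun [set: measurableTypeR R * measurableTypeR R]
      (fun p : measurableTypeR R * measurableTypeR R => f p.1 p.2 : R).
    by apply: (@meas2M R (fun x y => g x) (fun x y => sech2 (x - y) * v y));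
      [exact: meas2_fst|exact: meas_kernel].
  have fi : Lint (fun x => \int[leb]_y `|f x y|).
    apply: (@integrable_dominated _ _ (fun x => pi * B * `|g x|)).
    - apply: (measurable_Rintegral (k := fun x y => `|f x y|)).
        exact: measurableT_comp.
      by move=> x; exact: integrable_norm.
    - by apply: integrableZ_fun; exact: integrable_norm.
    - move=> x; rewrite ger0_norm ?Rintegral_ge0//.
      rewrite (_ : (fun _ => _) = (fun y => `|g x| * (sech2 (x - y) * `|v y|))); last first.
        by apply/funext => y; rewrite /f !normrM (gtr0_norm (sech2_gt0 _)).
      have bnv : bounded_mfun (fun y => `|v y|).
        by split; [exact: measurableT_comp|exists B => y; rewrite normr_id].
      rewrite RintegralZl//; last exact: sech_conv_int_bounded.
      rewrite mulrC ler_wpM2r// (le_trans (ler_norm _))//.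
      by apply: (sech_conv_le (u := fun y => `|v y|)) => [|y]; rewrite ?normr_id//; case: bnv.
  have [E1 _ I2] := Rfubini mf fx fy fi.
  have E2 : (fun y => \int[leb]_x f x y) = (fun y => S g y * v y).
    apply/funext => y; rewrite /S -RintegralZr//; last exact: sech_conv_int.
    apply: eq_Rintegral => x _.
    by rewrite /f -(sech2N (x - y)) opprB; ring.
  split; last by rewrite -E2.
  rewrite -E2 -E1; apply: eq_Rintegral => x _.
  by rewrite /f RintegralZl//; exact: sech_conv_int_bounded.
move=> gi bu; split; first exact: (H u gi bu).1.
have := (H _ gi (bounded_mfun_cst 1)).2.
by congr (_.-integrable _ _); apply/funext => y /=; rewrite mulr1.
Qed.

Lemma integrable_sech_conv g : Lint g -> Lint (S g).
Proof. by move=> gi; have [] := sech_conv_adjoint gi (bounded_mfun_cst 0). Qed.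

(** Jensen's inequality for the probability density [sech2 / pi]: the variance of [u] about its mean
    [m] is nonnegative. *)
Lemma sech_conv_sqr u x : bounded_mfun u ->
  S u x ^+ 2 <= pi * S (fun y => u y ^+ 2) x.
Proof.
move=> bu; pose m := S u x / pi.
have bu2 : bounded_mfun (fun y => u y ^+ 2).
  by under eq_fun do rewrite expr2; exact: bounded_mfunM.
have pi0 := @pi_gt0 R.
have : 0 <= \int[leb]_y (sech2 (x - y) * (u y - m) ^+ 2).
  by apply: Rintegral_ge0 => y _; rewrite mulr_ge0 ?sqr_ge0// ltW// sech2_gt0.
rewrite (_ : \int[leb]_y _ = S (fun y => u y ^+ 2 - (2 * m) * u y + m ^+ 2) x); last first.
  by apply: eq_Rintegral => y _; ring.
rewrite sech_convD; last 2 first.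
- by apply: bounded_mfunB => //; exact: bounded_mfunZ.
- exact: bounded_mfun_cst.
rewrite sech_convB//; last exact: bounded_mfunZ.
rewrite sech_convZ//.
have -> : S (fun=> m ^+ 2) x = m ^+ 2 * pi.
  rewrite /S -(Rintegral_sech2_subl x) -RintegralZl//; last exact: integrable_sech2_subl.
  by apply: eq_Rintegral => y _; rewrite mulrC.
have E : pi * (S (fun y => u y ^+ 2) x - 2 * m * S u x + m ^+ 2 * pi) =
    pi * S (fun y => u y ^+ 2) x - S u x ^+ 2.
  rewrite /m; have gen (A s q : R) : 0 < q ->
    q * (A - 2 * (s / q) * s + (s / q) ^+ 2 * q) = q * A - s ^+ 2.
    by move=> q0; field; exact: lt0r_neq0.
  exact: gen.
by move=> H; have := mulr_ge0 (ltW pi0) H; rewrite E subr_ge0.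
Qed.

(** Integrate [sech_conv_sqr] in [x] and move [S] from [u^2] to the constant 1, where it takes the
    value [pi]. *)
Lemma sech_conv_L2 u : bounded_mfun u -> Lint (fun x => u x ^+ 2) ->
  Lint (fun x => S u x ^+ 2) /\
  \int[leb]_x S u x ^+ 2 <= pi ^+ 2 * \int[leb]_x u x ^+ 2.
Proof.
move=> bu ui; have [E1 I1] := sech_conv_adjoint ui (bounded_mfun_cst 1).
have S1 x : S (fun=> 1) x = pi.
  rewrite -(Rintegral_sech2_subl x); apply: eq_Rintegral => y _; exact: mulr1.
have I2 : Lint (fun x => S u x ^+ 2).
  apply: (@integrable_dominated _ _ (fun x => pi * S (fun y => u y ^+ 2) x)).
  - by apply: measurable_funX; case: (bounded_sech_conv bu).
  - exact: integrableZ_fun.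
  - by move=> x; rewrite ger0_norm ?sqr_ge0//; exact: sech_conv_sqr.
split => //.
apply: (@le_trans _ _ (\int[leb]_x (pi * S (fun y => u y ^+ 2) x))).
  by apply: le_Rintegral => //; [exact: integrableZ_fun|move=> x _; exact: sech_conv_sqr].
rewrite RintegralZl// expr2 -mulrA ler_wpM2l ?pi_ge0// le_eqVlt; apply/orP; left; apply/eqP.
under eq_Rintegral do rewrite -[S _ _]mulr1.
rewrite -E1 -RintegralZl//; apply: eq_Rintegral => x _.
by rewrite S1 mulrC.
Qed.

End SechConvolution.

(** * Kernel relations *)

Section WavePackets.
Variable R : realType.
Implicit Types (x y t xi w : R) (a b u v g : R -> R).
Notation leb := (@lebesgue_measure R).
Notation Lint f := (leb.-integrable setT (EFin \o f)).
Local Notation S := (@sech_conv R).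

(** This is [pi / cosh (pi xi)], written with [sech2] because the hyperbolic secant is its own
    Fourier transform up to scaling. *)
Definition sech_symbol xi := 2 * pi * sech2 (2 * pi * xi).

Lemma sech2_cos_integral xi : \int[leb]_x (cos (xi * x) * sech2 x) = sech_symbol xi.
Proof.
have := sech2_cos_transform xi; rewrite /sech_symbol /sech2.
have -> : 2 * pi * xi / 2 = pi * xi by field.
have e0 : expR (pi * xi) + expR (- (pi * xi)) != 0 by rewrite gt_eqF// addr_gt0 ?expR_gt0.
by move=> <-; rewrite mulrAC mulfV// mul1r.
Qed.

Lemma integrable_sech2_cos xi : Lint (fun x => sech2 x * cos (xi * x)).
Proof.
by apply: integrable_bounded_mfun; [exact: integrable_sech2|exact: bounded_mfun_cos].
Qed.

Lemma integrable_sech2_sin xi : Lint (fun x => sech2 x * sin (xi * x)).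
Proof.
by apply: integrable_bounded_mfun; [exact: integrable_sech2|exact: bounded_mfun_sin].
Qed.

Lemma sech2_sin_integral xi : \int[leb]_x (sech2 x * sin (xi * x)) = 0.
Proof.
have n1 : (-1 : R) != 0 by rewrite oppr_eq0 oner_neq0.
have := Rintegral_affine 0 n1 (integrable_sech2_sin xi).
rewrite normrN normr1 invr1 mul1r => E1.
have : \int[leb]_x (sech2 x * sin (xi * x)) = - \int[leb]_x (sech2 x * sin (xi * x)).
  rewrite -[LHS]E1.
  transitivity (\int[leb]_x (-1 * (sech2 x * sin (xi * x)))).
    by apply: eq_Rintegral => x _; rewrite addr0 !mulN1r sech2N mulrN sinN mulrN.
  by rewrite RintegralZl ?mulN1r//; exact: integrable_sech2_sin.
lra.
Qed.

Lemma Rintegral_shift f t : Lint f -> \int[leb]_x f (x - t) = \int[leb]_x f x.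
Proof.
move=> fi; have := Rintegral_affine (- t) (oner_neq0 R) fi.
by rewrite normr1 invr1 mul1r => <-; apply: eq_Rintegral => x _; rewrite mul1r.
Qed.

Lemma integrable_shift f t : Lint f -> Lint (fun x => f (x - t)).
Proof.
move=> fi; have := integrable_affine (- t) (oner_neq0 R) fi.
by congr (_.-integrable _ _); apply/funext => x /=; rewrite mul1r.
Qed.

Lemma integrable_shiftD f t : Lint f -> Lint (fun x => f (x + t)).
Proof. by move=> /(integrable_shift (- t)); under eq_fun do rewrite opprK. Qed.

Lemma sech_conv_cos xi x : S (fun y => cos (xi * y)) x = sech_symbol xi * cos (xi * x).
Proof.
pose f z := cos (xi * x) * (sech2 z * cos (xi * z)) - sin (xi * x) * (sech2 z * sin (xi * z)).
have i1 := integrable_sech2_cos xi; have i2 := integrable_sech2_sin xi.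
have fi : Lint f by apply: integrableB_fun; exact: integrableZ_fun.
transitivity (\int[leb]_z f z).
  rewrite -(Rintegral_shift x fi); apply: eq_Rintegral => y _.
  rewrite /f -(sech2N (x - y)) opprB.
  have {1}-> : xi * y = xi * x + xi * (y - x) by ring.
  by rewrite cosD; ring.
rewrite /f RintegralB//; [|exact: integrableZ_fun|exact: integrableZ_fun].
rewrite !RintegralZl// sech2_sin_integral mulr0 subr0 mulrC -sech2_cos_integral.
by congr (_ * _); apply: eq_Rintegral => y _; rewrite mulrC.
Qed.

Lemma sech_conv_sin xi x : S (fun y => sin (xi * y)) x = sech_symbol xi * sin (xi * x).
Proof.
pose f z := sin (xi * x) * (sech2 z * cos (xi * z)) + cos (xi * x) * (sech2 z * sin (xi * z)).
have i1 := integrable_sech2_cos xi; have i2 := integrable_sech2_sin xi.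
have fi : Lint f by apply: integrableD_fun; exact: integrableZ_fun.
transitivity (\int[leb]_z f z).
  rewrite -(Rintegral_shift x fi); apply: eq_Rintegral => y _.
  rewrite /f -(sech2N (x - y)) opprB.
  have {1}-> : xi * y = xi * x + xi * (y - x) by ring.
  by rewrite sinD; ring.
rewrite /f RintegralD//; [|exact: integrableZ_fun|exact: integrableZ_fun].
rewrite !RintegralZl// sech2_sin_integral mulr0 addr0 mulrC -sech2_cos_integral.
by congr (_ * _); apply: eq_Rintegral => y _; rewrite mulrC.
Qed.

Lemma bounded_mfun_sech2_scale (k : R) : bounded_mfun (fun x => sech2 (k * x)).
Proof.
split.
  apply: continuous_measurable_fun.
  apply: (@cont_comp R (@sech2 R) (fun x => k * x)); first exact: continuous_sech2.
  by apply: contM; [exact: cont_cst|exact: cont_id].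
by exists 1 => x; rewrite gtr0_norm ?sech2_gt0// sech2_le1.
Qed.

Lemma bounded_sech_symbol : bounded_mfun sech_symbol.
Proof. by apply: bounded_mfunZ; exact: bounded_mfun_sech2_scale. Qed.

(* Spectral data [p = (a, b)] stand for the superposition
   [x |-> \int (a xi cos (xi x) + b xi sin (xi x)) d xi]. *)
Implicit Types p q : (R -> R) * (R -> R).

Definition packet p x := \int[leb]_xi (p.1 xi * cos (xi * x) + p.2 xi * sin (xi * x)).

Definition packet_data p := Lint p.1 /\ Lint p.2.

Let cos_bm xi : bounded_mfun (fun x => cos (x * xi)).
Proof. by under eq_fun do rewrite mulrC; exact: bounded_mfun_cos. Qed.
Let sin_bm xi : bounded_mfun (fun x => sin (x * xi)).
Proof. by under eq_fun do rewrite mulrC; exact: bounded_mfun_sin. Qed.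

Lemma packet_int p x : packet_data p ->
  Lint (fun xi => p.1 xi * cos (xi * x) + p.2 xi * sin (xi * x)).
Proof.
by move=> [p1 p2]; apply: integrableD_fun; exact: integrable_bounded_mfun.
Qed.

Let meas2_trig (h : R -> R) : continuous h ->
  measurable_fun [set: measurableTypeR R * measurableTypeR R]
    (fun z : measurableTypeR R * measurableTypeR R => h (z.2 * z.1) : R).
Proof.
move=> ch; apply: (measurableT_comp (continuous_measurable_fun ch)).
exact: measurable_funM.
Qed.

Let meas2_packet p : packet_data p ->
  measurable_fun [set: measurableTypeR R * measurableTypeR R]
    (fun z : measurableTypeR R * measurableTypeR R =>
       p.1 z.2 * cos (z.2 * z.1) + p.2 z.2 * sin (z.2 * z.1) : R).
Proof.
move=> [p1 p2]; apply: measurable_funD.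
- apply: (@meas2M R (fun _ xi => p.1 xi) (fun x xi => cos (xi * x))).
    by apply: meas2_snd; exact: measurable_integrable.
  exact: (meas2_trig (@continuous_cos R)).
- apply: (@meas2M R (fun _ xi => p.2 xi) (fun x xi => sin (xi * x))).
    by apply: meas2_snd; exact: measurable_integrable.
  exact: (meas2_trig (@continuous_sin R)).
Qed.

Let packet_integrand_le p x xi :
  `|p.1 xi * cos (xi * x) + p.2 xi * sin (xi * x)| <= `|p.1 xi| + `|p.2 xi|.
Proof.
rewrite (le_trans (ler_normD _ _))// !normrM lerD// ler_piMr// ?cos_max ?sin_max//.
Qed.

(** Convolution with [sech2] and multiplication by [cos (w x)] or [sin (w x)], seen on spectral
    data: multiplication by the symbol, and combinations of shifts by [w]. The sine exchanges the
    two components. *)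
Definition data_sech p := (fun xi => sech_symbol xi * p.1 xi, fun xi => sech_symbol xi * p.2 xi).
Definition data_cos w p := (fun xi => (p.1 (xi - w) + p.1 (xi + w)) / 2,
                            fun xi => (p.2 (xi - w) + p.2 (xi + w)) / 2).
Definition data_sin w p := (fun xi => (p.2 (xi + w) - p.2 (xi - w)) / 2,
                            fun xi => (p.1 (xi - w) - p.1 (xi + w)) / 2).
Definition data_lin (k : R) p (l : R) q :=
  (fun xi => k * p.1 xi + l * q.1 xi, fun xi => k * p.2 xi + l * q.2 xi).

Lemma packet_data_sech p : packet_data p -> packet_data (data_sech p).
Proof.
move=> [p1 p2]; have [ms [B sB]] := bounded_sech_symbol.
by split; exact: (integrable_bounded_mull _ ms sB).
Qed.

Let halfI f : Lint f -> Lint (fun x => f x / 2).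
Proof. by move=> fi; under eq_fun do rewrite mulrC; exact: integrableZ_fun. Qed.

Lemma packet_data_cos w p : packet_data p -> packet_data (data_cos w p).
Proof.
by move=> [p1 p2]; split; apply: halfI; apply: integrableD_fun;
  [exact: integrable_shift|exact: integrable_shiftD|exact: integrable_shift|exact: integrable_shiftD].
Qed.

Lemma packet_data_sin w p : packet_data p -> packet_data (data_sin w p).
Proof.
by move=> [p1 p2]; split; apply: halfI; apply: integrableB_fun;
  [exact: integrable_shiftD|exact: integrable_shift|exact: integrable_shift|exact: integrable_shiftD].
Qed.

Lemma packet_data_lin k p l q : packet_data p -> packet_data q -> packet_data (data_lin k p l q).
Proof.
by move=> [p1 p2] [q1 q2]; split; apply: integrableD_fun; exact: integrableZ_fun.
Qed.

Lemma packet_lin k p l q x : packet_data p -> packet_data q ->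
  packet (data_lin k p l q) x = k * packet p x + l * packet q x.
Proof.
move=> dp dq; rewrite /packet -!RintegralZl//; [|exact: packet_int|exact: packet_int].
rewrite -RintegralD//; last 2 first.
- by apply: integrableZ_fun; exact: packet_int.
- by apply: integrableZ_fun; exact: packet_int.
by apply: eq_Rintegral => xi _ /=; ring.
Qed.

Lemma packet_sech p x : packet_data p -> S (packet p) x = packet (data_sech p) x.
Proof.
move=> dp; have [p1 p2] := dp.
pose f y xi := sech2 (x - y) * (p.1 xi * cos (xi * y) + p.2 xi * sin (xi * y)).
have fx y : Lint (f y) by apply: integrableZ_fun; exact: packet_int.
have fy xi : Lint (f ^~ xi).
  apply: integrable_bounded_mfun; first exact: integrable_sech2_subl.
  by apply: bounded_mfunD; apply: bounded_mfunZ; [exact: bounded_mfun_cos|exact: bounded_mfun_sin].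
have mf : measurable_fun [set: measurableTypeR R * measurableTypeR R]
    (fun z : measurableTypeR R * measurableTypeR R => f z.1 z.2 : R).
  apply: (@meas2M R (fun y _ => sech2 (x - y))
    (fun y xi => p.1 xi * cos (xi * y) + p.2 xi * sin (xi * y))).
    by apply: (@meas2_fst R (fun y => sech2 (x - y))); case: (bounded_sech2_subl x).
  exact: meas2_packet.
have nI : Lint (fun xi => `|p.1 xi| + `|p.2 xi|).
  by apply: integrableD_fun; exact: integrable_norm.
have fi : Lint (fun y => \int[leb]_xi `|f y xi|).
  apply: (@integrable_dominated _ _
    (fun y => \int[leb]_xi (`|p.1 xi| + `|p.2 xi|) * sech2 (x - y))).
  - apply: (measurable_Rintegral (k := fun y xi => `|f y xi|)).
      exact: measurableT_comp.
    by move=> y; exact: integrable_norm.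
  - by apply: integrableZ_fun; exact: integrable_sech2_subl.
  - move=> y; rewrite mulrC -RintegralZl//.
    apply: le_norm_int; first by apply: measurable_integrable; exact: integrable_norm.
      exact: integrableZ_fun.
    move=> xi; rewrite normr_id /f normrM (gtr0_norm (sech2_gt0 _)).
    by rewrite ler_wpM2l ?(ltW (sech2_gt0 _))// packet_integrand_le.
have [E1 _ _] := Rfubini mf fx fy fi.
transitivity (\int[leb]_y \int[leb]_xi f y xi).
  by apply: eq_Rintegral => y _; rewrite /f RintegralZl//; exact: packet_int.
rewrite E1; apply: eq_Rintegral => xi _ /=.
have bc := bounded_mfunZ (p.1 xi) (bounded_mfun_cos xi).
have bs := bounded_mfunZ (p.2 xi) (bounded_mfun_sin xi).
rewrite -[LHS]/(S (fun y => p.1 xi * cos (xi * y) + p.2 xi * sin (xi * y)) x).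
rewrite sech_convD// sech_convZ ?sech_convZ; [|exact: bounded_mfun_sin|exact: bounded_mfun_cos].
by rewrite sech_conv_cos sech_conv_sin; ring.
Qed.

Let shifted_int p t x : packet_data p ->
  Lint (fun xi => p.1 xi * cos ((xi + t) * x) + p.2 xi * sin ((xi + t) * x)).
Proof.
move=> [p1 p2].
have H (h : R -> R) k : Lint h -> bounded_mfun k -> Lint (fun xi => h xi * k (xi + t)).
  move=> hi [mk [B kB]]; apply: (integrable_bounded_mul hi _ (fun xi => kB (xi + t))).
  by apply: (measurableT_comp mk); exact: measurable_funD.
apply: integrableD_fun; first exact: (H p.1 (fun xi => cos (xi * x))).
exact: (H p.2 (fun xi => sin (xi * x))).
Qed.

Lemma packet_shift p t x : packet_data p ->
  packet (fun xi => p.1 (xi - t), fun xi => p.2 (xi - t)) x =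
  \int[leb]_xi (p.1 xi * cos ((xi + t) * x) + p.2 xi * sin ((xi + t) * x)).
Proof.
move=> dp; rewrite -(Rintegral_shift t (shifted_int t x dp)).
by apply: eq_Rintegral => xi _ /=; rewrite subrK.
Qed.

Lemma packet_data_shift p t : packet_data p ->
  packet_data (fun xi => p.1 (xi - t), fun xi => p.2 (xi - t)).
Proof. by move=> [p1 p2]; split; exact: integrable_shift. Qed.

Lemma packet_cos w p : packet_data p ->
  (fun x => cos (w * x) * packet p x) = packet (data_cos w p).
Proof.
move=> dp; apply/funext => x.
have -> : data_cos w p = data_lin 2^-1 (fun xi => p.1 (xi - w), fun xi => p.2 (xi - w))
    2^-1 (fun xi => p.1 (xi - - w), fun xi => p.2 (xi - - w)).
  by rewrite /data_cos /data_lin; congr pair; apply/funext => xi /=; rewrite opprK; field.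
rewrite packet_lin; [|exact: packet_data_shift|exact: packet_data_shift].
rewrite !packet_shift// -!RintegralZl//; [|exact: packet_int|exact: shifted_int|exact: shifted_int].
rewrite -RintegralD//; [|by apply: integrableZ_fun; exact: shifted_int..].
apply: eq_Rintegral => xi _ /=.
by rewrite !(mulrDl xi) mulNr !cosD !sinD cosN sinN; field.
Qed.

Lemma packet_sin w p : packet_data p ->
  (fun x => sin (w * x) * packet p x) = packet (data_sin w p).
Proof.
move=> dp; apply/funext => x.
(* [q] is [p] with its phases turned by a quarter period. Multiplying by [sin (w x)] is then half
   the difference of two shifts of [q]. *)
pose q : (R -> R) * (R -> R) := (p.2, fun xi => -1 * p.1 xi).
have dq : packet_data q by case: dp => p1 p2; split => //; exact: integrableZ_fun.
have -> : data_sin w p = data_lin (- 2^-1) (fun xi => q.1 (xi - w), fun xi => q.2 (xi - w))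
    2^-1 (fun xi => q.1 (xi - - w), fun xi => q.2 (xi - - w)).
  by rewrite /data_sin /data_lin; congr pair; apply/funext => xi /=; rewrite opprK; field.
rewrite packet_lin; [|exact: packet_data_shift|exact: packet_data_shift].
rewrite !packet_shift// -!RintegralZl//; [|exact: packet_int|exact: shifted_int|exact: shifted_int].
rewrite -RintegralD//; [|by apply: integrableZ_fun; exact: shifted_int..].
apply: eq_Rintegral => xi _ /=.
by rewrite mulrDl mulrBl cosD sinD cosB sinB; field.
Qed.

Lemma sech_conv_packet p : packet_data p -> S (packet p) = packet (data_sech p).
Proof. by move=> dp; apply/funext => x; exact: packet_sech. Qed.

Definition data_kernel x : (R -> R) * (R -> R) :=
  (fun xi => sech2 (2 * pi * xi) * cos (xi * x), fun xi => sech2 (2 * pi * xi) * sin (xi * x)).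

Lemma twopi_neq0 : 2 * pi != 0 :> R.
Proof. by rewrite mulf_neq0// gt_eqF// pi_gt0. Qed.

Let int_sech2_2pi : Lint (fun xi => sech2 (2 * pi * xi)).
Proof.
have := integrable_affine 0 twopi_neq0 (@integrable_sech2 R).
by under eq_fun do rewrite addr0.
Qed.

Lemma packet_data_kernel x : packet_data (data_kernel x).
Proof. by split; exact: integrable_bounded_mfun. Qed.

(** Self-reciprocity of the hyperbolic secant. It turns the convolution kernel itself into a packet,
    so that identities between kernels reduce to identities between functions of [xi]. *)
Lemma packet_kernel x : packet (data_kernel x) = (fun y => sech2 (x - y)).
Proof.
apply/funext => y.
have pi0 : 0 < 2 * pi :> R by rewrite mulr_gt0// pi_gt0.
have := Rintegral_affine 0 twopi_neq0 (integrable_sech2_cos ((y - x) / (2 * pi))).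
rewrite (gtr0_norm pi0) => E1.
transitivity ((2 * pi)^-1 * sech_symbol ((y - x) / (2 * pi))).
  rewrite -sech2_cos_integral.
  rewrite (_ : \int[leb]_z (cos _ * sech2 z) = \int[leb]_z (sech2 z * cos ((y - x) / (2 * pi) * z))); last first.
    by apply: eq_Rintegral => z _; rewrite mulrC.
  rewrite -E1; apply: eq_Rintegral => xi _ /=; rewrite addr0.
  have -> : (y - x) / (2 * pi) * (2 * pi * xi) = xi * y - xi * x.
    by rewrite mulrA divfK ?twopi_neq0// mulrBl !(mulrC xi).
  by rewrite cosB; ring.
rewrite /sech_symbol -(sech2N (x - y)) opprB mulKf ?twopi_neq0//.
by rewrite mulrC divfK ?twopi_neq0.
Qed.

Local Notation s t := (sech2 (2 * pi * t)).

Lemma sech2_2piE t : s t = (expR (pi * t) + (expR (pi * t))^-1)^-1.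
Proof.
rewrite /sech2 -expRN; have -> : 2 * pi * t / 2 = pi * t by field.
by [].
Qed.

(** [h t] is [2 cosh (pi t)]. Once everything is expressed through [expR (pi * xi)] and [Q], the
    relations below are rational identities. *)
Let h t := expR (pi * t) + (expR (pi * t))^-1.

Let h_neq0 t : h t != 0.
Proof. by rewrite gt_eqF// addr_gt0 ?invr_gt0 ?expR_gt0. Qed.

Let sE t : s t = (h t)^-1.
Proof. exact: sech2_2piE. Qed.

Let hS t w : h (t + w) = expR (pi * t) * expR (pi * w) + (expR (pi * t) * expR (pi * w))^-1.
Proof. by rewrite /h mulrDr expRD. Qed.

Let hB t w : h (t - w) = expR (pi * t) / expR (pi * w) + (expR (pi * t) / expR (pi * w))^-1.
Proof. by rewrite /h mulrBr expRB. Qed.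

Let eS t w : expR (pi * (t + w)) = expR (pi * t) * expR (pi * w).
Proof. by rewrite mulrDr expRD. Qed.

(** The addition formula [cosh (u + v) + cosh (u - v) = 2 cosh u cosh v], divided by the product of
    the three [cosh] values. *)
Lemma symbol_relation1 w xi (Q := expR (pi * w)) :
  s xi * (s (xi - w) + s (xi + w)) = (Q + Q^-1) * (s (xi - w) * s (xi + w)).
Proof.
rewrite !sE.
have H : h (xi + w) + h (xi - w) = (Q + Q^-1) * h xi.
  rewrite hB hS /h -/Q; have := expR_gt0 (pi * xi); have : 0 < Q by exact: expR_gt0.
  by move: (expR _) Q => X q q0 X0; field; rewrite !gt_eqF.
have -> : (h xi)^-1 * ((h (xi - w))^-1 + (h (xi + w))^-1) =
    (h xi)^-1 * (h (xi - w))^-1 * (h (xi + w))^-1 * (h (xi + w) + h (xi - w)).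
  by field; rewrite !h_neq0.
by rewrite H; field; rewrite !h_neq0 gt_eqF ?expR_gt0.
Qed.

(** What [kernel_relation2] demands of the coefficient of the phase at [xi + 3 w]. *)
Lemma symbol_relation3 w xi (Q := expR (pi * w)) :
  - Q * (s xi * s (xi + w + w)) - Q * (s (xi + w) * s (xi + w + w + w))
  + s xi * s (xi + w + w + w) + Q ^+ 2 * (s (xi + w) * s (xi + w + w)) =
  (Q ^+ 2 - 1) ^+ 2 * Q * (s xi * s (xi + w) * s (xi + w + w) * s (xi + w + w + w)).
Proof.
rewrite !sE.
have H : - Q * (h (xi + w) * h (xi + w + w + w)) - Q * (h xi * h (xi + w + w))
    + h (xi + w) * h (xi + w + w) + Q ^+ 2 * (h xi * h (xi + w + w + w)) =
    (Q ^+ 2 - 1) ^+ 2 * Q.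
  rewrite !hS !eS /h -/Q; have := expR_gt0 (pi * xi); have : 0 < Q by exact: expR_gt0.
  by move: (expR _) Q => X q q0 X0; field; rewrite !gt_eqF.
rewrite -H; move: (h_neq0 xi) (h_neq0 (xi + w)) (h_neq0 (xi + w + w)) (h_neq0 (xi + w + w + w)).
move: (h _) (h _) (h _) (h _) => h0 h1 h2 h3 n0 n1 n2 n3.
by field; rewrite n0 n1 n2 n3.
Qed.

(** What [kernel_relation2] demands of the coefficient of the phase at [xi + w]. *)
Lemma symbol_relation4 w xi (Q := expR (pi * w)) :
  Q * (s (xi + w) * s (xi - w)) + Q * (s xi * s (xi + w + w)) - s xi * s (xi + w)
  - Q ^+ 2 * (s (xi + w) * s (xi + w + w) + s (xi - w) * s xi - s xi * s (xi + w)) =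
  - (Q ^+ 2 - 1) ^+ 2 * (s xi * s (xi + w)) + (Q ^+ 2 - 1) ^+ 2 * Q *
    (s xi * s (xi + w)) * (s (xi + w) * s (xi + w + w) + s xi * s (xi + w) + s (xi - w) * s xi).
Proof.
rewrite !sE.
have H : Q * (h xi ^+ 2 * h (xi + w) * h (xi + w + w)) + Q * (h (xi - w) * h xi * h (xi + w) ^+ 2)
    - h (xi - w) * h xi * h (xi + w) * h (xi + w + w)
    - Q ^+ 2 * (h (xi - w) * h xi ^+ 2 * h (xi + w) + h xi * h (xi + w) ^+ 2 * h (xi + w + w)
      - h (xi - w) * h xi * h (xi + w) * h (xi + w + w))
    + (Q ^+ 2 - 1) ^+ 2 * (h (xi - w) * h xi * h (xi + w) * h (xi + w + w)) =
    (Q ^+ 2 - 1) ^+ 2 * Q * (h (xi - w) * h xi + h (xi - w) * h (xi + w + w) + h (xi + w) * h (xi + w + w)).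
  rewrite hB !hS !eS /h -/Q; have := expR_gt0 (pi * xi); have : 0 < Q by exact: expR_gt0.
  by move: (expR _) Q => X q q0 X0; field; rewrite !gt_eqF.
move: H (h_neq0 xi) (h_neq0 (xi + w)) (h_neq0 (xi + w + w)) (h_neq0 (xi - w)).
move: (h xi) (h (xi + w)) (h (xi + w + w)) (h (xi - w)) => h0 h1 h2 hm H n0 n1 n2 nm.
(* A common denominator of the two sides, with [h0] and [h1] squared; clearing it leaves the
   polynomial relation [H]. *)
have n : h0 * h1 * h2 * hm * h0 * h1 != 0 by rewrite !mulf_neq0.
apply: (mulIf n); apply/eqP; rewrite -subr_eq0; apply/eqP.
move/eqP: H; rewrite -subr_eq0 => /eqP <-.
by field; rewrite n0 n1 n2 nm.
Qed.

Lemma cos_sin_products w x t : [/\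
   sin (w * x) * cos (t * x) = (sin ((t + w) * x) - sin ((t - w) * x)) / 2 &
   sin (w * x) * sin (t * x) = (cos ((t - w) * x) - cos ((t + w) * x)) / 2].
Proof.
rewrite [(t + w) * x]mulrDl [(t - w) * x]mulrBl; split; first by rewrite sinB sinD; field.
by rewrite cosB cosD; field.
Qed.

Let sechN t : s (- t) = s t. Proof. by rewrite mulrN sech2N. Qed.
Let negD t r : - t + r = - (t - r).
Proof. by rewrite opprB addrC. Qed.

Section KernelRelations.
Variables (w x : R).
Let Q := expR (pi * w).
Let D0 := data_kernel x.
Let K1 := data_sech (data_cos w D0).
Let K2 := data_sech (data_cos w (data_sin w D0)).
Let K3 := data_sech (data_cos w (data_sin w (data_sin w D0))).
Let K4 := data_sech (data_cos w (data_sech (data_cos w (data_sech (data_cos w D0))))).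

Let dD0 : packet_data D0. Proof. exact: packet_data_kernel. Qed.
Let dK1 : packet_data K1.
Proof. by apply: packet_data_sech; apply: packet_data_cos. Qed.
Let dK2 : packet_data K2.
Proof. by apply: packet_data_sech; apply: packet_data_cos; apply: packet_data_sin. Qed.
Let dK3 : packet_data K3.
Proof.
by apply: packet_data_sech; apply: packet_data_cos; apply: packet_data_sin; apply: packet_data_sin.
Qed.
Let dK4 : packet_data K4.
Proof. by do 3 (apply: packet_data_sech; apply: packet_data_cos). Qed.

(** As functions of [y] these are the kernels at the point [x] of the operators [S c S], [S c d S],
    [S c d d S] and [S c S c S c S], with [c] and [d] the multiplications by [cos (w y)] and
    [sin (w y)]. Each arises by applying the transposed factors to the outermost kernel
    [sech2 (x - y)]. *)
Definition kernel1 := S (fun y => cos (w * y) * sech2 (x - y)).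
Definition kernel2 := S (fun y => cos (w * y) * (sin (w * y) * sech2 (x - y))).
Definition kernel3 := S (fun y => cos (w * y) * (sin (w * y) * (sin (w * y) * sech2 (x - y)))).
Definition kernel4 := S (fun y => cos (w * y) * S (fun y => cos (w * y) * kernel1 y) y).

Let D0E : (fun y => sech2 (x - y)) = packet D0.
Proof. by rewrite packet_kernel. Qed.

Let sinE : (fun y => sin (w * y) * sech2 (x - y)) = packet (data_sin w D0).
Proof. by rewrite -packet_sin// -D0E. Qed.

Let k1E : kernel1 = packet K1.
Proof. by rewrite /kernel1 -sech_conv_packet -?packet_cos// -?D0E//; exact: packet_data_cos. Qed.

Let k2E : kernel2 = packet K2.
Proof.
rewrite /kernel2 -sech_conv_packet; last by apply: packet_data_cos; apply: packet_data_sin.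
by rewrite -packet_cos -?sinE//; exact: packet_data_sin.
Qed.

Let k3E : kernel3 = packet K3.
Proof.
have d1 := packet_data_sin w dD0; have d2 := packet_data_sin w d1.
rewrite /kernel3 -sech_conv_packet; last exact: packet_data_cos.
by rewrite -packet_cos// -packet_sin// -sinE.
Qed.

Let k4E : kernel4 = packet K4.
Proof.
have d1 := packet_data_cos w dK1; have d2 := packet_data_sech d1; have d3 := packet_data_cos w d2.
by rewrite /kernel4 k1E packet_cos// sech_conv_packet// packet_cos// sech_conv_packet.
Qed.

(** The claim is a linear combination of the four hypotheses, and the intermediate expression
    displays the multipliers. In the cosine component [s_k] and [r_k] are the symbol at [xi + k w]
    and [xi - k w], [c1] and [d1] are cosine phases at [xi + w] and [xi - w], and [e0], [e2], [f2]
    are sine phases. *)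
Let relation1_certificate (p v q s0 s1 s2 r1 r2 c1 d1 e0 e2 f2 : R) :
  v * c1 = (e2 - e0) / 2 -> v * d1 = (e0 - f2) / 2 ->
  s1 * (s0 + s2) = q * (s0 * s2) -> r1 * (r2 + s0) = q * (r2 * s0) ->
  1 * ((2 * p * s1 * ((s0 * e0 + s2 * e2) / 2) - 2 * p * r1 * ((r2 * f2 + s0 * e0) / 2)) / 2)
  + v * (2 * p * s0 * ((r1 * d1 + s1 * c1) / 2)) =
  q * (2 * p * s0 * (((s0 * e0 - r2 * f2) / 2 + (s2 * e2 - s0 * e0) / 2) / 2)) +
  0 * (2 * p * s0 * (((s0 * e0 - r2 * f2) / 2 + (s2 * e2 - s0 * e0) / 2) / 2)).
Proof.
move=> p1 p2 q1 q2; apply/eqP; rewrite -subr_eq0; apply/eqP.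
transitivity (p * s0 * s1 * (v * c1 - (e2 - e0) / 2) + p * s0 * r1 * (v * d1 - (e0 - f2) / 2)
  + p / 2 * e2 * (s1 * (s0 + s2) - q * (s0 * s2)) - p / 2 * f2 * (r1 * (r2 + s0) - q * (r2 * s0))).
  by field.
by rewrite p1 p2 q1 q2 !subrr !mulr0 !addr0 subr0.
Qed.

(** A factor [sin (w * y)] is [d] acting first, a factor [sin (w * x)] is [d] acting last: this is
    the kernel of [S c S d + d S c S = (Q + Q^-1) S c d S]. It rests on [symbol_relation1] at
    [xi + w] and [xi - w]. *)
Lemma kernel_relation1 y :
  sin (w * y) * kernel1 y + sin (w * x) * kernel1 y = (Q + Q^-1) * kernel2 y.
Proof.
rewrite k1E k2E.
have -> : sin (w * y) * packet K1 y = packet (data_sin w K1) y by rewrite -packet_sin.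
have d1 := packet_data_sin w dK1.
rewrite -[X in X + _]mul1r -packet_lin// -[RHS]addr0 -[X in _ = _ + X](mul0r (packet K2 y)) -packet_lin//.
congr (packet _ y); rewrite /data_lin; congr pair; apply/funext => xi /=;
  rewrite ?(subrK, addrK) /sech_symbol.
- have [p1 _] := cos_sin_products w x (xi + w); have [p2 _] := cos_sin_products w x (xi - w).
  have q1 := symbol_relation1 w (xi + w); have q2 := symbol_relation1 w (xi - w).
  rewrite ?(subrK, addrK) in p1 p2 q1 q2.
  exact: relation1_certificate.
- have [_ p1] := cos_sin_products w x (xi + w); have [_ p2] := cos_sin_products w x (xi - w).
  have q1 := symbol_relation1 w (xi + w); have q2 := symbol_relation1 w (xi - w).
  rewrite ?(subrK, addrK) in p1 p2 q1 q2.
  (* The sine component is the same identity with phases turned by a quarter period: cosines become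
     minus sines, sines become cosines. *)
  have p1' : sin (w * x) * - sin ((xi + w) * x) = (cos ((xi + w + w) * x) - cos (xi * x)) / 2.
    by rewrite mulrN p1; field.
  have p2' : sin (w * x) * - sin ((xi - w) * x) = (cos (xi * x) - cos ((xi - w - w) * x)) / 2.
    by rewrite mulrN p2; field.
  have H := relation1_certificate (- pi) p1' p2' q1 q2.
  by move: H; rewrite -/Q; move: (Q + Q^-1) => v; lra.
Qed.

(* [s_k] stands for the symbol at [xi + k w], and [c_k], [z_k] for the phases
   [cos ((xi + k w) x)], [sin ((xi + k w) x)] ([m] marks negative [k]). *)
Let relation2_certificate (p v q sm3 sm2 sm1 s0 s1 s2 s3 cm3 cm1 c1 c3 zm2 z0 z2 : R)
    (al := - (q ^+ 2 - 1) ^+ 2 / 4) (be := al * q / p ^+ 2) : p != 0 ->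
  v * zm2 = (cm3 - cm1) / 2 -> v * z0 = (cm1 - c1) / 2 -> v * z2 = (c1 - c3) / 2 ->
  - q * (s0 * s2) - q * (s1 * s3) + s0 * s3 + q ^+ 2 * (s1 * s2) =
    (q ^+ 2 - 1) ^+ 2 * q * (s0 * s1 * s2 * s3) ->
  - q * (s0 * sm2) - q * (sm1 * sm3) + s0 * sm3 + q ^+ 2 * (sm1 * sm2) =
    (q ^+ 2 - 1) ^+ 2 * q * (s0 * sm1 * sm2 * sm3) ->
  q * (s1 * sm1) + q * (s0 * s2) - s0 * s1 - q ^+ 2 * (s1 * s2 + sm1 * s0 - s0 * s1) =
    - (q ^+ 2 - 1) ^+ 2 * (s0 * s1) + (q ^+ 2 - 1) ^+ 2 * q * (s0 * s1) * (s1 * s2 + s0 * s1 + sm1 * s0) ->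
  q * (sm1 * s1) + q * (s0 * sm2) - s0 * sm1 - q ^+ 2 * (sm1 * sm2 + s1 * s0 - s0 * sm1) =
    - (q ^+ 2 - 1) ^+ 2 * (s0 * sm1) + (q ^+ 2 - 1) ^+ 2 * q * (s0 * sm1) * (sm1 * sm2 + s0 * sm1 + s1 * s0) ->
  q * (v * (2 * p * s0 * ((((s0 * z0 - sm2 * zm2) / 2) + ((s2 * z2 - s0 * z0) / 2)) / 2)) + 1 * ((2 * p * s1 * ((((sm1 * cm1 - s1 * c1) / 2) + ((s1 * c1 - s3 * c3) / 2)) / 2) - 2 * p * sm1 * ((((sm3 * cm3 - sm1 * cm1) / 2) + ((sm1 * cm1 - s1 * c1) / 2)) / 2)) / 2)) + 1 * (-1 * (2 * p * s0 * ((((((sm1 * cm1 - s1 * c1) / 2) - ((sm3 * cm3 - sm1 * cm1) / 2)) / 2) + ((((s1 * c1 - s3 * c3) / 2) - ((sm1 * cm1 - s1 * c1) / 2)) / 2)) / 2)) + - (q ^+ 2 * v) * ((2 * p * s1 * ((s0 * z0 + s2 * z2) / 2) - 2 * p * sm1 * ((sm2 * zm2 + s0 * z0) / 2)) / 2)) =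
  al * (2 * p * s0 * ((sm1 * cm1 + s1 * c1) / 2)) + - be * (2 * p * s0 * ((2 * p * sm1 * ((2 * p * sm2 * ((sm3 * cm3 + sm1 * cm1) / 2) + 2 * p * s0 * ((sm1 * cm1 + s1 * c1) / 2)) / 2) + 2 * p * s1 * ((2 * p * s0 * ((sm1 * cm1 + s1 * c1) / 2) + 2 * p * s2 * ((s1 * c1 + s3 * c3) / 2)) / 2)) / 2)).
Proof.
move=> p0 pm pz pp H3 H3m H4 H4m; apply/eqP; rewrite -subr_eq0; apply/eqP.
transitivity (p / 2 * (q * s0 * s2 - q ^+ 2 * s1 * s2) * (v * z2 - (c1 - c3) / 2)
  - p / 2 * q ^+ 2 * (s0 * s1 - s0 * sm1) * (v * z0 - (cm1 - c1) / 2)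
  + p / 2 * (q ^+ 2 * sm1 * sm2 - q * s0 * sm2) * (v * zm2 - (cm3 - cm1) / 2)
  + p / 4 * c3 * (- q * (s0 * s2) - q * (s1 * s3) + s0 * s3 + q ^+ 2 * (s1 * s2) - ((q ^+ 2 - 1) ^+ 2 * q * (s0 * s1 * s2 * s3)))
  + p / 4 * cm3 * (- q * (s0 * sm2) - q * (sm1 * sm3) + s0 * sm3 + q ^+ 2 * (sm1 * sm2) - ((q ^+ 2 - 1) ^+ 2 * q * (s0 * sm1 * sm2 * sm3)))
  + p / 4 * c1 * (q * (s1 * sm1) + q * (s0 * s2) - s0 * s1 - q ^+ 2 * (s1 * s2 + sm1 * s0 - s0 * s1) - (- (q ^+ 2 - 1) ^+ 2 * (s0 * s1) + (q ^+ 2 - 1) ^+ 2 * q * (s0 * s1) * (s1 * s2 + s0 * s1 + sm1 * s0)))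
  + p / 4 * cm1 * (q * (sm1 * s1) + q * (s0 * sm2) - s0 * sm1 - q ^+ 2 * (sm1 * sm2 + s1 * s0 - s0 * sm1) - (- (q ^+ 2 - 1) ^+ 2 * (s0 * sm1) + (q ^+ 2 - 1) ^+ 2 * q * (s0 * sm1) * (sm1 * sm2 + s0 * sm1 + s1 * s0)))).
  by rewrite /be /al; field.
by rewrite pm pz pp H3 H3m H4 H4m !subrr !mulr0 !addr0 subr0.
Qed.

(** With [K = S c], the kernel of [Q (d K d S + K d S d) - K d d S - Q^2 d K S d = al K S - be K K K
    S]. The left side is [- Q] times the product of the two ladder operators, with the innermost [c]
    stripped off. *)
Lemma kernel_relation2 y (al := - (Q ^+ 2 - 1) ^+ 2 / 4) (be := al * Q / pi ^+ 2) :
  Q * (sin (w * x) * kernel2 y + sin (w * y) * kernel2 y) - kernel3 y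
  - Q ^+ 2 * sin (w * x) * (sin (w * y) * kernel1 y) = al * kernel1 y - be * kernel4 y.
Proof.
rewrite k1E k2E k3E k4E.
have -> : sin (w * y) * packet K1 y = packet (data_sin w K1) y by rewrite -packet_sin.
have -> : sin (w * y) * packet K2 y = packet (data_sin w K2) y by rewrite -packet_sin.
have d1 := packet_data_sin w dK1; have d2 := packet_data_sin w dK2.
transitivity (packet (data_lin Q (data_lin (sin (w * x)) K2 1 (data_sin w K2)) 1
  (data_lin (-1) K3 (- (Q ^+ 2 * sin (w * x))) (data_sin w K1))) y).
  by rewrite !packet_lin//; [ring|exact: packet_data_lin..].
transitivity (packet (data_lin al K1 (- be) K4) y); last by rewrite packet_lin// mulNr.
congr (packet _ y); rewrite /data_lin; congr pair; apply/funext => xi /=;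
  rewrite ?(subrK, addrK) /sech_symbol.
all: have pi0 : pi != 0 :> R by rewrite gt_eqF// pi_gt0.
(* The relations at [- xi], rewritten by evenness of the symbol, handle the mirrored phases at
   [xi - w] and [xi - 3 w]. *)
all: have H3 := symbol_relation3 w xi; have H3m := symbol_relation3 w (- xi).
all: have H4 := symbol_relation4 w xi; have H4m := symbol_relation4 w (- xi).
all: rewrite ?(negD xi w, negD (xi - w) w, negD (xi - w - w) w) -?[- xi - w]opprD !sechN in H3m H4m.
- have [_ p0] := cos_sin_products w x xi; have [_ p1] := cos_sin_products w x (xi + w + w).
  have [_ p2] := cos_sin_products w x (xi - w - w); rewrite ?(subrK, addrK) in p0 p1 p2.
  exact: (relation2_certificate pi0 p2 p0 p1 H3 H3m H4 H4m).
- have [p0 _] := cos_sin_products w x xi; have [p1 _] := cos_sin_products w x (xi + w + w).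
  have [p2 _] := cos_sin_products w x (xi - w - w); rewrite ?(subrK, addrK) in p0 p1 p2.
  have neg (a b e : R) : sin (w * x) * a = (b - e) / 2 -> sin (w * x) * - a = (e - b) / 2.
    by rewrite mulrN => ->; field.
  have H := relation2_certificate pi0 (neg _ _ _ p2) (neg _ _ _ p0) (neg _ _ _ p1) H3 H3m H4 H4m.
  by move: H; rewrite -/Q -/al -/be; move=> H; apply: etrans (etrans H _); field.
Qed.

End KernelRelations.

End WavePackets.

(** * Ladder operators *)

Section LadderOperators.
Variables (R : realType) (w : R).
Implicit Types (x y : R) (u v g : R -> R).
Notation leb := (@lebesgue_measure R).
Notation Lint f := (leb.-integrable setT (EFin \o f)).
Local Notation S := (@sech_conv R).
Local Notation c := (fun y => cos (w * y)).
Local Notation d := (fun y => sin (w * y)).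
Let Q := expR (pi * w).

Definition mathieu u := S (fun y => cos (w * y) * u y).
Local Notation K := mathieu.

Lemma bounded_cosM u : bounded_mfun u -> bounded_mfun (fun y => c y * u y).
Proof. by move=> bu; apply: bounded_mfunM => //; exact: bounded_mfun_cos. Qed.

Lemma bounded_sinM u : bounded_mfun u -> bounded_mfun (fun y => d y * u y).
Proof. by move=> bu; apply: bounded_mfunM => //; exact: bounded_mfun_sin. Qed.

Lemma bounded_mathieu u : bounded_mfun u -> bounded_mfun (K u).
Proof. by move=> bu; apply: bounded_sech_conv; exact: bounded_cosM. Qed.

Lemma mathieuD u v : bounded_mfun u -> bounded_mfun v ->
  K (fun y => u y + v y) = (fun x => K u x + K v x).
Proof.
move=> bu bv; rewrite /mathieu -sech_convD; [|exact: bounded_cosM..].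
by congr sech_conv; apply/funext => y; rewrite mulrDr.
Qed.

Lemma mathieuZ k u : bounded_mfun u -> K (fun y => k * u y) = (fun x => k * K u x).
Proof.
move=> bu; rewrite /mathieu -sech_convZ; last exact: bounded_cosM.
by congr sech_conv; apply/funext => y; rewrite mulrCA.
Qed.

Lemma mathieuB u v : bounded_mfun u -> bounded_mfun v ->
  K (fun y => u y - v y) = (fun x => K u x - K v x).
Proof.
move=> bu bv; have := mathieuD bu (bounded_mfunZ (-1) bv).
rewrite mathieuZ// => E; under eq_fun do rewrite -mulN1r.
by rewrite E; apply/funext => x; rewrite mulN1r.
Qed.

(* [K] and the ladder operators only see [u] through [v = c u], and all compositions
   below are integral operators in [v] whose kernel is obtained by moving [S] to the left. *)
Section Transposition.
Variable x : R.

Let transpose g u : Lint (fun y => sech2 (x - y) * g y) -> bounded_mfun u ->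
  \int[leb]_y (sech2 (x - y) * (g y * S u y)) =
  \int[leb]_y (S (fun z => g z * sech2 (x - z)) y * u y).
Proof.
move=> gi bu; under eq_Rintegral do rewrite mulrA.
rewrite (sech_conv_adjoint gi bu).1.
by apply: eq_Rintegral => y _; congr (S _ y * _); apply/funext => z; rewrite mulrC.
Qed.

Let gc : Lint (fun y => sech2 (x - y) * c y).
Proof. by apply: sech_conv_int_bounded; exact: bounded_mfun_cos. Qed.

Lemma mathieu_sech v : bounded_mfun v -> K (S v) x = \int[leb]_y (kernel1 w x y * v y).
Proof. by move=> bv; exact: transpose. Qed.

Lemma mathieu_sin_sech v : bounded_mfun v ->
  K (fun y => d y * S v y) x = \int[leb]_y (kernel2 w x y * v y).
Proof.
move=> bv; have gi : Lint (fun y => sech2 (x - y) * (c y * d y)).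
  by apply: sech_conv_int_bounded; apply: bounded_cosM; exact: bounded_mfun_sin.
apply: etrans (etrans (transpose gi bv) _); apply: eq_Rintegral => y _.
  by rewrite -[_ * _ * S v y]mulrA.
by congr (S _ y * _); apply/funext => z; rewrite -mulrA.
Qed.

Lemma mathieu_sin_sin_sech v : bounded_mfun v ->
  K (fun y => d y * (d y * S v y)) x = \int[leb]_y (kernel3 w x y * v y).
Proof.
move=> bv; have gi : Lint (fun y => sech2 (x - y) * (c y * (d y * d y))).
  apply: sech_conv_int_bounded; apply: bounded_cosM; apply: bounded_sinM.
  exact: bounded_mfun_sin.
apply: etrans (etrans (transpose gi bv) _); apply: eq_Rintegral => y _.
  by rewrite -!mulrA.
by congr (S _ y * _); apply/funext => z; rewrite -!mulrA.
Qed.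

Lemma integrable_kernel1 : Lint (kernel1 w x).
Proof.
rewrite /kernel1; apply: integrable_sech_conv.
by under eq_fun do rewrite mulrC.
Qed.

Let cosL g : Lint g -> Lint (fun y => c y * g y).
Proof. by move=> gi; have [mc [B cB]] := bounded_mfun_cos w; exact: integrable_bounded_mull cB. Qed.

Lemma mathieu3_sech v : bounded_mfun v -> K (K (K (S v))) x = \int[leb]_y (kernel4 w x y * v y).
Proof.
move=> bv; have b1 := bounded_sech_conv bv.
have b2 := bounded_mathieu b1.
have step g u : Lint g -> bounded_mfun u ->
    \int[leb]_y (g y * K u y) = \int[leb]_y (c y * S g y * u y).
  move=> gi bu; rewrite (sech_conv_adjoint gi (bounded_cosM bu)).1.
  by apply: eq_Rintegral => y _; rewrite mulrCA mulrA.
have i1 := integrable_kernel1; have i2 := cosL i1.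
have i3 := cosL (integrable_sech_conv i2).
transitivity (\int[leb]_y (kernel1 w x y * (c y * K (S v) y))).
  by rewrite -mathieu_sech; last exact: bounded_cosM.
under eq_Rintegral do rewrite mulrA [_ * c _]mulrC.
rewrite step//.
by rewrite (sech_conv_adjoint i3 bv).1.
Qed.

Lemma integrable_kernel2 : Lint (kernel2 w x).
Proof.
rewrite /kernel2; apply: integrable_sech_conv; apply: cosL.
under eq_fun do rewrite mulrC; apply: sech_conv_int_bounded; exact: bounded_mfun_sin.
Qed.

Lemma integrable_kernel3 : Lint (kernel3 w x).
Proof.
rewrite /kernel3; apply: integrable_sech_conv; apply: cosL.
under eq_fun do rewrite mulrA mulrC; apply: sech_conv_int_bounded.
by apply: bounded_sinM; exact: bounded_mfun_sin.
Qed.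

Lemma integrable_kernel4 : Lint (kernel4 w x).
Proof.
rewrite /kernel4; apply: integrable_sech_conv; apply: cosL; apply: integrable_sech_conv.
by apply: cosL; exact: integrable_kernel1.
Qed.

End Transposition.

(** [kernel_relation1] integrated against [v]. For [v = c u], where [S v = K u], it reads
    [K K d + d K K = (Q + Q^-1) K d K]. *)
Lemma mathieu_exchange v x : bounded_mfun v ->
  K (S (fun y => d y * v y)) x + d x * K (S v) x =
  (Q + Q^-1) * K (fun y => d y * S v y) x.
Proof.
move=> bv; rewrite mathieu_sech ?mathieu_sech ?mathieu_sin_sech//; last exact: bounded_sinM.
have I k : Lint k -> Lint (fun y => k y * v y) by move=> ki; exact: integrable_bounded_mfun.
have i1 := integrable_kernel1 x; have i2 := integrable_kernel2 x.
rewrite -!RintegralZl//; [|exact: I|exact: I].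
rewrite -RintegralD//; last 2 first.
- by apply: integrable_bounded_mfun => //; exact: bounded_sinM.
- by apply: integrableZ_fun; exact: I.
apply: eq_Rintegral => y _.
rewrite [RHS]mulrA -(kernel_relation1 w x y); ring.
Qed.

Lemma mathieu_exchange2 v x (al := - (Q ^+ 2 - 1) ^+ 2 / 4) (be := al * Q / pi ^+ 2) :
  bounded_mfun v ->
  Q * (d x * K (fun y => d y * S v y) x + K (fun y => d y * S (fun z => d z * v z) y) x)
  - K (fun y => d y * (d y * S v y)) x - Q ^+ 2 * d x * K (S (fun y => d y * v y)) x =
  al * K (S v) x - be * K (K (K (S v))) x.
Proof.
move=> bv; have bdv := bounded_sinM bv.
rewrite mathieu3_sech// mathieu_sin_sin_sech// !mathieu_sin_sech// !mathieu_sech//.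
have I k u : Lint k -> bounded_mfun u -> Lint (fun y => k y * u y) by exact: integrable_bounded_mfun.
have i1 := integrable_kernel1 x; have i2 := integrable_kernel2 x.
have i3 := integrable_kernel3 x; have i4 := integrable_kernel4 x.
have E1 : \int[leb]_y (al * (kernel1 w x y * v y) - be * (kernel4 w x y * v y)) =
    al * \int[leb]_y (kernel1 w x y * v y) - be * \int[leb]_y (kernel4 w x y * v y).
  by rewrite -!RintegralZl ?RintegralB//; try exact: I; apply: integrableZ_fun; exact: I.
rewrite -E1 mulrDr mulrA.
have IZ k (g : R -> R) u : Lint g -> bounded_mfun u ->
    k * \int[leb]_y (g y * u y) = \int[leb]_y (k * (g y * u y)).
  by move=> gi bu; rewrite RintegralZl//; exact: I.
rewrite !IZ//.
rewrite -RintegralD//; try (apply: integrableZ_fun; exact: I).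
rewrite -RintegralB//; [|by apply: integrableD_fun; apply: integrableZ_fun; exact: I|exact: I].
rewrite -RintegralB//; last 2 first.
- apply: integrableB_fun; last exact: I.
  by apply: integrableD_fun; apply: integrableZ_fun; exact: I.
- by apply: integrableZ_fun; exact: I.
apply: eq_Rintegral => y _.
rewrite !mulrA -mulrBl -(kernel_relation2 w x y) -/Q; ring.
Qed.

Lemma mathieu_linB k u v : bounded_mfun u -> bounded_mfun v ->
  K (fun y => k * u y - v y) = (fun x => k * K u x - K v x).
Proof. by move=> bu bv; rewrite mathieuB ?mathieuZ//; exact: bounded_mfunZ. Qed.

Definition ladder u x := Q * K (fun y => d y * u y) x - d x * K u x.

Lemma bounded_ladder u : bounded_mfun u -> bounded_mfun (ladder u).
Proof.
move=> bu; apply: bounded_mfunB; last by apply: bounded_sinM; exact: bounded_mathieu.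
by apply: bounded_mfunZ; apply: bounded_mathieu; exact: bounded_sinM.
Qed.

Lemma ladderD u v : bounded_mfun u -> bounded_mfun v ->
  ladder (fun y => u y + v y) = (fun x => ladder u x + ladder v x).
Proof.
move=> bu bv; apply/funext => x; rewrite /ladder mathieuD//.
rewrite (_ : (fun y => d y * (u y + v y)) = (fun y => d y * u y + d y * v y)); last first.
  by apply/funext => y; rewrite mulrDr.
by rewrite mathieuD; [ring|exact: bounded_sinM..].
Qed.

Lemma ladderZ k u : bounded_mfun u -> ladder (fun y => k * u y) = (fun x => k * ladder u x).
Proof.
move=> bu; apply/funext => x; rewrite /ladder mathieuZ//.
rewrite (_ : (fun y => d y * (k * u y)) = (fun y => k * (d y * u y))); last first.
  by apply/funext => y; rewrite mulrCA.
by rewrite mathieuZ; [ring|exact: bounded_sinM].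
Qed.

Lemma mathieu_sinE u : K (fun y => d y * u y) = S (fun y => d y * (c y * u y)).
Proof. by rewrite /mathieu; under eq_fun do rewrite mulrCA. Qed.

(** Expanding with [R = Q K d - d K], the difference [K R - Q R K] is [Q] times the difference of
    the two sides of [mathieu_exchange]. *)
Lemma mathieu_ladder u : bounded_mfun u ->
  K (ladder u) = (fun x => Q * ladder (K u) x).
Proof.
move=> bu; have bv := bounded_cosM bu; have Q0 : Q != 0 by rewrite gt_eqF// expR_gt0.
apply/funext => x; rewrite {1}/ladder mathieu_linB; last 2 first.
- by apply: bounded_mathieu; exact: bounded_sinM.
- by apply: bounded_sinM; exact: bounded_mathieu.
rewrite /ladder mathieu_sinE -/(S _) -/(K u).
have := mathieu_exchange x bv; rewrite -/(K u) => H.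
apply/eqP; rewrite -subr_eq0; apply/eqP.
move/eqP: H; rewrite -subr_eq0 => /eqP H.
transitivity (Q * 0); last by rewrite mulr0.
rewrite -H -/Q; clear H.
move: (K (S _) x) (K (K u) x) (K (fun y => d y * K u y) x) (sin (w * x)) => k1 k2 k3 dx.
by field.
Qed.

End LadderOperators.

Section LadderRelations.
Variables (R : realType) (w : R).
Implicit Types (x y : R) (u v : R -> R).
Notation leb := (@lebesgue_measure R).
Local Notation S := (@sech_conv R).
Local Notation K := (mathieu w).
Local Notation c := (fun y => cos (w * y)).
Local Notation d := (fun y => sin (w * y)).
Let Q := expR (pi * w).

(** [K] sees [w] only through the cosine, so [ladder (- w)] is a ladder for the same operator, with
    [Q^-1] in place of [Q]. *)
Lemma mathieuN u : mathieu (- w) u = K u.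
Proof. by rewrite /mathieu; congr sech_conv; apply/funext => y; rewrite mulNr cosN. Qed.

Lemma ladderNE u : bounded_mfun u ->
  ladder (- w) u = (fun x => d x * K u x - Q^-1 * K (fun y => d y * u y) x).
Proof.
move=> bu; apply/funext => x; rewrite /ladder !mathieuN mulrN expRN mulNr sinN.
rewrite (_ : (fun y => sin (- w * y) * u y) = (fun y => -1 * (d y * u y))); last first.
  by apply/funext => y; rewrite (mulNr w) sinN mulN1r mulNr.
by rewrite mathieuZ; [rewrite -/Q; ring|exact: bounded_sinM].
Qed.

(** Multiplied by [- Q], the left side expands into the left side of [mathieu_exchange2] at
    [v = c u]. *)
Lemma ladder_ladder u (b := Q / pi ^+ 2) : bounded_mfun u ->
  ladder (- w) (ladder w u) =
  (fun x => (Q ^+ 2 - 1) ^+ 2 / (4 * Q) * (K (K u) x - b * K (K (K (K u))) x)).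
Proof.
move=> bu; have bv : bounded_mfun (fun y => c y * u y) by exact: bounded_cosM.
have Q0 : Q != 0 by rewrite gt_eqF// expR_gt0.
have pi0 : pi != 0 :> R by rewrite gt_eqF// pi_gt0.
have b1 := bounded_mathieu w (bounded_sinM w bu).
have b2 := bounded_sinM w (bounded_mathieu w bu).
rewrite ladderNE; last exact: bounded_ladder.
apply/funext => x; have := mathieu_exchange2 w x bv.
rewrite -/(K u) -/Q -(mathieu_sinE w u) => H.
have -> : K (ladder w u) x = Q * K (K (fun y => d y * u y)) x - K (fun y => d y * K u y) x.
  exact: (congr1 (fun f => f x) (mathieu_linB w Q b1 b2)).
have -> : (fun y => d y * ladder w u y) =
    (fun y => Q * (d y * K (fun z => d z * u z) y) - d y * (d y * K u y)).
  by apply/funext => y; rewrite /ladder -/Q; ring.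
rewrite mathieu_linB; [|exact: bounded_sinM|exact: bounded_sinM].
move: H; rewrite /b.
move: (K (K (K (K u))) x) (K (fun y => d y * K u y) x) (K (fun y => d y * (d y * K u y)) x)
  (K (fun y => d y * K (fun z => d z * u z) y) x) (K (K (fun y => d y * u y)) x) (K (K u) x).
move=> k1 k2 k3 k4 k5 k6 H.
transitivity (- Q^-1 * (- (Q ^+ 2 - 1) ^+ 2 / 4 * k6 - - (Q ^+ 2 - 1) ^+ 2 / 4 * Q / pi ^+ 2 * k1)).
  by rewrite -H; field.
have ppi : pi ^+ 2 != 0 :> R by rewrite expf_neq0.
move: (pi ^+ 2) ppi Q0 => p2 ppi; rewrite /Q; move: (expR _) => q q0; field.
by rewrite q0 ppi.
Qed.

End LadderRelations.

(** * Resolvents *)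

Section LadderOfResolvents.
Variables (T : Type) (F : fieldType) (W : (T -> F) -> Prop).
Implicit Types (u v g : T -> F) (K : (T -> F) -> T -> F).

Definition lin_closed := forall a u v, W u -> W v -> W (fun x => a * u x + v x).

Definition linear_on K := (forall u, W u -> W (K u)) /\
  forall a u v, W u -> W v -> K (fun x => a * u x + v x) = (fun x => a * K u x + K v x).

(** Bijectivity of [K - l] on the function space [W] itself, with equality of functions instead of
    classes modulo null sets. *)
Definition regular K l :=
  (forall u, W u -> K u = (fun x => l * u x) -> u = (fun=> 0)) /\
  (forall g, W g -> exists2 u, W u & (fun x => K u x - l * u x) = g).

Hypothesis WL : lin_closed.

Let W0 u : W u -> W (fun=> 0).
Proof. by move=> Wu; have := WL (-1) Wu Wu; under eq_fun do rewrite mulN1r addNr. Qed.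

Let WZ a u : W u -> W (fun x => a * u x).
Proof. by move=> Wu; have := WL a Wu (W0 Wu); under eq_fun do rewrite addr0. Qed.

Lemma linear_on0 K u : W u -> linear_on K -> K (fun=> 0) = (fun=> 0).
Proof.
move=> Wu [_ KL]; have := KL (-1) _ _ (W0 Wu) (W0 Wu).
under eq_fun do rewrite mulr0 addr0.
by move=> ->; apply/funext => x; rewrite mulN1r addNr.
Qed.

Lemma linear_onZ K a u : W u -> linear_on K -> K (fun x => a * u x) = (fun x => a * K u x).
Proof.
move=> Wu KL; have [_ H] := KL; have := H a _ _ Wu (W0 Wu).
under eq_fun do rewrite addr0.
by move=> ->; rewrite (linear_on0 Wu KL); apply/funext => x; rewrite addr0.
Qed.

(* If [g] is given and [h] solves [(K - q l) h = q Rp g], then [(K - l) (Rm h) = Rm Rp g],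
   which modulo the range of [K - l] is a nonzero multiple of [g]. *)
Lemma regular_ladder K Rp Rm q a b l :
  linear_on K -> linear_on Rp -> linear_on Rm ->
  q != 0 -> a != 0 -> l != 0 -> b * l ^+ 2 != 1 ->
  (forall u, W u -> K (Rp u) = (fun x => q * Rp (K u) x)) ->
  (forall u, W u -> K (Rm u) = (fun x => q^-1 * Rm (K u) x)) ->
  (forall u, W u -> Rm (Rp u) = (fun x => a * (K (K u) x - b * K (K (K (K u))) x))) ->
  regular K (q * l) -> regular K l.
Proof.
move=> KL pL mL q0 a0 l0 bl KRp KRm RmRp [inj surj].
have [KW KD] := KL; have [pW pD] := pL; have [mW mD] := mL.
have k0 : a * (l ^+ 2 - b * l ^+ 4) != 0.
  rewrite (_ : _ * _ = a * (l ^+ 2 * (1 - b * l ^+ 2))); last by ring.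
  by rewrite !mulf_neq0 ?expf_neq0// subr_eq0 eq_sym.
split.
- move=> u Wu Ku.
  (* [Rp u] satisfies the eigenvalue equation for [q l], hence vanishes. Applying [Rm] then shows
     that a nonzero multiple of [u] vanishes. *)
  have : Rp u = (fun=> 0).
    apply: inj; first exact: pW.
    by rewrite KRp// Ku linear_onZ//; apply/funext => x; rewrite mulrA.
  move/(congr1 Rm); rewrite RmRp// (linear_on0 Wu mL) => E.
  apply/funext => x; have /(congr1 (fun f => f x)) := E.
  have KZ k : K (fun x => k * u x) = (fun x => k * l * u x).
    by rewrite linear_onZ// Ku; apply/funext => y; rewrite mulrA.
  rewrite Ku !KZ.
  move=> H; have : a * (l ^+ 2 - b * l ^+ 4) * u x = 0 by rewrite -H; ring.
  by move/eqP; rewrite mulf_eq0 (negPf k0) => /eqP.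
- move=> g Wg; have [h Wh Kh] := surj _ (WZ q (pW _ Wg)).
  have WK1 := KW _ Wg; have WK2 := KW _ WK1; have WK3 := KW _ WK2.
  have KhE : K h = (fun x => (q * l) * h x + q * Rp g x).
    by apply/funext => x; have /= <- := congr1 (fun f => f x) Kh; rewrite addrC subrK.
  have KRh : K (Rm h) = (fun x => l * Rm h x + a * (K (K g) x - b * K (K (K (K g))) x)).
    rewrite KRm// KhE mD//; last by apply: WZ; exact: pW.
    rewrite linear_onZ//; last exact: pW.
    by rewrite RmRp//; apply/funext => x; field.
  (* [f0] is the polynomial quotient [(P(K) - P(l)) / (K - l)] applied to [g], where
     [P(x) = x^2 - b x^4]. It is nested so that each layer has the form [a * u + v] of the linearity
     hypothesis. Then [K - l] maps [Rm h - a f0] to [a P(l) g], which explains the factor [k]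
     below. *)
  pose f3 := fun x => - b * K (K (K g)) x + (fun=> 0) x.
  pose f2 := fun x => - b * l * K (K g) x + f3 x.
  pose f1 := fun x => (1 - b * l ^+ 2) * K g x + f2 x.
  pose f0 := fun x => (l - b * l ^+ 3) * g x + f1 x.
  have z0 := W0 Wg.
  have W3 : W f3 by exact: WL.
  have W2 : W f2 by exact: WL.
  have W1 : W f1 by exact: WL.
  have Wf0 : W f0 by exact: WL.
  have Kf : K f0 = (fun x => (l - b * l ^+ 3) * K g x + ((1 - b * l ^+ 2) * K (K g) x +
      (- b * l * K (K (K g)) x + (- b * K (K (K (K g))) x)))).
    rewrite /f0 KD// /f1 KD// /f2 KD// /f3 KD// (linear_on0 Wg KL).
    by apply/funext => x; rewrite addr0.
  pose k := (a * (l ^+ 2 - b * l ^+ 4))^-1.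
  exists (fun x => k * (- a * f0 x + Rm h x)).
    by apply: WZ; apply: WL => //; exact: mW.
  have Wm := mW _ Wh.
  rewrite linear_onZ//; last exact: WL.
  rewrite KD// Kf KRh; apply/funext => x; apply: (mulfI k0).
  rewrite (mulrCA l) -mulrBr mulrA divff// mul1r /f0 /f1 /f2 /f3; ring.
Qed.

End LadderOfResolvents.

(** * Complex functions as pairs of real ones *)

Section Complexification.
Variable R : realType.
Notation C := (complex R).
Notation leb := (@lebesgue_measure R).
Notation Lint f := (leb.-integrable setT (EFin \o f)).
Implicit Types (u v : R -> R) (f g : R -> C) (P : (R -> R) -> R -> R).
Notation Re := complex.Re.
Notation Im := complex.Im.

Lemma ReD (z z' : C) : Re (z + z') = Re z + Re z'. Proof. by case: z; case: z'. Qed.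
Lemma ImD (z z' : C) : Im (z + z') = Im z + Im z'. Proof. by case: z; case: z'. Qed.
Lemma ReM (z z' : C) : Re (z * z') = Re z * Re z' - Im z * Im z'.
Proof. by case: z; case: z'. Qed.
Lemma ImM (z z' : C) : Im (z * z') = Re z * Im z' + Im z * Re z'.
Proof. by case: z; case: z'. Qed.
Lemma ReN (z : C) : Re (- z) = - Re z. Proof. by case: z. Qed.
Lemma ImN (z : C) : Im (- z) = - Im z. Proof. by case: z. Qed.
Lemma complex_eta (z : C) : z = complex.Complex (Re z) (Im z). Proof. by case: z. Qed.
Lemma complexP (z z' : C) : Re z = Re z' -> Im z = Im z' -> z = z'.
Proof. by rewrite {3}(complex_eta z) {3}(complex_eta z') => -> ->. Qed.

(** The space on which the resolvent of [K] is constructed. Boundedness keeps the identities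
    pointwise, and square integrability is what the inverse passage to the half line requires. *)
Definition square_mfun u := bounded_mfun u /\ Lint (fun x => u x ^+ 2).

Lemma square_mfun_lin k u v : square_mfun u -> square_mfun v ->
  square_mfun (fun x => k * u x + v x).
Proof.
move=> [bu iu] [bv iv]; have bZ : bounded_mfun (fun x => k * u x + v x).
  by apply: bounded_mfunD => //; exact: bounded_mfunZ.
split => //; apply: (@integrable_dominated _ _ (fun x => 2 * (k ^+ 2 * u x ^+ 2) + 2 * v x ^+ 2)).
- by apply: measurable_funX; case: bZ.
- by apply: integrableD_fun; do 2?exact: integrableZ_fun; apply: integrableZ_fun; exact: integrableZ_fun.
- move=> x; rewrite ger0_norm ?sqr_ge0// -subr_ge0.
  by rewrite (_ : _ - _ = (k * u x - v x) ^+ 2) ?sqr_ge0//; ring.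
Qed.

Definition csquare f := square_mfun (fun x => Re (f x)) /\ square_mfun (fun x => Im (f x)).

Definition cmap P f x : C :=
  complex.Complex (P (fun y => Re (f y)) x) (P (fun y => Im (f y)) x).

Definition real_linear P := (forall u, square_mfun u -> square_mfun (P u)) /\
  forall k u v, square_mfun u -> square_mfun v ->
    P (fun x => k * u x + v x) = (fun x => k * P u x + P v x).

Lemma csquare_lin : lin_closed csquare.
Proof.
move=> a f g [f1 f2] [g1 g2]; split.
- under eq_fun do rewrite ReD ReM -addrA -mulNr.
  by apply: square_mfun_lin => //; exact: square_mfun_lin.
- under eq_fun do rewrite ImD ImM -addrA.
  by apply: square_mfun_lin => //; exact: square_mfun_lin.
Qed.

Lemma linear_on_cmap P : real_linear P -> linear_on csquare (cmap P).
Proof.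
move=> [PW PL]; split; first by move=> f [f1 f2]; split; exact: PW.
move=> a f g [f1 f2] [g1 g2]; apply/funext => x; apply: complexP; rewrite /cmap /=.
- under [X in P X]eq_fun do rewrite ReD ReM -addrA -mulNr.
  by rewrite !PL ?ReD ?ReM/= ?mulNr ?addrA//; exact: square_mfun_lin.
- under [X in P X]eq_fun do rewrite ImD ImM -addrA.
  by rewrite !PL ?ImD ?ImM/= ?addrA//; exact: square_mfun_lin.
Qed.

End Complexification.

(** * Limits of sequences with geometric increments *)

Section GeometricLimits.
Variable R : realType.
Notation leb := (@lebesgue_measure R).
Notation Lint f := (leb.-integrable setT (EFin \o f)).
Implicit Types (u v : R -> R).

Lemma geometric_null (z G : R) : (forall n, `|z| <= G * 4^-1 ^+ n) -> z = 0.
Proof.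
move=> zG; apply/eqP; rewrite -normr_le0.
have : (fun n => G * 4^-1 ^+ n) @ \oo --> (0 : R).
  by apply: cvg_geometric; rewrite gtr0_norm ?invr_gt0// invf_lt1// ltr1n.
move=> H; rewrite -(cvg_lim _ H)//; apply: limr_ge; first by apply/cvg_ex; exists 0.
exact: nearW.
Qed.

(** The factor 2 leaves room for one increment, since [G <= 2 G (1 - 1 / 4)]. So [lo] increases,
    [hi] decreases, and the supremum of [lo] lies between them. *)
Lemma geometric_limit (f : nat -> R) G : 0 <= G ->
  (forall n, `|f n.+1 - f n| <= G * 4^-1 ^+ n) ->
  exists l, forall n, `|l - f n| <= 2 * G * 4^-1 ^+ n.
Proof.
move=> G0 inc; have e0 n : 0 <= G * 4^-1 ^+ n by rewrite mulr_ge0// exprn_ge0// invr_ge0.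
pose lo n := f n - 2 * G * 4^-1 ^+ n; pose hi n := f n + 2 * G * 4^-1 ^+ n.
have loS n : lo n <= lo n.+1.
  have := inc n; have := e0 n; rewrite ler_norml /lo exprS -!mulrA.
  by rewrite (mulrCA G); move: (G * _) => e ? /andP[]; lra.
have hiS n : hi n.+1 <= hi n.
  have := inc n; have := e0 n; rewrite ler_norml /hi exprS -!mulrA.
  by rewrite (mulrCA G); move: (G * _) => e ? /andP[]; lra.
have lom m n : (m <= n)%N -> lo m <= lo n.
  by apply: (homo_leq (@lexx _ _) le_trans) => k.
have him m n : (m <= n)%N -> hi n <= hi m.
  by move=> mn; rewrite -lerN2; apply: (homo_leq (f := fun k => - hi k) (@lexx _ _) le_trans) mn => k; rewrite lerN2.
have lohi m n : lo m <= hi n.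
  apply: le_trans (lom _ _ (leq_maxl m n)) _; apply: le_trans _ (him _ _ (leq_maxr m n)).
  by have := e0 (maxn m n); rewrite /lo /hi -!mulrA; move: (G * _) => e; lra.
exists (sup (range lo)) => n.
have ub : has_ubound (range lo) by exists (hi 0%N) => _ [k _ <-].
have l1 : lo n <= sup (range lo) by apply: ub_le_sup => //; exists n.
have l2 : sup (range lo) <= hi n.
  by apply: ge_sup => [|_ [k _ <-] //]; exists (lo 0%N), 0%N.
by move: l1 l2; rewrite ler_norml /lo /hi; lra.
Qed.

(** Uniform convergence preserves boundedness and measurability but not square integrability. The
    latter follows by Fatou's lemma from the common bound [M]. *)
Lemma square_mfun_limit (f : nat -> R -> R) G M : 0 <= G ->
  (forall n, square_mfun (f n)) -> (forall n x, `|f n.+1 x - f n x| <= G * 4^-1 ^+ n) ->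
  (forall n, \int[leb]_x f n x ^+ 2 <= M) ->
  exists u, square_mfun u /\ forall n x, `|u x - f n x| <= 2 * G * 4^-1 ^+ n.
Proof.
move=> G0 sf inc fM.
have /choice[u uf] : forall x, exists l, forall n, `|l - f n x| <= 2 * G * 4^-1 ^+ n.
  by move=> x; exact: (geometric_limit (f := f ^~ x)).
have fu x : f ^~ x @ \oo --> u x.
  apply/cvgrPdist_le => e e0.
  have : (fun n => 2 * G * 4^-1 ^+ n) @ \oo --> (0 : R).
    by apply: cvg_geometric; rewrite gtr0_norm ?invr_gt0// invf_lt1// ltr1n.
  move=> /cvgrPdist_le /(_ _ e0) H; near=> n.
  apply: le_trans (uf x n) _; have : `|0 - 2 * G * 4^-1 ^+ n| <= e by near: n; exact: H.
  by rewrite sub0r normrN; apply: le_trans; exact: ler_norm.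
exists u; split; last by move=> n x; exact: uf.
have mu : measurable_fun setT u.
  by apply: (measurable_fun_cvg (h := f)) => [n|x _]; [have [[]] := sf n|exact: fu].
split.
  split => //; have [_ [B fB]] := (sf 0%N).1.
  exists (2 * G + B) => x; have := uf x 0%N; rewrite expr0 mulr1 => H.
  by rewrite -[u x](subrK (f 0%N x)) (le_trans (ler_normD _ _))// lerD.
have mf n : measurable_fun setT (fun x => (f n x ^+ 2)%:E).
  by apply/measurable_EFinP; apply: measurable_funX; have [[]] := sf n.
have f0 n x : setT x -> (0 <= (f n x ^+ 2)%:E)%E by rewrite lee_fin sqr_ge0.
have := @fatou _ _ R leb setT measurableT _ mf f0.
under eq_integral => x _.
  have : (fun n => (f n x ^+ 2)%:E) @ \oo --> (u x ^+ 2)%:E.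
    by apply: cvg_EFin; [exact: nearW|rewrite expr2; under eq_fun do rewrite expr2; exact: cvgM].
  move=> /cvg_limn_einf_sup[-> _]; over.
move=> F; apply/integrableP; split; first by apply/measurable_EFinP; exact: measurable_funX.
under eq_integral => x _ do rewrite /= ger0_norm ?sqr_ge0//.
apply: le_lt_trans F (le_lt_trans _ (ltry M)).
rewrite limn_einf_lim; apply: lime_le; first exact: is_cvg_einfs.
apply: nearW => n; apply: le_trans (_ : \int[leb]_x (f n x ^+ 2)%:E <= M%:E)%E.
  by apply: ereal_inf_lbound; exists n => /=.
by rewrite integral_EFin ?lee_fin//; exact: (sf n).2.
Unshelve. all: by end_near.
Qed.

End GeometricLimits.

(** * Norm bounds for [K] and the Neumann series *)

Section MathieuResolvent.
Variables (R : realType) (w : R).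
Notation C := (complex R).
Notation leb := (@lebesgue_measure R).
Notation Lint f := (leb.-integrable setT (EFin \o f)).
Implicit Types (u v : R -> R) (f g : R -> C).
Notation Re := complex.Re.
Notation Im := complex.Im.
Local Notation K := (mathieu w).

Let square_mfunM (t : R -> R) u : bounded_mfun t -> (forall x, `|t x| <= 1) ->
  square_mfun u -> square_mfun (fun x => t x * u x) /\
  \int[leb]_x (t x * u x) ^+ 2 <= \int[leb]_x u x ^+ 2.
Proof.
move=> bt t1 [bu iu]; have btu := bounded_mfunM bt bu.
have le x : (t x * u x) ^+ 2 <= u x ^+ 2.
  rewrite exprMn ler_piMl ?sqr_ge0// -real_normK ?num_real// expr_le1//.
have i1 : Lint (fun x => (t x * u x) ^+ 2).
  apply: (integrable_dominated _ iu); first by apply: measurable_funX; case: btu.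
  by move=> x; rewrite ger0_norm ?sqr_ge0.
by split=> //; apply: le_Rintegral.
Qed.

Lemma square_mfun_cosM u : square_mfun u -> square_mfun (fun x => cos (w * x) * u x).
Proof.
move=> su; apply: (square_mfunM (bounded_mfun_cos w) _ su).1 => x; exact: cos_max.
Qed.

Lemma square_mfun_sinM u : square_mfun u -> square_mfun (fun x => sin (w * x) * u x).
Proof.
move=> su; apply: (square_mfunM (bounded_mfun_sin w) _ su).1 => x; exact: sin_max.
Qed.

Lemma mathieu_L2 u : square_mfun u -> square_mfun (K u) /\
  \int[leb]_x K u x ^+ 2 <= pi ^+ 2 * \int[leb]_x u x ^+ 2.
Proof.
move=> su; have [[bc ic] le] := square_mfunM (bounded_mfun_cos w) (fun x => cos_max (w * x)) su.
have [i1 le1] := sech_conv_L2 bc ic.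
split; first by split=> //; exact: bounded_sech_conv.
by apply: le_trans le1 _; rewrite ler_wpM2l ?sqr_ge0.
Qed.

Lemma mathieu_le u B : measurable_fun setT u -> (forall x, `|u x| <= B) ->
  forall x, `|K u x| <= pi * B.
Proof.
move=> mu uB; apply: sech_conv_le.
  by apply: measurable_funM => //; case: (bounded_mfun_cos w).
move=> x; rewrite normrM; apply: le_trans (uB x).
by rewrite ler_piMl// cos_max.
Qed.

Lemma real_linear_mathieu : real_linear K.
Proof.
split; first by move=> u /mathieu_L2[].
by move=> k u v [bu _] [bv _]; rewrite mathieuD ?mathieuZ//; exact: bounded_mfunZ.
Qed.

Lemma real_linear_ladder : real_linear (ladder w).
Proof.
split.
  move=> u su; have s1 := (mathieu_L2 (square_mfun_sinM su)).1.
  have s2 := square_mfun_sinM (mathieu_L2 su).1.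
  rewrite /ladder; under eq_fun do rewrite addrC -mulN1r.
  apply: square_mfun_lin => //.
  have := square_mfun_lin (expR (pi * w)) s1 (square_mfun_lin (-1) s1 s1).
  by congr square_mfun; apply/funext => x; rewrite mulN1r addNr addr0.
by move=> k u v [bu _] [bv _]; rewrite ladderD ?ladderZ//; exact: bounded_mfunZ.
Qed.

Section Neumann.
(** [s + i t] stands for [1 / l]. The equation [u = (K u - g) / l], split into real and imaginary
    parts, is the system solved below, and the hypothesis makes it a contraction of ratio [1 / 4]
    for the supremum norm. *)
Variables (s t : R).
Hypothesis st_small : (`|s| + `|t|) * pi <= 4^-1.

Let comb_le (s' t' a b B : R) : `|s'| + `|t'| = `|s| + `|t| ->
  `|a| <= pi * B -> `|b| <= pi * B -> `|s' * a + t' * b| <= 4^-1 * B.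
Proof.
move=> E aB bB; have B0 : 0 <= B by rewrite -(pmulr_rge0 _ (@pi_gt0 R)) (le_trans _ aB).
apply: (@le_trans _ _ ((`|s'| + `|t'|) * pi * B)); last by rewrite E ler_wpM2r.
by rewrite -mulrA mulrDl (le_trans (ler_normD _ _))// !normrM lerD// ler_wpM2l.
Qed.

Let E1 : `|s| + `|- t| = `|s| + `|t|. Proof. by rewrite normrN. Qed.
Let E2 : `|t| + `|s| = `|s| + `|t|. Proof. by rewrite addrC. Qed.

Lemma mathieu_system_inj (a b : R -> R) : bounded_mfun a -> bounded_mfun b ->
  (forall x, a x = s * K a x - t * K b x) -> (forall x, b x = t * K a x + s * K b x) ->
  forall x, a x = 0 /\ b x = 0.
Proof.
move=> [ma [A aA]] [mb [B bB]] Ea Eb.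
have H n x : `|a x| <= (A + B) * 4^-1 ^+ n /\ `|b x| <= (A + B) * 4^-1 ^+ n.
  elim: n x => [|n IH] x.
    have A0 := le_trans (normr_ge0 _) (aA x); have B0 := le_trans (normr_ge0 _) (bB x).
    by rewrite expr0 mulr1 (le_trans (aA x)) ?lerDl// (le_trans (bB x)) ?lerDr.
  have Ka := mathieu_le ma (fun y => (IH y).1); have Kb := mathieu_le mb (fun y => (IH y).2).
  rewrite exprS (mulrCA (A + B)); split; first by rewrite Ea -mulNr comb_le.
  by rewrite Eb comb_le.
by move=> x; split; apply: (@geometric_null _ _ (A + B)) => n; case: (H n x).
Qed.

(** Picard iteration from 0. The increments shrink by 4 in supremum norm while the [L^2] norms stay
    bounded, as [square_mfun_limit] asks. *)
Lemma mathieu_system_surj (h1 h2 : R -> R) : square_mfun h1 -> square_mfun h2 ->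
  exists a b, [/\ square_mfun a, square_mfun b,
    (forall x, a x = s * K a x + (- t * K b x + h1 x)) &
    (forall x, b x = t * K a x + (s * K b x + h2 x))].
Proof.
move=> sh1 sh2; have [[_ [G1 hG1]] ih1] := sh1; have [[_ [G2 hG2]] ih2] := sh2.
pose F (p : (R -> R) * (R -> R)) : (R -> R) * (R -> R) :=
  (fun x => s * K p.1 x + (- t * K p.2 x + h1 x), fun x => t * K p.1 x + (s * K p.2 x + h2 x)).
pose f n := iter n F (fun=> 0, fun=> 0).
have G10 := le_trans (normr_ge0 _) (hG1 0); have G20 := le_trans (normr_ge0 _) (hG2 0).
pose G := G1 + G2; have G0 : 0 <= G by exact: addr_ge0.
have sq0 : square_mfun (fun=> 0 : R).
  split; first exact: bounded_mfun_cst.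
  by under eq_fun do rewrite expr0n/=; exact: integrable0.
have sq n : square_mfun (f n).1 /\ square_mfun (f n).2.
  elim: n => [//|n [IH1 IH2]].
  have k1 := (mathieu_L2 IH1).1; have k2 := (mathieu_L2 IH2).1.
  by split; apply: square_mfun_lin => //; exact: square_mfun_lin.
have inc n x : `|(f n.+1).1 x - (f n).1 x| <= G * 4^-1 ^+ n /\
               `|(f n.+1).2 x - (f n).2 x| <= G * 4^-1 ^+ n.
  elim: n x => [|n IH] x.
    have z0 : K (fun=> 0) x = 0.
      have n0 (y : R) : `|0 : R| <= 0 by rewrite normr0.
      have := mathieu_le (bounded_mfun_cst (0 : R)).1 n0 x.
      by rewrite mulr0 normr_le0 => /eqP.
    rewrite /= z0 !mulr0 !add0r !subr0 expr0 mulr1.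
    by rewrite (le_trans (hG1 x)) ?lerDl// (le_trans (hG2 x)) ?lerDr.
  have [s1 s2] := sq n; have [s1' s2'] := sq n.+1.
  have d1 := mathieu_le (measurable_funB s1'.1.1 s1.1.1) (fun y => (IH y).1).
  have d2 := mathieu_le (measurable_funB s2'.1.1 s2.1.1) (fun y => (IH y).2).
  have := d1 x; rewrite [K _](mathieuB _ s1'.1 s1.1) => {}d1.
  have := d2 x; rewrite [K _](mathieuB _ s2'.1 s2.1) => {}d2.
  rewrite exprS (mulrCA G); split.
    rewrite (_ : _ - _ = s * (K (f n.+1).1 x - K (f n).1 x) + - t * (K (f n.+1).2 x - K (f n).2 x)).
      exact: comb_le.
    by rewrite /=; ring.
  rewrite (_ : _ - _ = t * (K (f n.+1).1 x - K (f n).1 x) + s * (K (f n.+1).2 x - K (f n).2 x)).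
    exact: comb_le.
  by rewrite /=; ring.
pose H := \int[leb]_x h1 x ^+ 2 + \int[leb]_x h2 x ^+ 2.
have i0 (u : R -> R) : 0 <= \int[leb]_x u x ^+ 2 by apply: Rintegral_ge0 => x _; exact: sqr_ge0.
(* The bound [4 H] is stable. The square of a sum of three terms is at most 3 times the sum of the
   squares, and [(s'^2 + t'^2) pi^2 <= 1 / 16], so one step gives at most [3 * 4 H / 16 + 3 H]. *)
have L2 (s' t' : R) (u v h : R -> R) : `|s'| + `|t'| = `|s| + `|t| ->
    square_mfun u -> square_mfun v -> square_mfun h ->
    \int[leb]_x u x ^+ 2 <= 4 * H -> \int[leb]_x v x ^+ 2 <= 4 * H -> \int[leb]_x h x ^+ 2 <= H ->
    \int[leb]_x (s' * K u x + (t' * K v x + h x)) ^+ 2 <= 4 * H.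
  move=> E su sv sh uH vH hH.
  have [[_ iu] lu] := mathieu_L2 su; have [[_ iv] lv] := mathieu_L2 sv.
  have iw : Lint (fun x => (s' * K u x + (t' * K v x + h x)) ^+ 2).
    by have [] := square_mfun_lin s' (mathieu_L2 su).1 (square_mfun_lin t' (mathieu_L2 sv).1 sh).
  have I1 := integrableZ_fun (3 * s' ^+ 2) iu; have I2 := integrableZ_fun (3 * t' ^+ 2) iv.
  have I3 := integrableZ_fun 3 sh.2.
  apply: (@le_trans _ _ (\int[leb]_x (3 * s' ^+ 2 * K u x ^+ 2 + 3 * t' ^+ 2 * K v x ^+ 2 + 3 * h x ^+ 2))).
    apply: le_Rintegral => //; first by apply: integrableD_fun => //; exact: integrableD_fun.
    move=> x _; rewrite -subr_ge0.
    move: (K u x) (K v x) (h x) => k1 k2 k3.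
    rewrite (_ : _ - _ = (s' * k1 - t' * k2) ^+ 2 + (s' * k1 - k3) ^+ 2 + (t' * k2 - k3) ^+ 2); last by ring.
    by rewrite !addr_ge0 ?sqr_ge0.
  rewrite RintegralD//; last exact: integrableD_fun.
  rewrite RintegralD// !RintegralZl//; last exact: sh.2.
  have st : (s' ^+ 2 + t' ^+ 2) * pi ^+ 2 <= 16^-1.
    apply: (@le_trans _ _ (((`|s'| + `|t'|) * pi) ^+ 2)).
      rewrite exprMn ler_wpM2r ?sqr_ge0// -(real_normK (num_real s')) -(real_normK (num_real t')).
      by rewrite -subr_ge0 (_ : _ - _ = 2 * (`|s'| * `|t'|)) ?mulr_ge0//; ring.
    rewrite E (_ : 16^-1 = 4^-1 ^+ 2); last by field.
    have n0 := mulr_ge0 (addr_ge0 (normr_ge0 s) (normr_ge0 t)) (ltW (@pi_gt0 R)).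
    by rewrite !expr2; apply: ler_pM.
  have H0 : 0 <= H by exact: addr_ge0.
  have lu' := le_trans lu (ler_wpM2l (sqr_ge0 pi) uH); have lv' := le_trans lv (ler_wpM2l (sqr_ge0 pi) vH).
  have := ler_wpM2l (sqr_ge0 s') lu'; have := ler_wpM2l (sqr_ge0 t') lv'.
  have := ler_wpM2r H0 st; rewrite mulrDl [(_ + _) * H]mulrDl !(mulrCA (pi ^+ 2)).
  move: hH; move: (\int[leb]_x K u x ^+ 2) (\int[leb]_x K v x ^+ 2) (\int[leb]_x h x ^+ 2) => k1 k2 k3.
  rewrite -!mulrA; move: (s' ^+ 2 * k1) (t' ^+ 2 * k2) (pi ^+ 2 * H) => X Y Z.
  rewrite !(mulrCA _ 4); move: (s' ^+ 2 * Z) (t' ^+ 2 * Z) H0 => A B; move: (H); clear => *; lra.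
have fM n : \int[leb]_x (f n).1 x ^+ 2 <= 4 * H /\ \int[leb]_x (f n).2 x ^+ 2 <= 4 * H.
  have H0 : 0 <= H by exact: addr_ge0.
  elim: n => [|n [IH1 IH2]].
    have z0 : \int[leb]_x (0 : R) ^+ 2 = 0.
      by rewrite expr0n/= /Rintegral integral0_eq.
    split; rewrite [X in X <= _]z0.
      exact: mulr_ge0.
    exact: mulr_ge0.
  have [s1 s2] := sq n; split; apply: L2 => //.
  - by rewrite lerDl.
  - by rewrite lerDr.
have [a [sa fa]] := square_mfun_limit G0 (fun n => (sq n).1) (fun n x => (inc n x).1) (fun n => (fM n).1).
have [b [sb fb]] := square_mfun_limit G0 (fun n => (sq n).2) (fun n x => (inc n x).2) (fun n => (fM n).2).
have Ka n x : `|K a x - K (f n).1 x| <= pi * (2 * G * 4^-1 ^+ n).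
  have [s1 _] := sq n; have := mathieu_le (measurable_funB sa.1.1 s1.1.1) (fa n) x.
  by rewrite [K _](mathieuB _ sa.1 s1.1).
have Kb n x : `|K b x - K (f n).2 x| <= pi * (2 * G * 4^-1 ^+ n).
  have [_ s2] := sq n; have := mathieu_le (measurable_funB sb.1.1 s2.1.1) (fb n) x.
  by rewrite [K _](mathieuB _ sb.1 s2.1).
exists a, b; split => // x; apply/eqP; rewrite -subr_eq0; apply/eqP.
(* The defect of the limit is independent of [n], yet it is at most [(2 G / 4 + 2 G / 4) 4^-n]: one
   half from replacing [a] by the next iterate, one half from replacing [a] and [b] under [K]. *)
- apply: (@geometric_null _ _ G) => n.
  have := fa n.+1 x; have := comb_le E1 (Ka n x) (Kb n x).
  rewrite exprS /=; move: (4^-1 ^+ n) => e.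
  rewrite (_ : 2 * G * (_ * e) = 4^-1 * (2 * G * e)); last by ring.
  rewrite (_ : a x - (s * K a x + _) = (a x - (s * K (f n).1 x + (- t * K (f n).2 x + h1 x)))
    - (s * (K a x - K (f n).1 x) + - t * (K b x - K (f n).2 x))); last by ring.
  move=> l1 l2; apply: le_trans (ler_normB _ _) _; apply: le_trans (lerD l2 l1) _.
  by rewrite -mulrDl -mulrA; lra.
- apply: (@geometric_null _ _ G) => n.
  have := fb n.+1 x; have := comb_le E2 (Ka n x) (Kb n x).
  rewrite exprS /=; move: (4^-1 ^+ n) => e.
  rewrite (_ : 2 * G * (_ * e) = 4^-1 * (2 * G * e)); last by ring.
  rewrite (_ : b x - (t * K a x + _) = (b x - (t * K (f n).1 x + (s * K (f n).2 x + h2 x)))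
    - (t * (K a x - K (f n).1 x) + s * (K b x - K (f n).2 x))); last by ring.
  move=> l1 l2; apply: le_trans (ler_normB _ _) _; apply: le_trans (lerD l2 l1) _.
  by rewrite -mulrDl -mulrA; lra.
Qed.

End Neumann.

End MathieuResolvent.

(** * Descending the ladder of resolvents *)

Section MathieuRegular.
Variables (R : realType) (w : R).
Notation C := (complex R).
Implicit Types (u v : R -> R) (f g : R -> C) (l : C).
Notation Re := complex.Re.
Notation Im := complex.Im.
Local Notation K := (mathieu w).
Let Q := expR (pi * w).
Let q : C := complex.Complex Q 0.

Let small l := (`|Re l^-1| + `|Im l^-1|) * pi <= 4^-1.

Lemma regular_mathieu_large l : l != 0 -> small l -> regular (@csquare R) (cmap K) l.
Proof.
move=> l0 ls; have lV : l^-1 * l = 1 by rewrite mulVf.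
split.
- move=> u [[ba _] [bb _]] Ku.
  have uE x : u x = l^-1 * cmap K u x by rewrite Ku mulrA lV mul1r.
  have Ea y : Re (u y) = Re l^-1 * K (fun z => Re (u z)) y - Im l^-1 * K (fun z => Im (u z)) y.
    by rewrite {1}uE ReM.
  have Eb y : Im (u y) = Im l^-1 * K (fun z => Re (u z)) y + Re l^-1 * K (fun z => Im (u z)) y.
    by rewrite {1}uE ImM addrC.
  apply/funext => x; have [e1 e2] := mathieu_system_inj ls ba bb Ea Eb x.
  exact: complexP.
- move=> g sg.
  have [h1 h2] : csquare (fun x => - l^-1 * g x).
    have := csquare_lin (- l^-1 - 1) sg sg.
    by congr csquare; apply/funext => x; rewrite mulrBl mul1r subrK.
  have [a [b [sa sb Ea Eb]]] := mathieu_system_surj w ls h1 h2.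
  exists (fun x => complex.Complex (a x) (b x)); first by split.
  apply/funext => x; apply: (mulfI (invr_neq0 l0)).
  rewrite mulrBr mulrA lV mul1r.
  have -> : complex.Complex (a x) (b x) = l^-1 * complex.Complex (K a x) (K b x) + - l^-1 * g x.
    apply: complexP; rewrite ?ReD ?ImD ?ReM ?ImM /=; first by rewrite Ea ReM; ring.
    by rewrite Eb ImM; ring.
  by rewrite /cmap /=; ring.
Qed.

Lemma cmapZr (P P' : (R -> R) -> R -> R) (k : R) f :
  (forall u, square_mfun u -> P u = (fun x => k * P' u x)) -> csquare f ->
  cmap P f = (fun x => complex.Complex k 0 * cmap P' f x).
Proof.
move=> H [s1 s2]; apply/funext => x; apply: complexP; rewrite ?ReM ?ImM /= !H//; ring.
Qed.

Let Q0 : Q != 0. Proof. by rewrite gt_eqF// expR_gt0. Qed.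
Let q0 : q != 0.
Proof. by apply/eqP => -[/eqP]; rewrite (negPf Q0). Qed.

Lemma regular_mathieu_step l : 0 < w -> l != 0 ->
  q * l ^+ 2 != complex.Complex (pi ^+ 2) 0 ->
  regular (@csquare R) (cmap K) (q * l) -> regular (@csquare R) (cmap K) l.
Proof.
move=> w0 l0 ql; have pi0 : pi != 0 :> R by rewrite gt_eqF// pi_gt0.
(* [Q > 1] keeps the factor [(Q^2 - 1)^2] of [ladder_ladder] away from 0. *)
have Q1 : 1 < Q by rewrite -expR0 ltr_expR mulr_gt0// pi_gt0.
have KN : mathieu (- w) = K by apply/funext => u; exact: mathieuN.
pose k := (Q ^+ 2 - 1) ^+ 2 / (4 * Q).
have k0 : k != 0.
  apply: mulf_neq0; last by rewrite invr_eq0 mulf_neq0.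
  by apply: expf_neq0; rewrite subr_eq0 gt_eqF// exprn_egt1.
pose pC : C := complex.Complex (pi ^+ 2) 0.
have pC0 : pC != 0 by apply/eqP => -[/eqP]; rewrite expf_eq0 (negPf pi0).
move=> H; apply: (@regular_ladder _ _ _ (@csquare_lin R) (cmap K) (cmap (ladder w))
  (cmap (ladder (- w))) q (complex.Complex k 0) (complex.Complex (Q / pi ^+ 2) 0) l _ _ _ q0 _ l0 _ _ _ _ H).
- by apply: linear_on_cmap; exact: real_linear_mathieu.
- by apply: linear_on_cmap; exact: real_linear_ladder.
- by apply: linear_on_cmap; exact: real_linear_ladder.
- by apply/eqP => -[/eqP]; rewrite (negPf k0).
- apply: contra ql => /eqP E; apply/eqP.
  have -> : q = complex.Complex (Q / pi ^+ 2) 0 * pC.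
    apply: complexP; rewrite ?ReM ?ImM /= ?mul0r ?mulr0 ?subr0 ?addr0//.
    by rewrite divfK// expf_neq0.
  by rewrite mulrAC E mul1r.
- move=> u su; apply: (@cmapZr (K \o ladder w) (ladder w \o K)) su => v [bv _] /=.
  exact: mathieu_ladder.
- move=> u su; have -> : q^-1 = complex.Complex Q^-1 0.
    apply: (mulfI q0); rewrite mulfV//; apply: complexP; rewrite ?ReM ?ImM /=; field => //.
  apply: (@cmapZr (K \o ladder (- w)) (ladder (- w) \o K)) su => v [bv _] /=.
  have := mathieu_ladder (- w) bv; rewrite KN => ->.
  by rewrite mulrN expRN.
- move=> u su.
  apply: etrans (@cmapZr (ladder (- w) \o ladder w)
    (fun v x => K (K v) x - Q / pi ^+ 2 * K (K (K (K v))) x) k _ _ su) _.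
    by move=> v [bv _] /=; exact: ladder_ladder.
  apply/funext => x; congr (_ * _).
  apply: complexP; first by rewrite ReD ReN ReM /= mul0r subr0.
  by rewrite ImD ImN ImM /= mul0r addr0.
Qed.

(** Induction on the number [N] of steps that bring [q^N l] into the Neumann region. The values
    forbidden for [q l] are among those forbidden for [l], with the index raised by one. *)
Lemma regular_mathieu l : 0 < w -> l != 0 ->
  (forall n, q ^+ n.*2.+1 * l ^+ 2 != complex.Complex (pi ^+ 2) 0) ->
  regular (@csquare R) (cmap K) l.
Proof.
move=> w0 l0 hl.
have Q1 : 1 < Q by rewrite -expR0 ltr_expR mulr_gt0// pi_gt0.
have [N HN] : exists N, small (q ^+ N * l).
  have : (fun n => (`|Re l^-1| + `|Im l^-1|) * pi * Q^-1 ^+ n) @ \oo --> (0 : R).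
    apply: cvg_geometric; rewrite gtr0_norm ?invr_gt0 ?expR_gt0//.
    by rewrite invf_lt1// expR_gt0.
  move=> /cvgrPdist_le /(_ 4^-1) []; first by rewrite invr_gt0.
  move=> N _ /(_ N (leqnn N)); rewrite sub0r normrN => H; exists N.
  rewrite /small; apply: le_trans (le_trans (ler_norm _) H).
  have -> : (q ^+ N * l)^-1 = complex.Complex (Q^-1 ^+ N) 0 * l^-1.
    rewrite invfM; congr (_ * _); rewrite -exprVn; elim: N {H} => [|n IH]; first by rewrite !expr0.
    rewrite !exprS IH; have -> : q^-1 = complex.Complex Q^-1 0.
      apply: (mulfI q0); rewrite mulfV//; apply: complexP; rewrite ?ReM ?ImM /=; field => //.
    by apply: complexP; rewrite ?ReM ?ImM /=; ring.
  rewrite ReM ImM /= !mul0r subr0 addr0 !normrM ger0_norm ?exprn_ge0 ?invr_ge0 ?expR_ge0//.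
  by rewrite -mulrDr [X in _ <= X]mulrC mulrA.
elim: N l l0 hl HN => [|N IH] l l0 hl HN.
  by apply: regular_mathieu_large => //; move: HN; rewrite expr0 mul1r.
apply: regular_mathieu_step => //; first by have := hl 0%N; rewrite expr1.
apply: IH; first by rewrite mulf_neq0.
- move=> n; have -> : q ^+ n.*2.+1 * (q * l) ^+ 2 = q ^+ n.+1.*2.+1 * l ^+ 2.
    by rewrite exprMn mulrA -exprD doubleS addn2.
  exact: hl.
- by rewrite mulrA -exprSr.
Qed.

End MathieuRegular.

(** * Eigenfunctions *)

Section GroundStates.
Variables (R : realType) (w : R).
Hypothesis w_gt0 : 0 < w.
Implicit Types (u v : R -> R).
Notation leb := (@lebesgue_measure R).
Notation Lint f := (leb.-integrable setT (EFin \o f)).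
Local Notation K := (mathieu w).
Let Q := expR (pi * w).

Definition ground b x := expR (- (w / (2 * pi) * (x - b) ^+ 2)).

Let pi0 : 0 < pi :> R. Proof. exact: pi_gt0. Qed.

Lemma square_mfun_ground b : square_mfun (ground b).
Proof.
have k0 : 0 < w / pi by rewrite divr_gt0.
have m : measurable_fun setT (ground b).
  by apply: continuous_measurable_fun; rewrite /ground; cont.
split.
  split => //; exists 1 => x; rewrite ger0_norm ?expR_ge0// -expR0 ler_expR oppr_le0.
  by rewrite mulr_ge0 ?sqr_ge0// divr_ge0 ?mulr_ge0 ?ltW.
have := integrable_affine (- b) (oner_neq0 R) (integrable_gaussian k0).
congr (_.-integrable _ _); apply/funext => x /=; congr EFin.
rewrite /ground -expRM_natl; congr expR; rewrite mul1r.
by move: (@pi R) pi0 => p p0; field; rewrite gt_eqF.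
Qed.

(** On spectral data, [c] averages the shifts by [w] and [- w], and [S] divides by [cosh (pi xi)].
    For [al = pi / (2 w)] a shift multiplies the Gaussian [exp (- al xi^2)] by [e^(- pi w / 2)] and
    by [e^(pi xi)] or its inverse. The average is thus [cosh (pi xi)] times the Gaussian, and the
    symbol cancels the [cosh]. *)
Lemma mathieu_ground0 : K (ground 0) = (fun x => pi * expR (- (pi * w / 2)) * ground 0 x).
Proof.
pose al := pi / (2 * w).
have al0 : 0 < al by rewrite divr_gt0// mulr_gt0.
pose p : (R -> R) * (R -> R) := (fun xi => expR (- (al * xi ^+ 2)), fun=> 0).
have dp : packet_data p by split; [exact: integrable_gaussian|exact: integrable0].
pose Z := \int[leb]_xi expR (- (al * xi ^+ 2)).
have Z0 : Z != 0 by rewrite gt_eqF// Rintegral_gaussian_gt0.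
have pE : packet p = (fun x => Z * ground 0 x).
  apply/funext => x; rewrite mulrC /packet /=.
  under eq_Rintegral do rewrite mul0r addr0.
  rewrite gaussian_cos_transform// /ground subr0; congr (expR _ * _).
  by rewrite /al; move: (@pi R) pi0 => q q0; field; rewrite !gt_eqF.
have bg := (square_mfun_ground 0).1.
have : K (packet p) = packet (data_sech (data_cos w p)).
  by rewrite /mathieu packet_cos// sech_conv_packet//; exact: packet_data_cos.
have -> : data_sech (data_cos w p) = data_lin (pi * expR (- (pi * w / 2))) p 0 p.
  congr pair; apply/funext => xi /=; last by rewrite addr0 mul0r !mulr0 addr0.
  rewrite mul0r addr0 /sech_symbol sech2_2piE.
  have -> : expR (- (al * (xi - w) ^+ 2)) =
      expR (- (al * xi ^+ 2)) * (expR (pi * xi) * expR (- (pi * w / 2))).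
    by rewrite -!expRD; congr expR; rewrite /al; field; rewrite gt_eqF.
  have -> : expR (- (al * (xi + w) ^+ 2)) =
      expR (- (al * xi ^+ 2)) * ((expR (pi * xi))^-1 * expR (- (pi * w / 2))).
    by rewrite -expRN -!expRD; congr expR; rewrite /al; field; rewrite gt_eqF.
  move: (expR_gt0 (pi * xi)); move: (expR (pi * xi)) (expR (- (al * xi ^+ 2))) (expR (- (pi * w / 2))).
  move=> X A B X0; field; rewrite !gt_eqF// addr_gt0// mulr_gt0//.
rewrite pE mathieuZ// => E; apply/funext => x.
have /(congr1 (fun f => f x)) /= := E.
rewrite packet_lin// mul0r addr0 pE => H; apply: (mulfI Z0).
by rewrite H; ring.
Qed.

Lemma mathieu_shift u b e : bounded_mfun u -> cos (w * b) = e -> sin (w * b) = 0 ->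
  K (fun y => u (y - b)) = (fun x => e * K u (x - b)).
Proof.
move=> bu cb sb; apply/funext => x.
pose f z := sech2 (x - b - z) * (cos (w * (z + b)) * u z).
have fi : Lint f.
  apply: sech_conv_int_bounded; apply: bounded_mfunM => //.
  split; first by apply: continuous_measurable_fun; cont.
  by exists 1 => z; exact: cos_max.
transitivity (\int[leb]_y f (y - b)).
  apply: eq_Rintegral => y _; rewrite /f subrK; congr (sech2 _ * _).
  by rewrite opprB addrA subrK.
rewrite Rintegral_shift// /mathieu /sech_conv -RintegralZl//; last first.
  by apply: sech_conv_int_bounded; exact: bounded_cosM.
apply: eq_Rintegral => z _.
by rewrite /f mulrDr cosD cb sb; ring.
Qed.

Lemma mathieu_ground b e : cos (w * b) = e -> sin (w * b) = 0 ->
  K (ground b) = (fun x => e * (pi * expR (- (pi * w / 2))) * ground b x).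
Proof.
move=> cb sb; have gE : ground b = (fun y => ground 0 (y - b)).
  by apply/funext => y; rewrite /ground subr0.
rewrite gE (mathieu_shift (square_mfun_ground 0).1 cb sb) mathieu_ground0.
by apply/funext => x; rewrite mulrA.
Qed.

Definition excited n b := iter n (ladder (- w)) (ground b).

Lemma square_mfun_excited n b : square_mfun (excited n b).
Proof.
elim: n => [|n IH]; first exact: square_mfun_ground.
exact: (real_linear_ladder (- w)).1.
Qed.

Lemma mathieu_excited n b e : cos (w * b) = e -> sin (w * b) = 0 ->
  K (excited n b) = (fun x => e * (pi * expR (- (pi * w / 2)) * Q^-1 ^+ n) * excited n b x).
Proof.
move=> cb sb; elim: n => [|n IH].
  by rewrite (mathieu_ground cb sb); apply/funext => x; rewrite expr0 mulr1.
have bn := (square_mfun_excited n b).1.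
have KN : mathieu (- w) = K by apply/funext => u; exact: mathieuN.
have := mathieu_ladder (- w) bn; rewrite KN => ->.
rewrite IH ladderZ//; apply/funext => x.
have -> : expR (pi * - w) = Q^-1 by rewrite mulrN expRN.
rewrite exprS; change (excited n.+1 b x) with (ladder (- w) (excited n b) x).
move: (ladder _ _ x) => L.
by move: (expR _) (_ ^+ n) => E F; ring.
Qed.

(** [ladder w] undoes one descent up to a nonzero scalar, which carries linear independence from one
    level to the next. The scalar comes from [ladder_ladder] for [- w]. It would vanish at
    [l^2 = pi^2 Q], above the square [pi^2 / Q] of the top level. *)
Lemma ladder_excited n b e : cos (w * b) = e -> sin (w * b) = 0 -> e ^+ 2 = 1 ->
  exists2 k, k != 0 & ladder w (excited n.+1 b) = (fun x => k * excited n b x).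
Proof.
move=> cb sb e1; have bn := (square_mfun_excited n b).1.
have Q0 : 0 < Q by exact: expR_gt0.
have Q1 : 1 < Q by rewrite -expR0 ltr_expR mulr_gt0.
pose l := e * (pi * expR (- (pi * w / 2)) * Q^-1 ^+ n).
have l2 : l ^+ 2 = pi ^+ 2 * Q^-1 * (Q^-1 ^+ n) ^+ 2.
  rewrite /l !exprMn e1 mul1r -expRM_natl; congr (_ * _ * _).
  by rewrite -expRN; congr expR; field.
have Ke : K (excited n b) = (fun x => l * excited n b x) by exact: mathieu_excited.
have KZ k : K (fun x => k * excited n b x) = (fun x => k * l * excited n b x).
  by rewrite mathieuZ// Ke; apply/funext => x; rewrite mulrA.
have := ladder_ladder (- w) bn; rewrite opprK mulrN expRN -/Q.
have -> : mathieu (- w) = K by apply/funext => u; exact: mathieuN.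
rewrite -[ladder (- w) _]/(excited n.+1 b) Ke !KZ => ->.
exists ((Q^-1 ^+ 2 - 1) ^+ 2 / (4 * Q^-1) * (l ^+ 2 - Q^-1 / pi ^+ 2 * l ^+ 4)); last first.
  by apply/funext => x; ring.
have l0 : l != 0.
  by rewrite -sqrf_eq0 l2 !mulf_neq0 ?expf_neq0 ?invr_eq0 ?gt_eqF.
have QV : Q^-1 < 1 by rewrite invf_lt1.
apply: mulf_neq0.
  apply: mulf_neq0; last by rewrite invr_eq0 mulf_neq0// invr_eq0 gt_eqF.
  by apply: expf_neq0; rewrite subr_eq0 lt_eqF// exprn_ilt1// invr_ge0 ltW.
rewrite (_ : _ - _ = l ^+ 2 * (1 - Q^-1 / pi ^+ 2 * l ^+ 2)); last by ring.
apply: mulf_neq0; first exact: expf_neq0.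
rewrite subr_eq0 eq_sym lt_eqF// l2 -exprM.
rewrite (_ : _ * _ = Q^-1 ^+ (2 + n * 2)); first by rewrite exprn_ilt1// invr_ge0 ltW.
rewrite exprD; move: (Q^-1 ^+ (n * 2)) (Q^-1) (@pi R) pi0 => E q p p0.
by field; rewrite gt_eqF.
Qed.

Lemma ladder_sum m (c : 'I_m -> R) (u : 'I_m -> R -> R) : (forall i, bounded_mfun (u i)) ->
  bounded_mfun (fun x => \sum_(i < m) c i * u i x) /\
  ladder w (fun x => \sum_(i < m) c i * u i x) = (fun x => \sum_(i < m) c i * ladder w (u i) x).
Proof.
move=> bu; elim: m c u bu => [|m IH] c u bu.
  have b0 : bounded_mfun (fun=> 0 : R) by exact: bounded_mfun_cst.
  under eq_fun do rewrite big_ord0; split => //.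
  have := ladderZ w 0 b0; under eq_fun do rewrite mul0r.
  by move=> ->; apply/funext => x; rewrite mul0r big_ord0.
have [b1 E1] := IH (fun i => c (widen_ord (leqnSn m) i)) (fun i => u (widen_ord (leqnSn m) i))
  (fun i => bu _).
have bZ := bounded_mfunZ (c ord_max) (bu ord_max).
under eq_fun do rewrite big_ord_recr/=; split; first exact: bounded_mfunD.
rewrite ladderD// E1 ladderZ//.
by apply/funext => x; rewrite big_ord_recr.
Qed.

(** Multiplied by [exp (w / (2 pi) * (x^2 - 2 b0 x))], the combination becomes a polynomial of
    degree less than [m] in [exp (w t x / pi)], and it has the [m] distinct roots given by
    [x = 0, ..., m - 1]. *)
Lemma free_ground m (c : 'I_m -> R) b0 t : t != 0 ->
  (forall x, \sum_(i < m) c i * ground (b0 + i%:R * t) x = 0) -> forall i, c i = 0.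
Proof.
move=> t0 H.
pose d (i : nat) := if insub i is Some j then c j * expR (- (w / (2 * pi) * (b0 + i%:R * t) ^+ 2)) else 0.
pose p := \poly_(i < m) d i.
suff p0 : p = 0.
  move=> i; have := coef_poly m d i; rewrite -/p p0 coef0 ltn_ord /d valK => /esym/eqP.
  by rewrite mulf_eq0 (gt_eqF (expR_gt0 _)) orbF => /eqP.
have px x : p.[expR (w * t / pi * x)] = 0.
  rewrite horner_poly; have /(congr1 ( *%R (expR (w / (2 * pi) * (x ^+ 2 - 2 * b0 * x))))) := H x.
  move=> Hx; apply: etrans (etrans Hx (mulr0 _)); rewrite mulr_sumr; apply: eq_bigr => i _.
  rewrite /d valK /ground -expRM_natl -[LHS]mulrA -expRD [RHS]mulrCA -expRD; congr (_ * expR _).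
  by move: (@pi R) pi0 => q q0; field; rewrite gt_eqF.
pose rs := [seq expR (w * t / pi * k%:R) | k <- iota 0 m].
apply/eqP; apply: contraT => p0.
have : (size rs < size p)%N.
  apply: max_poly_roots => //.
    by apply/allP => _ /mapP[k _ ->]; apply/rootP.
  rewrite map_inj_uniq ?iota_uniq// => k l /expR_inj /mulfI.
  move=> /(_ _)/mulrIn; apply; rewrite ?oner_eq0//.
  have wn : w != 0 by rewrite gt_eqF.
  have pn : pi != 0 :> R by rewrite gt_eqF.
  by apply: mulf_neq0; [exact: mulf_neq0|rewrite invr_eq0].
by rewrite size_map size_iota ltnNge size_poly.
Qed.

(** Induction on [n]: [ladder w] sends a relation at level [n + 1] to one at level [n], with
    coefficients [c i * k i]. *)
Lemma free_excited n m (c : 'I_m -> R) b0 t e : t != 0 -> e ^+ 2 = 1 ->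
  (forall i : 'I_m, cos (w * (b0 + i%:R * t)) = e) ->
  (forall i : 'I_m, sin (w * (b0 + i%:R * t)) = 0) ->
  (forall x, \sum_(i < m) c i * excited n (b0 + i%:R * t) x = 0) -> forall i, c i = 0.
Proof.
move=> t0 e1 cb sb; elim: n c => [|n IH] c H; first exact: free_ground t0 H.
have L (i : 'I_m) := ladder_excited n (cb i) (sb i) e1.
have bu (i : 'I_m) := (square_mfun_excited n.+1 (b0 + i%:R * t)).1.
have /choice[k kP] : forall i : 'I_m, exists k, k != 0 /\
    ladder w (excited n.+1 (b0 + i%:R * t)) = (fun x => k * excited n (b0 + i%:R * t) x).
  by move=> i; have [k k0 kE] := L i; exists k.
have [_ E] := ladder_sum c bu.
have z : ladder w (fun x => \sum_(i < m) c i * excited n.+1 (b0 + i%:R * t) x) = (fun=> 0).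
  rewrite (_ : (fun _ => _) = (fun x => 0 * 0)); last by apply/funext => x; rewrite H mulr0.
  by rewrite (ladderZ _ _ (bounded_mfun_cst 0)); apply/funext => x; rewrite mul0r.
move=> i; apply/eqP.
have : c i * k i = 0.
  apply: (IH (fun i => c i * k i)) => x.
  have /(congr1 (fun f => f x)) := E; rewrite z => /esym Ex; apply: etrans Ex.
  by apply: eq_bigr => j _; rewrite (kP j).2 mulrA.
by move/eqP; rewrite mulf_eq0 (negPf (kP i).1) orbF.
Qed.

End GroundStates.

(** * The Laplace transform in logarithmic variables *)

Section ExponentialSubstitution.
Variable R : realType.
Implicit Types (s t z : R) (f g : R -> R).
Notation leb := (@lebesgue_measure R).
Notation Lint f := (leb.-integrable setT (EFin \o f)).
Notation T := (measurableTypeR R).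
Notation meas2 f := (measurable_fun [set: T * T] (fun p : T * T => f p.1 p.2 : R)).

(** The Gumbel density, derivative of [exp (- exp (- z))], which rises from 0 to 1. *)
Let psi z := expR (- z) * expR (- expR (- z)).

Let psi_integral : Lint psi /\ \int[leb]_z psi z = 1.
Proof.
have d z : is_derive z 1 (fun z => expR (- expR (- z))) (psi z).
  by derive; rewrite /psi; ring.
have c : continuous psi by rewrite /psi; cont.
have i : Lint psi.
  apply: (integrable_primitive (B := 1) d c) => z; first by rewrite mulr_ge0// expR_ge0.
  by rewrite ger0_norm ?expR_ge0// -expR0 ler_expR oppr_le0 expR_ge0.
split => //; rewrite (Rintegral_FTC (lp := 1) (lm := 0) d c i) ?subr0//.
- rewrite -[X in _ --> X]expR0 -[X in expR X]oppr0.
  apply: (@continuous_cvg _ _ _ _ _ _ expR); first exact: continuous_expR.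
  by apply: cvgN; exact: cvgr_expR.
- have e : expR (- z) @[z --> -oo] --> (+oo : set_system R).
    apply/cvgryPge => A; near=> z; apply: le_trans (expR_ge1Dx _).
    suff : z <= - A by lra.
    by near: z; apply: nbhs_ninfty_le; rewrite num_real.
  exact: (cvg_comp _ _ e (@cvgr_expR R)).
Unshelve. all: end_near. Qed.

Lemma mem_Rpos t : (t \in @Rpos R) = (0 < t).
Proof. by apply/idP/idP; rewrite inE /Rpos/= in_itv/= andbT. Qed.

(** For fixed [s], the exponential density in [t] with rate [e^(- s)], of total mass 1. *)
Let kern s t := \1_(@Rpos R) t * (expR (- s) * expR (- (expR (- s) * t))).

Let kern_integral s : (\int[leb]_t (kern s t)%:E = 1)%E.
Proof.
rewrite -(@integral_exponential_pdf R (expR (- s)) (expR_gt0 _)) /exponential_pdf.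
have m (D : set R) : measurable_fun D (fun t => (expR (- s) * expR (- expR (- s) * t))%:E).
  by apply/measurable_EFinP; apply: measurable_funS (@continuous_measurable_fun R _ _) => //; cont.
transitivity (\int[leb]_(t in `]0%R, +oo[) (expR (- s) * expR (- expR (- s) * t))%:E)%E.
  rewrite [RHS]integral_mkcond; apply: eq_integral => t _.
  rewrite patchE /kern indicE /Rpos; case: ifPn => _; first by rewrite mul1r mulNr.
  by rewrite mul0r.
rewrite integral_itv_obnd_cbnd// [LHS]integral_mkcond; apply: eq_integral => t _.
by rewrite !patchE; case: ifPn.
Qed.

Let ge0Zl k (h : R -> R) : 0 <= k -> measurable_fun setT h -> (forall t, 0 <= h t) ->
  (\int[leb]_t (k * h t)%:E = k%:E * \int[leb]_t (h t)%:E)%E.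
Proof.
move=> k0 mh h0; under eq_integral do rewrite EFinM; rewrite ge0_integralZl//.
- exact/measurable_EFinP.
- by move=> t _; rewrite lee_fin.
Qed.

(* Averaging [\int f = \int e^z f (e^z t) dt] over [z] with the density [psi] and exchanging
   the integrals reduces the substitution to the integral of one exponential. *)
Lemma ge0_integral_expR f : measurable_fun setT f -> (forall t, 0 <= f t) ->
  (forall t, t <= 0 -> f t = 0) ->
  (\int[leb]_t (f t)%:E = \int[leb]_s (expR s * f (expR s))%:E)%E.
Proof.
move=> mf f0 fneg.
have [psi_i psi1] := psi_integral.
have psi0 z : 0 <= psi z by rewrite mulr_ge0 ?expR_ge0.
have kern0 s t : 0 <= kern s t by rewrite /kern indicE !mulr_ge0 ?expR_ge0.
set I := (\int[leb]_t (f t)%:E)%E.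
have I0 : (0 <= I)%E by apply: integral_ge0 => t _; rewrite lee_fin.
have m1 : meas2 (fun z t => psi z * (expR z * f (expR z * t))).
  apply: (@meas2M R (fun z _ => psi z) (fun z t => expR z * f (expR z * t))).
    by apply: (@meas2_fst R psi); exact: measurable_integrable.
  apply: (@meas2M R (fun z _ => expR z) (fun z t => f (expR z * t))).
    exact: (@meas2_fst R (@expR R)).
  apply: (measurableT_comp mf); apply: measurable_funM => //.
  exact: (measurableT_comp (@measurable_expR R)).
have mfe : measurable_fun setT (fun s => expR s * f (expR s)).
  by apply: measurable_funM; [exact: measurable_expR|exact: (measurableT_comp mf (@measurable_expR R))].
have m2 : meas2 (fun t s => kern s t * (expR s * f (expR s))).
  apply: (@meas2M R (fun t s => kern s t) (fun _ s => expR s * f (expR s))); last exact: (meas2_snd mfe).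
  have me : measurable_fun setT (fun s : R => expR (- s)) by apply: continuous_measurable_fun; cont.
  apply: (@meas2M R (fun t _ => \1_(@Rpos R) t)
      (fun t s => expR (- s) * expR (- (expR (- s) * t)))).
    have mi : measurable_fun setT (fun t : R => \1_(@Rpos R) t : R).
      by apply: measurable_indic; exact: measurable_itv.
    exact: (meas2_fst mi).
  apply: (@meas2M R (fun _ s => expR (- s)) (fun t s => expR (- (expR (- s) * t)))).
    exact: (meas2_snd me).
  apply: (measurableT_comp (@measurable_expR R)); apply: measurable_funN.
  by apply: (@meas2M R (fun _ s => expR (- s)) (fun t _ => t)); [exact: (meas2_snd me)|exact: (@meas2_fst R id)].
transitivity (\int[leb]_z \int[leb]_t (psi z * (expR z * f (expR z * t)))%:E)%E.
  transitivity (\int[leb]_z ((psi z)%:E * I))%E.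
    rewrite ge0_integralZr//; last 2 first.
    - by apply/measurable_EFinP; exact: measurable_integrable.
    - by move=> z _; rewrite lee_fin.
    by rewrite (integral_EFin psi_i) psi1 mul1e.
  apply: eq_integral => z _.
  have k0 : expR z != 0 by rewrite gt_eqF// expR_gt0.
  rewrite /I (ge0_integral_affine 0 k0 mf f0) gtr0_norm ?expR_gt0//.
  have mz : measurable_fun setT (fun t => f (expR z * t + 0)) by exact: measurable_affine.
  rewrite -!ge0Zl ?expR_ge0//; last 2 first.
  - exact: measurable_funM.
  - by move=> t; rewrite mulr_ge0 ?expR_ge0.
  by apply: eq_integral => t _; rewrite addr0.
rewrite (@fubini_tonelli _ _ T T R leb leb (fun p => (psi p.1 * (expR p.1 * f (expR p.1 * p.2)))%:E)); last 2 first.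
- exact/measurable_EFinP.
- by move=> p; rewrite lee_fin !mulr_ge0 ?expR_ge0.
(* For [t > 0] put [z = s - ln t]: then [psi z] times [e^z] is [kern s t] times [e^s], and
   [e^z t = e^s] no longer involves [t]. For [t <= 0] both inner integrals are 0. *)
transitivity (\int[leb]_t \int[leb]_s (kern s t * (expR s * f (expR s)))%:E)%E.
  apply: eq_integral => t _; have [t0|t0] := lerP t 0.
    rewrite !integral0_eq// => z _.
      by rewrite /kern indicE mem_Rpos ltNge t0/= !mul0r.
    by rewrite fneg ?mulr0// mulr_ge0_le0 ?expR_ge0.
  have mt : measurable_fun setT (fun z => psi z * (expR z * f (expR z * t))).
    apply: measurable_funM; first exact: measurable_integrable.
    apply: measurable_funM; first exact: measurable_expR.
    by apply: (measurableT_comp mf); apply: measurable_funM => //; exact: measurable_expR.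
  rewrite (@ge0_integral_affine R 1 (- ln t) _ (oner_neq0 R) mt); last first.
    by move=> z; rewrite !mulr_ge0 ?expR_ge0.
  rewrite normr1 mul1e; apply: eq_integral => s _; congr EFin.
  rewrite /kern indicE mem_Rpos t0 /psi !mul1r /=.
  rewrite opprB.
  have -> : expR (ln t - s) = expR (- s) * t by rewrite addrC expRD lnK.
  have -> : expR (s - ln t) = expR s / t by rewrite expRB lnK.
  have gen (A B E F : R) : B * t * A * (E / t * F) = B * A * (E * F).
    by field; rewrite gt_eqF.
  by rewrite divfK ?gt_eqF// gen.
rewrite (@fubini_tonelli _ _ T T R leb leb (fun p => (kern p.2 p.1 * (expR p.2 * f (expR p.2)))%:E)); last 2 first.
- exact/measurable_EFinP.
- by move=> p; rewrite lee_fin !mulr_ge0 ?expR_ge0 ?kern0.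
apply: eq_integral => s _ /=; under eq_integral do rewrite mulrC.
rewrite ge0Zl ?kern_integral ?mule1 ?mulr_ge0 ?expR_ge0//.
apply: measurable_funM; first by apply: measurable_indic; exact: measurable_itv.
by apply: continuous_measurable_fun; cont.
Qed.

Lemma integrable_expR f : measurable_fun setT f -> (forall t, t <= 0 -> f t = 0) ->
  Lint f <-> Lint (fun s => expR s * f (expR s)).
Proof.
move=> mf fneg.
have mfe : measurable_fun setT (fun s => expR s * f (expR s)).
  by apply: measurable_funM; [exact: measurable_expR|exact: (measurableT_comp mf (@measurable_expR R))].
have E : (\int[leb]_t `|(EFin \o f) t| = \int[leb]_s `|(expR s * f (expR s))%:E|)%E.
  under eq_integral do rewrite abse_EFin.
  rewrite (@ge0_integral_expR (fun t => `|f t|))//; last 2 first.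
  - exact: measurableT_comp.
  - by move=> t t0; rewrite fneg ?normr0.
  by apply: eq_integral => s _; rewrite abse_EFin normrM gtr0_norm ?expR_gt0.
split => /integrableP[_ H]; apply/integrableP; split; try exact/measurable_EFinP.
  by rewrite -E.
by rewrite E.
Qed.

Lemma Rintegral_expR f : Lint f -> (forall t, t <= 0 -> f t = 0) ->
  \int[leb]_t f t = \int[leb]_s (expR s * f (expR s)).
Proof.
move=> fi fneg; have mf := measurable_integrable fi.
have split (h : R -> R) : Lint h ->
    \int[leb]_x h x = \int[leb]_x (h x + `|h x|) - \int[leb]_x `|h x|.
  move=> hi; rewrite RintegralD ?addrK//; exact: integrable_norm.
have ei := (integrable_expR mf fneg).1 fi.
have ge0 (h : R -> R) : measurable_fun setT h -> (forall t, 0 <= h t) -> (forall t, t <= 0 -> h t = 0) ->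
    \int[leb]_t h t = \int[leb]_s (expR s * h (expR s)).
  by move=> mh h0 hneg; rewrite /Rintegral ge0_integral_expR.
rewrite split// [RHS]split// (ge0 (fun t => f t + `|f t|)); last 3 first.
- by apply: measurable_funD => //; exact: measurableT_comp.
- by move=> t; have := ler_norm (- f t); rewrite normrN; lra.
- by move=> t t0; rewrite fneg// normr0 addr0.
rewrite (ge0 (fun t => `|f t|)); last 3 first.
- exact: measurableT_comp.
- by [].
- by move=> t t0; rewrite fneg// normr0.
by congr (_ - _); apply: eq_Rintegral => s _; rewrite normrM (gtr0_norm (expR_gt0 s)) ?mulrDr.
Qed.

Let patch_Rpos f s : (f \_ (@Rpos R)) (expR s) = f (expR s).
Proof. by rewrite patchE mem_Rpos expR_gt0. Qed.

Let patch_Rpos0 f t : t <= 0 -> (f \_ (@Rpos R)) t = 0.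
Proof. by move=> t0; rewrite patchE mem_Rpos ltNge t0. Qed.

Lemma measurable_Rpos : measurable (@Rpos R : set (measurableTypeR R)).
Proof. exact: measurable_itv. Qed.

Let integrable_patch f :
  leb.-integrable (@Rpos R) (EFin \o f) <-> Lint (f \_ (@Rpos R)).
Proof.
have mR := measurable_Rpos; rewrite -restrict_EFin; exact: integrable_mkcond.
Qed.

Lemma integrable_Rpos f : measurable_fun (@Rpos R) f ->
  leb.-integrable (@Rpos R) (EFin \o f) <-> Lint (fun s => expR s * f (expR s)).
Proof.
move=> mf; have mR := measurable_Rpos.
have mp : measurable_fun setT (f \_ (@Rpos R)) by apply/(measurable_restrictT _ mR).
have := integrable_expR mp (patch_Rpos0 f).
under [X in _ <-> Lint X]eq_fun do rewrite patch_Rpos.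
by move=> <-; exact: integrable_patch.
Qed.

Lemma Rintegral_Rpos f : leb.-integrable (@Rpos R) (EFin \o f) ->
  \int[leb]_(t in @Rpos R) f t = \int[leb]_s (expR s * f (expR s)).
Proof.
move=> /integrable_patch fi.
rewrite Rintegral_mkcond (Rintegral_expR fi (patch_Rpos0 f)).
by apply: eq_Rintegral => s _; rewrite patch_Rpos.
Qed.

End ExponentialSubstitution.

Section LaplaceOnTheLine.
Variable R : realType.
Implicit Types (x y r s z : R) (u v F c : R -> R).
Notation leb := (@lebesgue_measure R).
Notation Lint f := (leb.-integrable setT (EFin \o f)).
Local Notation S := (@sech_conv R).

(* [phi] is the Laplace kernel [e^(-t p)] in the logarithmic variables [t = e^s], [p = e^x],
   with the half densities [e^(s/2) e^(x/2)] that make the substitution unitary. *)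
Definition phi z := expR (z / 2 - expR z).

Lemma phi_gt0 z : 0 < phi z. Proof. exact: expR_gt0. Qed.

(** After multiplication by the denominator this is [(1 + e^z) e^(- e^z) <= 1]. *)
Lemma phi_le_sech2 z : phi z <= sech2 z.
Proof.
rewrite /phi /sech2 -[leRHS]mul1r ler_pdivlMr ?sech2_den_gt0//.
rewrite mulrDr -!expRD.
have -> : z / 2 - expR z + z / 2 = z - expR z by field.
have -> : z / 2 - expR z - z / 2 = - expR z by ring.
rewrite expRD expRN -[X in _ + X]mul1r -mulrDl ler_pdivrMr ?expR_gt0// mul1r addrC.
exact: expR_ge1Dx.
Qed.

Lemma continuous_phi : continuous phi.
Proof. by rewrite /phi; cont. Qed.

Lemma phi_le1 z : phi z <= 1.
Proof. exact: le_trans (phi_le_sech2 z) (sech2_le1 z). Qed.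

Lemma integrable_phi : Lint phi.
Proof.
apply: (integrable_dominated _ (@integrable_sech2 R)).
  by apply: continuous_measurable_fun; exact: continuous_phi.
by move=> z; rewrite gtr0_norm ?phi_gt0// phi_le_sech2.
Qed.

Lemma integrable_phiD x : Lint (fun s => phi (x + s)).
Proof.
have := integrable_affine x (oner_neq0 R) integrable_phi.
by congr (_.-integrable _ _); apply/funext => s /=; rewrite mul1r addrC.
Qed.

Lemma Rintegral_phiD x : \int[leb]_s phi (x + s) = \int[leb]_s phi s.
Proof.
have := Rintegral_affine x (oner_neq0 R) integrable_phi.
rewrite normr1 invr1 mul1r => <-; apply: eq_Rintegral => s _.
by rewrite mul1r addrC.
Qed.

Let RZ k g : Lint g -> \int[leb]_s (k * g s) = k * \int[leb]_s g s.
Proof. by move=> gi; rewrite RintegralZl. Qed.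

Let Rcomb k l (g1 g2 g3 : R -> R) : Lint g1 -> Lint g2 -> Lint g3 ->
  \int[leb]_s g1 s - k * \int[leb]_s g2 s + l * \int[leb]_s g3 s =
  \int[leb]_s (g1 s - k * g2 s + l * g3 s).
Proof.
move=> i1 i2 i3; have i2k := integrableZ_fun k i2; have i3l := integrableZ_fun l i3.
by rewrite -!RZ// -RintegralB// -RintegralD//; exact: integrableB_fun.
Qed.

Definition L2fun F := measurable_fun setT F /\ Lint (fun s => F s ^+ 2).

Definition laplace F x := \int[leb]_s (phi (x + s) * F s).

Lemma L2fun_square u : square_mfun u -> L2fun u.
Proof. by move=> [[mu _] iu]. Qed.

Lemma integrable_phi_L2 x F : L2fun F ->
  Lint (fun s => phi (x + s) * F s) /\ Lint (fun s => phi (x + s) * F s ^+ 2).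
Proof.
move=> [mF iF]; have ip := integrable_phiD x; have mp := measurable_integrable ip.
split.
  apply: (@integrable_dominated _ _ (fun s => phi (x + s) + F s ^+ 2)).
  - exact: measurable_funM.
  - exact: integrableD_fun.
  - move=> s; rewrite normrM gtr0_norm ?phi_gt0// -(real_normK (num_real (F s))).
    have := phi_gt0 (x + s); have := phi_le1 (x + s); have := normr_ge0 (F s).
    by move: (phi _) `|F s| => p f; nra.
apply: (integrable_bounded_mull iF mp (B := 1)) => s.
by rewrite gtr0_norm ?phi_gt0// phi_le1.
Qed.

Lemma meas2_phi F : measurable_fun setT F ->
  measurable_fun [set: measurableTypeR R * measurableTypeR R]
    (fun p : measurableTypeR R * measurableTypeR R => phi (p.1 + p.2) * F p.2 : R).
Proof.
move=> mF; apply: (@meas2M R (fun x s => phi (x + s)) (fun _ s => F s)); last exact: meas2_snd.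
apply: (measurableT_comp (continuous_measurable_fun continuous_phi)).
exact: measurable_funD.
Qed.

Lemma laplace_le F x : L2fun F ->
  `|laplace F x| <= \int[leb]_s phi s + \int[leb]_s F s ^+ 2.
Proof.
move=> LF; have [mF iF] := LF; have [i1 _] := integrable_phi_L2 x LF.
rewrite -(Rintegral_phiD x) -RintegralD//; last exact: integrable_phiD.
apply: le_norm_int.
- exact: measurable_integrable.
- by apply: integrableD_fun => //; exact: integrable_phiD.
- move=> s; rewrite normrM gtr0_norm ?phi_gt0// -(real_normK (num_real (F s))).
  have := phi_gt0 (x + s); have := phi_le1 (x + s); have := normr_ge0 (F s).
  by move: (phi _) `|F s| => p f; nra.
Qed.

Lemma laplace_sqr F x : L2fun F ->
  laplace F x ^+ 2 <= (\int[leb]_s phi s + 1) * \int[leb]_s (phi (x + s) * F s ^+ 2).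
Proof.
move=> LF; have [mF iF] := LF; have [i1 i2] := integrable_phi_L2 x LF.
have i0 := integrable_phiD x.
set p := \int[leb]_s phi s; have pE : \int[leb]_s phi (x + s) = p by exact: Rintegral_phiD.
have p0 : 0 <= p by apply: Rintegral_ge0 => s _; exact/ltW/phi_gt0.
(* Cauchy-Schwarz: the discriminant of [m |-> \int phi (F - m)^2 >= 0]. *)
have H m : 0 <= \int[leb]_s (phi (x + s) * F s ^+ 2) - 2 * m * laplace F x + m ^+ 2 * p.
  rewrite -pE (Rcomb _ _ i2 i1 i0).
  apply: Rintegral_ge0 => s _.
  rewrite (_ : _ + _ = phi (x + s) * (F s - m) ^+ 2); last by ring.
  exact: mulr_ge0 (ltW (phi_gt0 _)) (sqr_ge0 _).
move: H; set A := \int[leb]_s _; set B := laplace F x => H.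
(* At this point [p] is only known to be nonnegative; [p + 1] can be divided by. *)
have pp : 0 < p + 1 by rewrite ltr_wpDl.
have := mulr_ge0 (ltW pp) (H (B / (p + 1))).
rewrite (_ : (p + 1) * _ = (p + 1) * A - B ^+ 2 - B ^+ 2 / (p + 1)); last by field; rewrite gt_eqF.
by have := divr_ge0 (sqr_ge0 B) (ltW pp); lra.
Qed.

(** The point where arbitrary [L^2] data become bounded, so that the theory of [K] on [square_mfun]
    applies to every function of the half line. *)
Lemma square_mfun_laplace F : L2fun F -> square_mfun (laplace F).
Proof.
move=> LF; have [mF iF] := LF.
have m : measurable_fun setT (laplace F).
  apply: (measurable_Rintegral (k := fun x s => phi (x + s) * F s)); first exact: meas2_phi.
  by move=> x; have [] := integrable_phi_L2 x LF.
split.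
  by split => //; eexists => x; exact: laplace_le.
have n1 : -1 != 0 :> R by rewrite oppr_eq0 oner_eq0.
(* By [laplace_sqr] and [phi (x + s) <= sech2 (- x - s)], a multiple of the reflected convolution
   [S (F^2)] dominates the square. *)
have i1 := integrableZ_fun (\int[leb]_s phi s + 1) (integrable_affine 0 n1 (integrable_sech_conv iF)).
apply: (integrable_dominated _ i1); first exact: measurable_funX.
move=> x; rewrite ger0_norm ?sqr_ge0// (le_trans (laplace_sqr x LF))//.
apply: ler_wpM2l.
  by rewrite addr_ge0//; apply: Rintegral_ge0 => s _; exact/ltW/phi_gt0.
have [_ i2] := integrable_phi_L2 x LF.
apply: le_Rintegral => // [|s _]; first exact: sech_conv_int.
by rewrite ler_wpM2r ?sqr_ge0// (le_trans (phi_le_sech2 _))// -sech2N mulN1r addr0 opprD.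
Qed.

Lemma laplaceD F G x : L2fun F -> L2fun G ->
  laplace (fun s => F s + G s) x = laplace F x + laplace G x.
Proof.
move=> /(integrable_phi_L2 x)[i1 _] /(integrable_phi_L2 x)[i2 _].
by rewrite /laplace -RintegralD//; apply: eq_Rintegral => s _; rewrite mulrDr.
Qed.

Lemma laplaceZ k F x : L2fun F -> laplace (fun s => k * F s) x = k * laplace F x.
Proof.
move=> /(integrable_phi_L2 x)[i1 _].
by rewrite /laplace -RintegralZl//; apply: eq_Rintegral => s _; rewrite mulrCA.
Qed.

Lemma L2fun_lin k F G : L2fun F -> L2fun G -> L2fun (fun s => k * F s + G s).
Proof.
move=> [mF iF] [mG iG]; have m : measurable_fun setT (fun s => k * F s + G s).
  by apply: measurable_funD => //; exact: measurable_funM.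
split => //; apply: (@integrable_dominated _ _ (fun x => 2 * k ^+ 2 * F x ^+ 2 + 2 * G x ^+ 2)).
- exact: measurable_funX.
- by apply: integrableD_fun; exact: integrableZ_fun.
- move=> x; rewrite ger0_norm ?sqr_ge0// -subr_ge0.
  by rewrite (_ : _ - _ = (k * F x - G x) ^+ 2) ?sqr_ge0//; ring.
Qed.

(** In the variable [p = e^s] this is the integral of [e^(- p a)] over the half line, equal to
    [1 / a], with [a = e^x + e^y]. It is why the square of [laplace] is the convolution [S]. *)
Lemma phi_convolution x y : Lint (fun s => phi (x + s) * phi (y + s)) /\
  \int[leb]_s (phi (x + s) * phi (y + s)) = sech2 (x - y).
Proof.
have i : Lint (fun s => phi (x + s) * phi (y + s)).
  apply: (integrable_bounded_mul (integrable_phiD x) (B := 1)).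
    exact: measurable_integrable (integrable_phiD y).
  by move=> s; rewrite gtr0_norm ?phi_gt0// phi_le1.
split => //; pose a := expR x + expR y; have a0 : 0 < a by rewrite addr_gt0 ?expR_gt0.
pose k := expR ((x + y) / 2) / a.
have kE : sech2 (x - y) = k.
  rewrite /k /a /sech2; apply/(canRL (mulfK _)); first by rewrite gt_eqF.
  have -> : expR x + expR y = expR ((x + y) / 2) * (expR ((x - y) / 2) + expR (- ((x - y) / 2))).
    by rewrite mulrDr -!expRD; congr (expR _ + expR _); field.
  by rewrite mulrC mulfK// sech2_den_neq0.
pose P s := - k * expR (- (expR s * a)).
have d (s : R) : is_derive s 1 P (phi (x + s) * phi (y + s)).
  rewrite /P; derive; rewrite /phi -expRD /k /a.
  have -> : expR ((x + s) / 2 - expR (x + s) + ((y + s) / 2 - expR (y + s))) =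
      expR ((x + y) / 2) * expR s * expR (- (expR s * (expR x + expR y))).
    by rewrite -!expRD; congr expR; rewrite !expRD; field.
  by field; rewrite gt_eqF.
have c : continuous (fun s => phi (x + s) * phi (y + s)).
  by rewrite /phi; cont.
rewrite (Rintegral_FTC (lp := 0) (lm := - k) d c i) ?kE ?sub0r ?opprK//.
- rewrite -[X in _ --> X](mulr0 (- k)); apply: cvgM; first exact: cvg_cst.
  have e : expR s * a @[s --> +oo] --> (+oo : set_system R).
    apply/cvgryPge => A; near=> s; rewrite -ler_pdivrMr// (le_trans _ (expR_ge1Dx _))//.
    suff : A / a <= s by lra.
    by near: s; apply: nbhs_pinfty_ge; rewrite num_real.
  exact: (cvg_comp _ _ e (@cvgr_expR R)).
- rewrite -[X in _ --> X]mulr1; apply: cvgM; first exact: cvg_cst.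
  rewrite -[X in _ --> X]expR0 -[X in expR X]oppr0 -[X in - X](mul0r a).
  apply: (@continuous_cvg _ _ _ _ _ _ expR); first exact: continuous_expR.
  apply: cvgN; apply: cvgM; last exact: cvg_cst.
  by apply: cvg_trans (cvg_comp _ _ (@cvg_opp_ny R) (@cvgr_expR R)); apply: near_eq_cvg; apply: nearW => s /=; rewrite opprK.
Unshelve. all: end_near. Qed.

Lemma laplace_laplace v x : bounded_mfun v -> L2fun v -> laplace (laplace v) x = S v x.
Proof.
move=> bv Lv; have [mv [B vB]] := bv.
pose f s y := phi (x + s) * (phi (s + y) * v y).
have fx s : Lint (f s) by apply: integrableZ_fun; have [] := integrable_phi_L2 s Lv.
have fyE y : f ^~ y = (fun s => v y * (phi (x + s) * phi (y + s))).
  by apply/funext => s; rewrite /f [s + y]addrC; ring.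
have fy y : Lint (f ^~ y) by rewrite fyE; apply: integrableZ_fun; have [] := phi_convolution x y.
have mf : measurable_fun [set: measurableTypeR R * measurableTypeR R]
    (fun p : measurableTypeR R * measurableTypeR R => f p.1 p.2 : R).
  apply: (@meas2M R (fun s y => phi (x + s)) (fun s y => phi (s + y) * v y)).
    exact: (meas2_fst (measurable_integrable (integrable_phiD x))).
  exact: meas2_phi.
have fi : Lint (fun s => \int[leb]_y `|f s y|).
  apply: (@integrable_dominated _ _ (fun s => B * (\int[leb]_y phi y) * phi (x + s))).
  - apply: (measurable_Rintegral (k := fun s y => `|f s y|)); first exact: measurableT_comp.
    by move=> s; exact: integrable_norm.
  - by apply: integrableZ_fun; exact: integrable_phiD.
  - move=> s; rewrite ger0_norm ?Rintegral_ge0//.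
    have -> : B * \int[leb]_y phi y * phi (x + s) = \int[leb]_y (phi (x + s) * B * phi (s + y)).
      by rewrite (RZ _ (integrable_phiD s)) Rintegral_phiD mulrC mulrA.
    apply: le_Rintegral => //; [exact: integrable_norm|by apply: integrableZ_fun; exact: integrable_phiD|].
    move=> y _; rewrite /f !normrM !(gtr0_norm (phi_gt0 _)) -mulrA ler_wpM2l ?(ltW (phi_gt0 _))//.
    by rewrite mulrC ler_wpM2r ?(ltW (phi_gt0 _)).
have [E _ _] := Rfubini mf fx fy fi.
transitivity (\int[leb]_s \int[leb]_y f s y).
  by apply: eq_Rintegral => s _; rewrite /f RintegralZl//; have [] := integrable_phi_L2 s Lv.
rewrite E; apply: eq_Rintegral => y _; rewrite fyE (RZ _ (phi_convolution x y).1).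
by rewrite (phi_convolution x y).2 mulrC.
Qed.

Lemma laplace_hankel c F s : bounded_mfun c -> L2fun F ->
  Lint (fun r => (\int[leb]_y (phi (y + s) * phi (y + r) * c y)) * F r) /\
  laplace (fun y => c y * laplace F y) s =
  \int[leb]_r ((\int[leb]_y (phi (y + s) * phi (y + r) * c y)) * F r).
Proof.
move=> bc LF; have [mc [B cB]] := bc; have [mF iF] := LF.
pose f r y := phi (s + y) * phi (r + y) * c y * F r.
have i1 r : Lint (fun y => phi (s + y) * phi (r + y) * c y).
  by apply: integrable_bounded_mfun => //; have [] := phi_convolution s r.
have fx r : Lint (f r).
  by rewrite /f; under eq_fun do rewrite mulrC; exact: integrableZ_fun.
have fyE y : f ^~ y = (fun r => phi (s + y) * c y * (phi (y + r) * F r)).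
  by apply/funext => r; rewrite /f [r + y]addrC; ring.
have fy y : Lint (f ^~ y).
  by rewrite fyE; apply: integrableZ_fun; have [] := integrable_phi_L2 y LF.
have mf : measurable_fun [set: measurableTypeR R * measurableTypeR R]
    (fun p : measurableTypeR R * measurableTypeR R => f p.1 p.2 : R).
  apply: (@meas2M R (fun r y => phi (s + y) * phi (r + y) * c y) (fun r _ => F r)); last exact: meas2_fst.
  apply: (@meas2M R (fun r y => phi (s + y) * phi (r + y)) (fun _ y => c y)); last exact: meas2_snd.
  apply: (@meas2M R (fun r y => phi (s + y)) (fun r y => phi (r + y))).
    exact: (meas2_snd (measurable_integrable (integrable_phiD s))).
  have := @meas2_phi (fun=> 1) (measurable_cst _).
  by under eq_fun do rewrite mulr1.
have iS : Lint (fun r => sech2 (s - r) * F r).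
  apply: (@integrable_dominated _ _ (fun r => sech2 (s - r) + F r ^+ 2)).
  - by apply: measurable_funM => //; case: (bounded_sech2_subl s).
  - by apply: integrableD_fun => //; exact: integrable_sech2_subl.
  - move=> r; rewrite normrM gtr0_norm ?sech2_gt0// -(real_normK (num_real (F r))).
    have := sech2_gt0 (s - r); have := sech2_le1 (s - r); have := normr_ge0 (F r).
    by move: (sech2 _) `|F r| => p e; nra.
have fi : Lint (fun r => \int[leb]_y `|f r y|).
  apply: (@integrable_dominated _ _ (fun r => B * `|sech2 (s - r) * F r|)).
  - apply: (measurable_Rintegral (k := fun s y => `|f s y|)); first exact: measurableT_comp.
    by move=> r; exact: integrable_norm.
  - by apply: integrableZ_fun; exact: integrable_norm.
  - move=> r; rewrite ger0_norm ?Rintegral_ge0//.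
    have [i2 E2] := phi_convolution s r.
    have -> : B * `|sech2 (s - r) * F r| = \int[leb]_y (B * `|F r| * (phi (s + y) * phi (r + y))).
      by rewrite RintegralZl// E2 normrM gtr0_norm ?sech2_gt0//; ring.
    apply: le_Rintegral => //; [exact: integrable_norm|exact: integrableZ_fun|].
    move=> y _; rewrite /f !normrM !(gtr0_norm (phi_gt0 _)).
    have := cB y; have := mulr_gt0 (phi_gt0 (s + y)) (phi_gt0 (r + y)); have := normr_ge0 (F r).
    move: (phi _ * _) `|F r| `|c y| => p e d ? ? ?.
    by rewrite -[leLHS]mulrA [leLHS]mulrC ler_wpM2r// ?ler_wpM2r// ltW.
have [E fI _] := Rfubini mf fx fy fi.
have fr r : \int[leb]_y f r y = (\int[leb]_y (phi (y + s) * phi (y + r) * c y)) * F r.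
  apply: etrans (etrans (RZ (F r) (i1 r)) _).
    by apply: eq_Rintegral => y _; rewrite /f mulrC.
  rewrite [LHS]mulrC; apply: (congr1 (fun z => z * F r)).
  by apply: eq_Rintegral => y _; rewrite (addrC s) (addrC r).
split; first by move: fI; under eq_fun do rewrite fr.
transitivity (\int[leb]_y \int[leb]_r f r y).
  apply: eq_Rintegral => y _; rewrite fyE RintegralZl ?mulrA//.
  by have [] := integrable_phi_L2 y LF.
by rewrite -E; apply: eq_Rintegral => r _; exact: fr.
Qed.

End LaplaceOnTheLine.

(** * The Hankel operator in logarithmic variables *)

Section HankelOnTheLine.
Variables (R : realType) (T : R).
Implicit Types (x y r s t z : R) (f g F U : R -> R).
Notation leb := (@lebesgue_measure R).
Notation Lint f := (leb.-integrable setT (EFin \o f)).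
Notation Rintp f := (leb.-integrable (@Rpos R) (EFin \o f)).
Local Notation w := (omega T).
Local Notation c := (fun y => cos (w * y)).

Definition L2pos f := measurable_fun (@Rpos R) f /\ Rintp (fun t => f t ^+ 2).

(** The unitary map of [L^2] spaces induced by [t = e^s]; [of_line] is its inverse on the half
    line. *)
Definition to_line f s := expR (s / 2) * f (expR s).

Definition of_line U t := expR (- (ln t / 2)) * U (ln t).

Lemma measurable_Rpos_expR f : measurable_fun (@Rpos R) f ->
  measurable_fun setT (fun s => f (expR s)).
Proof.
move=> mf; have mR := @measurable_Rpos R.
have mp : measurable_fun setT (f \_ (@Rpos R)) by apply/(measurable_restrictT _ mR).
have := measurableT_comp mp (@measurable_expR R).
congr (measurable_fun _ _); apply/funext => s /=.
by rewrite patchE mem_Rpos expR_gt0.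
Qed.

Let e2 s : expR (s / 2) * expR (s / 2) = expR s.
Proof. by rewrite -expRD; congr expR; field. Qed.

Lemma L2fun_to_line f : L2pos f -> L2fun (to_line f).
Proof.
move=> [mf fi]; have mfe := measurable_Rpos_expR mf.
split; first by apply: measurable_funM => //; apply: continuous_measurable_fun; cont.
have mf2 : measurable_fun (@Rpos R) (fun t => f t ^+ 2) by exact: measurable_funX.
have := (integrable_Rpos mf2).1 fi; congr (_.-integrable _ _); apply/funext => s /=.
by rewrite /to_line exprMn [expR (s / 2) ^+ 2]e2.
Qed.

Lemma of_lineK U : to_line (of_line U) = U.
Proof.
apply/funext => s; rewrite /to_line /of_line expRK mulrA -expRD.
by rewrite subrr expR0 mul1r.
Qed.

Lemma L2pos_of_line U : L2fun U -> L2pos (of_line U).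
Proof.
move=> [mU iU].
have m : measurable_fun (@Rpos R) (of_line U).
  apply: measurable_funM; apply: measurable_funTS.
    apply: (measurableT_comp (@measurable_expR R)); apply: measurable_funN.
    by apply: measurable_funM => //; exact: measurable_ln.
  by apply: (measurableT_comp mU); exact: measurable_ln.
split => //; apply/integrable_Rpos; first exact: measurable_funX.
move: iU; congr (_.-integrable _ _); apply/funext => s /=; congr EFin.
by rewrite -[in LHS](of_lineK U) /to_line exprMn [expR (s / 2) ^+ 2]e2.
Qed.

Lemma L2posP f : measurable_fun (@Rpos R) f -> L2fun (to_line f) -> L2pos f.
Proof.
move=> mf [_ i]; split => //; apply/integrable_Rpos; first exact: measurable_funX.
move: i; congr (_.-integrable _ _); apply/funext => s /=; congr EFin.
by rewrite /to_line exprMn [expR (s / 2) ^+ 2]e2.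
Qed.

Lemma to_line_lin k f g :
  to_line (fun t => k * f t + g t) = (fun s => k * to_line f s + to_line g s).
Proof. by apply/funext => s; rewrite /to_line; ring. Qed.

Lemma L2pos_lin k f g : L2pos f -> L2pos g -> L2pos (fun t => k * f t + g t).
Proof.
move=> Lf Lg; apply: L2posP.
  by apply: measurable_funD; [apply: measurable_funM => //; case: Lf|case: Lg].
by rewrite to_line_lin; apply: L2fun_lin; exact: L2fun_to_line.
Qed.

Lemma laplace_lin k f g x : L2pos f -> L2pos g ->
  laplace (to_line (fun t => k * f t + g t)) x = k * laplace (to_line f) x + laplace (to_line g) x.
Proof.
move=> /L2fun_to_line Lf /L2fun_to_line Lg; rewrite to_line_lin.
have z : L2fun (fun s => k * to_line f s).
  have := L2fun_lin (k - 1) Lf Lf; congr L2fun; apply/funext => s; ring.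
by rewrite laplaceD// laplaceZ.
Qed.

Let meas_kernel x : measurable_fun setT (fun t : R => expR (x / 2 - expR x * t)).
Proof. by apply: continuous_measurable_fun; cont. Qed.

Let kernel_to_line f x s :
  expR s * (expR (x / 2 - expR x * expR s) * f (expR s)) = phi (x + s) * to_line f s.
Proof.
rewrite /phi /to_line -expRD mulrA -expRD mulrA -expRD; congr (expR _ * _).
by rewrite expRD; field.
Qed.

Let integrable_kernel f x : L2pos f -> Rintp (fun t => expR (x / 2 - expR x * t) * f t).
Proof.
move=> Lf; have [mf _] := Lf; apply/integrable_Rpos.
  by apply: measurable_funM => //; apply: measurable_funTS; exact: meas_kernel.
under eq_fun do rewrite kernel_to_line.
by have [] := integrable_phi_L2 x (L2fun_to_line Lf).
Qed.

Lemma laplace_to_line f x : L2pos f ->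
  laplace (to_line f) x = \int[leb]_(t in @Rpos R) (expR (x / 2 - expR x * t) * f t).
Proof.
move=> Lf; rewrite (Rintegral_Rpos (integrable_kernel x Lf)).
by apply: eq_Rintegral => s _; rewrite kernel_to_line.
Qed.

(** The transform does not see null sets, which upgrades almost-everywhere equations on the half
    line to pointwise equations after [laplace]. *)
Lemma laplace_ae f g x : L2pos f -> L2pos g ->
  leb.-negligible [set t | @Rpos R t /\ f t <> g t] ->
  laplace (to_line f) x = laplace (to_line g) x.
Proof.
move=> Lf Lg fg; rewrite !laplace_to_line// /Rintegral; congr fine.
have i1 := integrable_kernel x Lf; have i2 := integrable_kernel x Lg.
apply: ae_eq_integral.
- exact: measurable_Rpos.
- exact: measurable_int i1.
- exact: measurable_int i2.
- apply: negligibleS fg => t /= /not_implyP[tp ne]; split => // E; apply: ne.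
  by rewrite E.
Qed.

Let e y t := expR (y - expR y * t).

Let integrable_e t : 0 < t -> Lint (fun y => e y t).
Proof.
move=> t0; have k0 : 0 < t / 2 by rewrite divr_gt0.
have [i _] := phi_convolution (ln (t / 2)) (ln (t / 2)).
have := integrableZ_fun (2 / t) i; congr (_.-integrable _ _); apply/funext => y /=; congr EFin.
rewrite /phi -expRD.
have -> : (ln (t / 2) + y) / 2 - expR (ln (t / 2) + y) +
    ((ln (t / 2) + y) / 2 - expR (ln (t / 2) + y)) = ln (t / 2) + (y - expR y * t).
  by rewrite expRD lnK//; field.
rewrite expRD lnK// mulrA (_ : 2 / t * (t / 2) = 1) ?mul1r//.
by field; rewrite gt_eqF.
Qed.

Let bcos (h : R -> R) : continuous h -> bounded_mfun (fun y => cos (h y)).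
Proof.
move=> ch; split; first by apply: continuous_measurable_fun; cont.
by exists 1 => y; exact: cos_max.
Qed.

Let bsin (h : R -> R) : continuous h -> bounded_mfun (fun y => sin (h y)).
Proof.
move=> ch; split; first by apply: continuous_measurable_fun; cont.
by exists 1 => y; exact: sin_max.
Qed.

Let gamma_integral (h : R -> R) : bounded_mfun (fun y => h y) ->
  \int[leb]_(t in @Rpos R) (t `^ (1 - 1) * expR (- t) * h (ln t)) = \int[leb]_y (e y 1 * h y).
Proof.
move=> bh; have E s : expR s * (expR s `^ (1 - 1) * expR (- expR s) * h (ln (expR s))) = e s 1 * h s.
  by rewrite subrr powRr0 mul1r expRK mulrA -expRD /e mulr1.
rewrite Rintegral_Rpos; first by apply: eq_Rintegral => s _; exact: E.
apply/integrable_Rpos.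
  apply: measurable_funM; last first.
    by apply: measurable_funTS; apply: (measurableT_comp bh.1); exact: measurable_ln.
  under eq_fun do rewrite subrr powRr0 mul1r.
  by apply: measurable_funTS; apply: continuous_measurable_fun; cont.
under eq_fun do rewrite E.
by apply: integrable_bounded_mfun => //; exact: integrable_e.
Qed.

(** With [p = e^y], [hA] is the Laplace transform of [cos (w ln p)], the source of the factor [c]
    between two Laplace transforms. Rescaling [p] by [t] in the integral for [Gamma (1 - i w)]
    produces the factor [1 / t] and absorbs the phase [w ln t]. *)
Lemma hA_integral t : 0 < t -> hA T 0 t = \int[leb]_y (expR (y - expR y * t) * cos (w * y)).
Proof.
move=> t0; rewrite /hA /pA add0r ReM /GammaC /expi /=.
have c1 : continuous (fun y : R => - w * y) by cont.
rewrite (gamma_integral (bcos c1)) (gamma_integral (bsin c1)).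
set xi := ln t; have ie := integrable_e ltr01.
have i1 : Lint (fun y => e y 1 * cos (- w * y)) by apply: integrable_bounded_mfun => //; exact: bcos.
have i2 : Lint (fun y => e y 1 * sin (- w * y)) by apply: integrable_bounded_mfun => //; exact: bsin.
pose f z := e (z + xi) 1 * cos (w * z).
have fE z : f z = t * (e z t * cos (w * z)).
  rewrite /f mulrA /e; congr (_ * _).
  have -> : z + xi - expR (z + xi) * 1 = xi + (z - expR z * t).
    by rewrite expRD lnK//; ring.
  by rewrite expRD lnK.
have fi : Lint f.
  rewrite (_ : f = (fun z => t * (e z t * cos (w * z)))); last by apply/funext.
  apply: integrableZ_fun.
  by apply: integrable_bounded_mfun; [exact: integrable_e|exact: bounded_mfun_cos].
have -> : \int[leb]_y (e y 1 * cos (- w * y)) * cos (w * xi) -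
    \int[leb]_y (e y 1 * sin (- w * y)) * sin (w * xi) = \int[leb]_y f (y - xi).
  rewrite -!RintegralZr// -RintegralB//; last 2 first.
  - by under eq_fun do rewrite mulrC; exact: integrableZ_fun.
  - by under eq_fun do rewrite mulrC; exact: integrableZ_fun.
  apply: eq_Rintegral => y _; rewrite /f subrK mulrBr cosB mulNr cosN sinN; ring.
rewrite Rintegral_shift//; under eq_Rintegral do rewrite fE.
rewrite RintegralZl//; last first.
  by apply: integrable_bounded_mfun; [exact: integrable_e|exact: bounded_mfun_cos].
by rewrite mulrC mulKf// gt_eqF.
Qed.

Lemma hA_line s r : expR (s / 2) * expR (r / 2) * hA T 0 (expR s + expR r) =
  \int[leb]_y (phi (y + s) * phi (y + r) * cos (w * y)).
Proof.
have t0 : 0 < expR s + expR r by rewrite addr_gt0 ?expR_gt0.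
rewrite hA_integral// -RintegralZl//; last first.
  by apply: integrable_bounded_mfun; [exact: integrable_e|exact: bounded_mfun_cos].
apply: eq_Rintegral => y _; rewrite mulrA; congr (_ * _).
by rewrite /phi -!expRD; congr expR; rewrite !expRD; field.
Qed.

Let measurable_hA a : 0 < a -> measurable_fun (@Rpos R) (fun t => hA T 0 (a + t)).
Proof.
move=> a0; pose h t := pA T 0 (ln (a + t)) * expR (- ln (a + t)).
have ml : measurable_fun (@Rpos R) (fun t => ln (a + t)).
  apply: measurable_funTS; apply: (measurableT_comp (@measurable_ln R)).
  exact: measurable_funD.
apply: (@eq_measurable_fun _ _ _ _ _ h).
  by move=> t; rewrite mem_Rpos => t0; rewrite /h /hA expRN lnK// posrE addr_gt0.
apply: measurable_funM.
  apply: (measurableT_comp (f := pA T 0)) => //; apply: continuous_measurable_fun.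
  rewrite (_ : pA T 0 = (fun xi => 0 + (complex.Re (GammaC (complex.Complex 1 (- w))) * cos (w * xi) -
      complex.Im (GammaC (complex.Complex 1 (- w))) * sin (w * xi)))); last first.
    by apply/funext => xi; rewrite /pA ReM.
  by cont.
by apply: (measurableT_comp (@measurable_expR R)); exact: measurable_funN.
Qed.

Definition hankel f t := \int[leb]_(s in @Rpos R) (hA T 0 (t + s) * f s).

Lemma hankel_of_line f t : 0 < t -> L2pos f ->
  hankel f t = of_line (laplace (fun y => cos (w * y) * laplace (to_line f) y)) t.
Proof.
move=> t0 Lf; have [mf _] := Lf; have LF := L2fun_to_line Lf.
pose s := ln t; have es : expR s = t by rewrite lnK.
have E r : expR (s / 2) * (expR r * (hA T 0 (t + expR r) * f (expR r))) =
    (\int[leb]_y (phi (y + s) * phi (y + r) * cos (w * y))) * to_line f r.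
  by rewrite -hA_line es /to_line -[X in _ * (X * _) = _]e2; ring.
rewrite /of_line -/s; have [i0 ->] := laplace_hankel s (bounded_mfun_cos w) LF.
have i : Lint (fun r => expR r * (hA T 0 (t + expR r) * f (expR r))).
  have := integrableZ_fun (expR (- (s / 2))) i0; congr (_.-integrable _ _).
  by apply/funext => r /=; rewrite -E mulrA -expRD addNr expR0 mul1r.
under [in RHS]eq_Rintegral do rewrite -E.
rewrite RintegralZl// mulrA -expRD addNr expR0 mul1r.
rewrite /hankel Rintegral_Rpos//; apply/integrable_Rpos => //.
by apply: measurable_funM => //; exact: measurable_hA.
Qed.

End HankelOnTheLine.

(** * The spectrum of H(0) *)

Section Spectrum.
Variables (R : realType) (T : R).
Hypothesis T_gt0 : 0 < T.
Notation C := (complex R).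
Notation leb := (@lebesgue_measure R).
Notation Lint f := (leb.-integrable setT (EFin \o f)).
Notation Rintp f := (leb.-integrable (@Rpos R) (EFin \o f)).
Notation Re := complex.Re.
Notation Im := complex.Im.
Local Notation w := (omega T).
Local Notation K := (mathieu w).
Implicit Types (f g : R -> C) (u v h : R -> R) (l : C).

Let w_gt0 : 0 < w. Proof. by rewrite divr_gt0// mulr_gt0// pi_gt0. Qed.

Let ReF f t := Re (f t).
Let ImF f t := Im (f t).

Lemma inL2E f : inL2 f <-> L2pos (ReF f) /\ L2pos (ImF f).
Proof.
split.
  move=> [m1 [m2 i]]; split; split => //.
  - apply: (le_integrable (@measurable_Rpos R) _ _ i).
      by apply/measurable_EFinP; exact: measurable_funX.
    by move=> t _ /=; rewrite lee_fin !ger0_norm ?addr_ge0 ?sqr_ge0// lerDl sqr_ge0.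
  - apply: (le_integrable (@measurable_Rpos R) _ _ i).
      by apply/measurable_EFinP; exact: measurable_funX.
    by move=> t _ /=; rewrite lee_fin !ger0_norm ?addr_ge0 ?sqr_ge0// lerDr sqr_ge0.
move=> [[m1 i1] [m2 i2]]; split => //; split => //.
by have := integrableD (@measurable_Rpos R) i1 i2.
Qed.

(* H(0) is [lower] after [lift], and [lift] after [lower] is [K]. *)
Let lift h := laplace (to_line h).
Let lower u := of_line (laplace (fun y => cos (w * y) * u y)).

Let square_lift h : L2pos h -> square_mfun (lift h).
Proof. by move=> /L2fun_to_line/square_mfun_laplace. Qed.

Let square_cos u : square_mfun u -> square_mfun (fun y => cos (w * y) * u y).
Proof. exact: square_mfun_cosM. Qed.

Let L2pos_lower u : square_mfun u -> L2pos (lower u).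
Proof.
by move=> su; apply/L2pos_of_line/L2fun_square/square_mfun_laplace/L2fun_square/square_cos.
Qed.

Let lift_lower u : square_mfun u -> lift (lower u) = K u.
Proof.
move=> su; have sc := square_cos su; apply/funext => x.
rewrite /lift /lower of_lineK laplace_laplace//; first by case: sc.
exact: L2fun_square.
Qed.

Let hankelE h t : 0 < t -> L2pos h -> hankel T h t = lower (lift h) t.
Proof. exact: hankel_of_line. Qed.

Let lower0 t : lower (fun=> 0) t = 0.
Proof.
rewrite /lower /of_line /laplace /Rintegral integral0_eq ?mulr0// => s _.
by rewrite !mulr0.
Qed.

Let L2pos_comb k1 k2 h1 h2 : L2pos h1 -> L2pos h2 -> L2pos (fun t => k1 * h1 t + k2 * h2 t).
Proof.
move=> L1 L2; have := L2pos_lin k1 L1 (L2pos_lin (k2 - 1) L2 L2).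
by congr L2pos; apply/funext => t; ring.
Qed.

Let lift_comb k1 k2 h1 h2 x : L2pos h1 -> L2pos h2 ->
  lift (fun t => k1 * h1 t + k2 * h2 t) x = k1 * lift h1 x + k2 * lift h2 x.
Proof.
move=> L1 L2; have L3 := L2pos_lin (k2 - 1) L2 L2.
have -> : (fun t => k1 * h1 t + k2 * h2 t) = (fun t => k1 * h1 t + ((k2 - 1) * h2 t + h2 t)).
  by apply/funext => t; ring.
by rewrite /lift !laplace_lin//; ring.
Qed.

Let MHE f t : 0 < t -> L2pos (ReF f) -> L2pos (ImF f) ->
  MH T 0 f t = complex.Complex (lower (lift (ReF f)) t) (lower (lift (ImF f)) t).
Proof. by move=> t0 L1 L2; rewrite -!hankelE. Qed.

Let Rpos_gt0 t : @Rpos R t -> 0 < t.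
Proof. by rewrite /Rpos/= in_itv/= andbT. Qed.

(** If [H f = l f], then [lift f] solves the eigenvalue equation of [K], so it is 0, and
    [l f = lower (lift f) = 0]. For the equation with right side [g], solve [(K - l) u = lift g] and
    take [f = (lower u - g) / l]; then [lift f = u], and [H f - l f = g] follows. *)
Lemma regular_resolvent l : l != 0 -> regular (@csquare R) (cmap K) l -> ~ in_spectrum T 0 l.
Proof.
move=> l0 [inj surj]; apply; split.
- move=> f /inL2E[L1 L2] H.
  pose u x : C := complex.Complex (lift (ReF f) x) (lift (ImF f) x).
  have su : csquare u by split; exact: square_lift.
  (* Applies [lift] to one real component of the almost-everywhere equation and obtains it at every
     point. *)
  have key h k1 k2 : L2pos h -> (forall t, 0 < t -> lower (lift h) t <> k1 * ReF f t + k2 * ImF f t ->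
      MH T 0 f t - l * f t <> 0) -> forall x, K (lift h) x = k1 * lift (ReF f) x + k2 * lift (ImF f) x.
    move=> Lh ne x; rewrite -lift_lower; last exact: square_lift.
    rewrite -lift_comb//; apply: laplace_ae; [exact/L2pos_lower/square_lift|exact: L2pos_comb|].
    apply: negligibleS H => t /= [tp E]; split => //; apply: ne E; exact: Rpos_gt0.
  have E1 := key (ReF f) (Re l) (- Im l) L1; have E2 := key (ImF f) (Im l) (Re l) L2.
  have u0 : u = (fun=> 0).
    apply: inj => //; apply/funext => x; apply: complexP; rewrite ?ReM ?ImM/=.
      rewrite E1 ?mulNr// => t t0 ne; rewrite MHE// => /(congr1 (@complex.Re R)).
      by rewrite ReD ReN ReM/= => /eqP; rewrite subr_eq0 => /eqP E; apply: ne; rewrite E mulNr.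
    rewrite E2 1?addrC// => t t0 ne; rewrite MHE// => /(congr1 (@complex.Im R)).
    by rewrite ImD ImN ImM/= => /eqP; rewrite subr_eq0 => /eqP E; apply: ne; rewrite E addrC.
  apply: negligibleS H => t /= [tp ft]; split => //.
  have [z1 z2] : lift (ReF f) = (fun=> 0) /\ lift (ImF f) = (fun=> 0).
    have ux x : u x = 0 by rewrite u0.
    by split; apply/funext => x; [have /(congr1 (@complex.Re R)) := ux x|have /(congr1 (@complex.Im R)) := ux x].
  rewrite MHE ?Rpos_gt0// z1 z2 !lower0 => E; apply: ft; apply: (mulfI l0).
  by move/eqP: E; rewrite subr_eq0 mulr0 => /eqP <-.
- move=> g /inL2E[L1 L2].
  have [u [s1 s2] uE] := surj (fun x => complex.Complex (lift (ReF g) x) (lift (ImF g) x))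
    (conj (square_lift L1) (square_lift L2)).
  pose m := l^-1; have ml : m * l = 1 by rewrite mulVf.
  pose U t : C := complex.Complex (lower (ReF u) t) (lower (ImF u) t).
  pose f t := m * (U t - g t).
  have LA1 := L2pos_comb 1 (-1) (L2pos_lower s1) L1; have LA2 := L2pos_comb 1 (-1) (L2pos_lower s2) L2.
  have fRe : ReF f = (fun t => Re m * (1 * lower (ReF u) t + -1 * ReF g t) +
      - Im m * (1 * lower (ImF u) t + -1 * ImF g t)).
    by apply/funext => t; rewrite /ReF /f ReM ReD ImD ReN ImN/= /ImF; ring.
  have fIm : ImF f = (fun t => Im m * (1 * lower (ReF u) t + -1 * ReF g t) +
      Re m * (1 * lower (ImF u) t + -1 * ImF g t)).
    by apply/funext => t; rewrite /ImF /f ImM ReD ImD ReN ImN/= /ReF; ring.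
  have Lf1 : L2pos (ReF f) by rewrite fRe; exact: L2pos_comb.
  have Lf2 : L2pos (ImF f) by rewrite fIm; exact: L2pos_comb.
  have mu x : u x = m * (cmap K u x - complex.Complex (lift (ReF g) x) (lift (ImF g) x)).
    have /= <- := congr1 (fun p : R -> C => p x) uE.
    by rewrite opprB addrCA subrr addr0 mulrA ml mul1r.
  have l1 : lift (ReF f) = ReF u.
    apply/funext => x; rewrite fRe !lift_comb//; try exact: L2pos_lower.
    rewrite !lift_lower// {3}/ReF mu ReM ReD ImD ReN ImN/=; ring.
  have l2 : lift (ImF f) = ImF u.
    apply/funext => x; rewrite fIm !lift_comb//; try exact: L2pos_lower.
    rewrite !lift_lower// {3}/ImF mu ImM ReD ImD ReN ImN/=; ring.
  exists f; first exact/inL2E.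
  rewrite /aeq (_ : [set t | _] = set0); first exact: negligible_set0.
  apply/seteqP; split => t //= [tp]; apply; rewrite MHE ?Rpos_gt0// l1 l2.
  by rewrite -/(U t) /f mulrA (mulrC l) ml mul1r opprB addrC subrK.
Qed.

Let Q := expR (pi * w).

Definition level n : R := pi * expR (- (pi * w / 2)) * Q^-1 ^+ n.

Lemma level_gt0 n : 0 < level n.
Proof. by rewrite /level !mulr_gt0 ?exprn_gt0 ?invr_gt0 ?expR_gt0 ?pi_gt0. Qed.

Lemma realCX (x : R) k : complex.Complex x 0 ^+ k = complex.Complex (x ^+ k) 0.
Proof.
elim: k => [|k IH]; first by rewrite !expr0.
by rewrite !exprS IH; apply: complexP; rewrite ?ReM ?ImM/=; ring.
Qed.

(** Outside the values excluded by [regular_mathieu] the resolvent exists; at an excluded value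
    [l^2] is the square of a level. *)
Lemma spectrum_level l : l != 0 -> in_spectrum T 0 l ->
  exists n (e : R), (e = 1 \/ e = -1) /\ l = complex.Complex (e * level n) 0.
Proof.
move=> l0; have [[n ln] _|H] := pselect (exists n,
  complex.Complex Q 0 ^+ n.*2.+1 * l ^+ 2 = complex.Complex (pi ^+ 2) 0); last first.
  move=> sp; exfalso; apply: (regular_resolvent l0 _ sp); apply: regular_mathieu => // n.
  by apply/eqP => E; apply: H; exists n.
have Q0 : 0 < Q by exact: expR_gt0.
have QC0 : complex.Complex Q 0 != 0 by apply/eqP => -[/eqP]; rewrite gt_eqF.
have lv : Q ^+ n.*2.+1 * level n ^+ 2 = pi ^+ 2.
  have Eh : expR (- (pi * w / 2)) ^+ 2 = Q^-1.
    by rewrite -expRM_natl -expRN; congr expR; field.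
  rewrite /level !exprMn Eh exprS -exprM muln2 exprVn.
  by field; rewrite expf_neq0 gt_eqF.
have : l ^+ 2 = complex.Complex (level n) 0 ^+ 2.
  by apply: (mulfI (expf_neq0 n.*2.+1 QC0)); rewrite ln !realCX -lv; apply: complexP; rewrite ?ReM ?ImM/=; ring.
move=> /eqP; rewrite eqf_sqr => /orP[]/eqP ->; exists n.
  by exists 1; split; [left|rewrite mul1r].
exists (-1); split; first by right.
by apply: complexP; rewrite ?ReN ?ImN/= ?mulN1r ?oppr0.
Qed.

Let lower_lin k u t : square_mfun u -> lower (fun x => k * u x) t = k * lower u t.
Proof.
move=> su; rewrite /lower /of_line [RHS]mulrCA -(laplaceZ k _ (L2fun_square (square_cos su))).
by congr (_ * laplace _ _); apply/funext => y; rewrite mulrCA.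
Qed.

Let lift0 : lift (fun=> 0) = (fun=> 0).
Proof.
apply/funext => x; rewrite /lift /laplace /Rintegral integral0_eq// => s _.
by rewrite /to_line !mulr0.
Qed.

Let L2pos0 : L2pos (fun=> 0 : R).
Proof.
have L := L2pos_lower (square_mfun_ground w_gt0 0).
have := L2pos_comb 0 0 L L; congr L2pos; apply/funext => t; ring.
Qed.

Let lift_sum m (a : 'I_m -> R) (h : 'I_m -> R -> R) : (forall i, L2pos (h i)) ->
  L2pos (fun t => \sum_(i < m) a i * h i t) /\
  forall x, lift (fun t => \sum_(i < m) a i * h i t) x = \sum_(i < m) a i * lift (h i) x.
Proof.
elim: m a h => [|m IH] a h Lh.
  split; first by under eq_fun do rewrite big_ord0.
  by move=> x; rewrite big_ord0; under [X in lift X]eq_fun do rewrite big_ord0; rewrite lift0.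
have [L E] := IH (fun i => a (widen_ord (leqnSn m) i)) (fun i => h (widen_ord (leqnSn m) i)) (fun i => Lh _).
have sE : (fun t => \sum_(i < m.+1) a i * h i t) =
    (fun t => 1 * (\sum_(i < m) a (widen_ord (leqnSn m) i) * h (widen_ord (leqnSn m) i) t) +
      a ord_max * h ord_max t).
  by apply/funext => t; rewrite big_ord_recr/= mul1r.
rewrite sE; split; first exact: L2pos_comb.
by move=> x; rewrite lift_comb// E mul1r big_ord_recr.
Qed.

Lemma eigenvalue_level n (e : R) : e = 1 \/ e = -1 ->
  eigenvalue_infinite_mult T 0 (complex.Complex (e * level n) 0).
Proof.
move=> e1 m.
have wT : w * T = pi *+ 2 by rewrite /omega divfK ?gt_eqF// mulr_natl.
(* The sign [e] decides the coset of centres: multiples of the period for [e = 1], shifted by half a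
   period for [e = -1]. Each coset is infinite, whence the infinite multiplicity. *)
have [b0 [cb0 sb0]] : exists b0, cos (w * b0) = e /\ sin (w * b0) = 0.
  case: e1 => ->; first by exists 0; rewrite mulr0 cos0 sin0.
  exists (T / 2); have -> : w * (T / 2) = pi by rewrite mulrA wT mulr2n; field.
  by rewrite cospi sinpi.
pose b (i : 'I_m) := b0 + i%:R * T.
have wb i : w * b i = w * b0 + pi *+ 2 *+ i.
  by rewrite /b mulrDr (mulrCA w) wT mulr_natl.
have cb i : cos (w * b i) = e by rewrite wb (periodicn (@cosD2pi R)).
have sb i : sin (w * b i) = 0 by rewrite wb (periodicn (@sinD2pi R)).
have e2 : e ^+ 2 = 1 by case: e1 => ->; rewrite ?sqrrN expr1n.
pose v i := excited w n (b i).
have sv i : square_mfun (v i) by exact: square_mfun_excited.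
have Kv i : K (v i) = (fun x => e * level n * v i x) by exact: mathieu_excited.
have Lv i := L2pos_lower (sv i).
(* Eigenfunctions of [K] pass to the half line because [H lower = lower lift lower = lower K]. *)
exists (fun i t => complex.Complex (lower (v i) t) 0); split.
  move=> i; split; first by apply/inL2E; split; [exact: Lv|exact: L2pos0].
  rewrite /aeq (_ : [set t | _] = set0); first exact: negligible_set0.
  apply/seteqP; split => t //= [tp]; apply.
  rewrite (@MHE (fun t => complex.Complex (lower (v i) t) 0) t (Rpos_gt0 tp) (Lv i) L2pos0).
  have -> : ReF (fun t => complex.Complex (lower (v i) t) 0) = lower (v i) by [].
  have -> : ImF (fun t => complex.Complex (lower (v i) t) 0) = (fun=> 0) by [].
  rewrite lift0 lift_lower// Kv lower0 lower_lin//.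
  by apply: complexP; rewrite ?ReM ?ImM/=; ring.
move=> a Ha.
(* A relation between the [lower (v i)] is lifted to one between the [K (v i)], which are the [v i]
   times one common nonzero eigenvalue. *)
have key (d : 'I_m -> R) : leb.-negligible [set t | @Rpos R t /\ \sum_(i < m) d i * lower (v i) t <> 0] ->
    forall i, d i = 0.
  move=> Hd; have [L E] := lift_sum d Lv.
  apply: (@free_excited R w w_gt0 n m d b0 T e) => //; first by rewrite gt_eqF.
  move=> x; have := laplace_ae x L L2pos0 Hd; rewrite -/(lift _) -/(lift _) lift0 E.
  under eq_bigr do rewrite lift_lower// Kv mulrCA.
  rewrite -mulr_sumr => /eqP; rewrite mulf_eq0 mulf_eq0 (gt_eqF (level_gt0 n)) orbF.
  by case: e1 => ->; rewrite ?oppr_eq0 oner_eq0 => /eqP.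
have ReS (t : R) : Re (\sum_(i < m) a i * complex.Complex (lower (v i) t) 0) =
    \sum_(i < m) Re (a i) * lower (v i) t.
  rewrite (big_morph (@complex.Re R) (@ReD R) (erefl _)); apply: eq_bigr => i _.
  by rewrite ReM/= mulr0 subr0.
have ImS (t : R) : Im (\sum_(i < m) a i * complex.Complex (lower (v i) t) 0) =
    \sum_(i < m) Im (a i) * lower (v i) t.
  rewrite (big_morph (@complex.Im R) (@ImD R) (erefl _)); apply: eq_bigr => i _.
  by rewrite ImM/= mulr0 add0r.
move=> i; apply: complexP.
  apply: (key (fun i => Re (a i))); apply: negligibleS Ha => t /= [tp ne]; split => // E.
  by apply: ne; rewrite -ReS E.
apply: (key (fun i => Im (a i))); apply: negligibleS Ha => t /= [tp ne]; split => // E.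
by apply: ne; rewrite -ImS E.
Qed.

Lemma eigenvalue_in_spectrum l : eigenvalue_infinite_mult T 0 l -> in_spectrum T 0 l.
Proof.
move=> /(_ 1%N)[F [FE Ffree]] [inj _].
have [F2 Fl] := FE ord0.
have F0 := inj _ F2.
have : aeq (F ord0) (fun=> 0).
  apply: F0; apply: negligibleS Fl => t /= [tp ne]; split => // E.
  by apply: ne; rewrite E subrr.
move=> H; have : (1 : C) = 0.
  apply: (Ffree (fun=> 1) _ ord0); apply: negligibleS H => t /= [tp]; rewrite big_ord1 mul1r.
  by split.
by move=> /eqP; rewrite oner_eq0.
Qed.

End Spectrum.

Theorem theorem8p1 (R : realType) (T : R) (hT : 0 < T) :
  let S := [set lam : complex R | lam != 0 /\ in_spectrum T 0 lam] in
  (forall lam, S lam -> eigenvalue_infinite_mult T 0 lam) /\ infinite_set S.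
Proof.
move=> S; split.
  move=> l [l0 /(spectrum_level hT l0)[n [e [e1 ->]]]].
  exact: eigenvalue_level.
(* The positive levels alone make the set infinite; they are distinct because [Q^-1 < 1]. *)
pose f n : complex R := complex.Complex (level T n) 0.
have fS n : S (f n).
  split; first by apply/eqP => -[/eqP]; rewrite gt_eqF// level_gt0.
  apply: eigenvalue_in_spectrum => //.
  have := eigenvalue_level hT n (or_introl (erefl 1)); by rewrite mul1r.
have finj : injective f.
  move=> m n [E]; have Q0 : 0 < (expR (pi * omega T))^-1 by rewrite invr_gt0 expR_gt0.
  apply: (ieexprIn Q0).
    by rewrite lt_eqF// invf_lt1 ?expR_gt0// -expR0 ltr_expR mulr_gt0 ?pi_gt0// divr_gt0// mulr_gt0// pi_gt0.
  by apply: mulfI E; rewrite gt_eqF// mulr_gt0 ?pi_gt0 ?expR_gt0.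
move=> Sf; apply: infinite_nat.
rewrite (_ : [set: nat] = f @^-1` S).
  by apply: finite_preimage Sf => m n _ _; exact: finj.
by apply/seteqP; split => n // _; exact: fS.
Qed.
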